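(* Let $F$ be a differential field with field of constants $C$ and let $E/F$ be a full $G$-primitive Picard-Vessiot extension with matrix $Y\in G(E)$. Then there are elements $\boldsymbol x=(x_1,\dots,x_m)$, $\boldsymbol z=(z_1,\dots,z_l)$ and $\boldsymbol y=(y_1,\dots,y_m)$ of $E$, algebraically independent over $F$, such that $$Y=\boldsymbol u(\boldsymbol x)\,n(\bar w)\,\boldsymbol t(\boldsymbol z)\,\boldsymbol u(\boldsymbol y).$$
   Context: $C$ is an algebraically closed field of characteristic zero; $G\subseteq\mathrm{GL}_n$ is one of the (connected) classical groups over $C$, $l$ its Lie rank, $\mathfrak g$ its Lie algebra. Fix a maximal torus $T$ with Lie algebra $\mathfrak h$, root system $\Phi=\Phi^+\cup\Phi^-$ with basis $\{\bar\alpha_1,\dots,\bar\alpha_l\}$, $m=|\Phi^-|$, and a Chevalley basis $\{H_1,\dots,H_l\}\cup\{X_\alpha\mid\alpha\in\Phi\}$ of $\mathfrak g$. The negative roots are numbered $\beta_1,\dots,\beta_m$ with $\mathrm{ht}(\beta_i)\ge\mathrm{ht}(\beta_{i+1})$, where $\mathrm{ht}(\sum k_i\bar\alpha_i)=\sum k_i$. $u_i(x)=\exp(xX_{\beta_i})$ parametrizes the root group $U_i$ of $\beta_i$ and $\boldsymbol u(\boldsymbol x)=u_1(x_1)\cdots u_m(x_m)$. $T_i\subseteq T$ is the one-dimensional torus with Lie algebra $\langle H_i\rangle$, $z\mapsto t_i(z)$ is an isomorphism $\mathbb G_m\to T_i$, and $\boldsymbol t(\boldsymbol z)=t_1(z_1)\cdots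 t_l(z_l)$; the product map $T_1\times\dots\times T_l\to T$ is assumed to be an isomorphism. $\bar w$ is the longest Weyl group element and $n(\bar w)\in N_G(T)(C)$ a fixed representative. $\ell\delta(g)=\partial(g)g^{-1}$. A Picard-Vessiot extension $E/F$ is called full $G$-primitive if its differential Galois group is $G(C)$ and there is a matrix $Y\in G(E)$ whose entries generate $E$ over $F$ and which satisfies $\ell\delta(Y)\in\mathfrak g(F)$. *)

(* Defs.v *)
From HB Require Import structures.
From mathcomp Require Export mpoly.
From mathcomp Require Export all_boot all_order all_algebra.

Set Implicit Arguments.
Unset Strict Implicit.
Unset Printing Implicit Defensive.

Export GRing.Theory.
Global Open Scope ring_scope.

(** * Linear algebraic groups over an algebraically closed field [C]

   An algebraic subset of GL_n is given by its set [S] of [C]-points; the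
   n * n variables of a polynomial are the matrix entries, in the order of
   [mxvec]. *)

Definition mxeval (C K : fieldType) (i : C -> K) (n : nat)
    (p : {mpoly C[n * n]}) (A : 'M[K]_n) : K :=
  mmap i (fun k => mxvec A 0 k) p.

Definition vanishing (C : fieldType) (n : nat) (S : 'M[C]_n -> Prop)
    (p : {mpoly C[n * n]}) : Prop :=
  forall g, S g -> mxeval idfun p g = 0.

(* [S](K) for a field extension i : C -> K, where [S] is a Zariski closed
   subset of GL_n(C). *)
Definition points (C K : fieldType) (i : C -> K) (n : nat)
    (S : 'M[C]_n -> Prop) (g : 'M[K]_n) : Prop :=
  g \in unitmx /\ forall p, vanishing S p -> mxeval i p g = 0.

(* Lie(S)(K): the Zariski tangent space of [S] at the identity, with
   coefficients extended to K. *)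
Definition lie (C K : fieldType) (i : C -> K) (n : nat)
    (S : 'M[C]_n -> Prop) (A : 'M[K]_n) : Prop :=
  forall p, vanishing S p ->
    \sum_k mxeval i (mderiv k p) 1%:M * mxvec A 0 k = 0.

Definition algebraic_subgroup (C : fieldType) (n : nat)
    (S : 'M[C]_n -> Prop) : Prop :=
  [/\ forall g, S g <-> points idfun S g,
      S 1%:M,
      forall g h, S g -> S h -> S (g *m h)
    & forall g, S g -> S (invmx g)].

(** ** Tori *)

(* Points of the split torus Gm^r. *)
Definition Gm (K : fieldType) (r : nat) (z : 'rV[K]_r) : Prop :=
  forall i, z 0 i != 0.

(* A morphism from Gm^r to n x n matrices: each entry of [f] is a Laurent
   polynomial, written as a polynomial in the r coordinates of z followed by
   their r inverses. *)
Definition laurent_eval (C K : fieldType) (i : C -> K) (r n : nat)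
    (f : 'M[{mpoly C[r + r]}]_n) (z : 'rV[K]_r) : 'M[K]_n :=
  map_mx (mmap i (fun k => row_mx z (map_mx GRing.inv z) 0 k)) f.

(* [f] is an isomorphism of algebraic groups from Gm^r onto the closed
   subgroup [S] of GL_n; a regular function on [S] is a polynomial in the
   entries divided by a power of the determinant. *)
Definition torus_iso (C : fieldType) (r n : nat)
    (f : 'rV[C]_r -> 'M[C]_n) (S : 'M[C]_n -> Prop) : Prop :=
  [/\ algebraic_subgroup S,
      exists P : 'M[{mpoly C[r + r]}]_n,
        forall z, Gm z -> f z = laurent_eval idfun P z,
      forall y z, Gm y -> Gm z -> f (\row_k (y 0 k * z 0 k)) = f y *m f z,
      forall g, S g <-> exists2 z, Gm z & g = f z
    & exists (q : 'I_r -> {mpoly C[n * n]}) (e : nat), forall z, Gm z ->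
        forall k, z 0 k = mxeval idfun (q k) (f z) / (\det (f z)) ^+ e].

Definition is_torus (C : fieldType) (n : nat) (S : 'M[C]_n -> Prop) : Prop :=
  exists r, exists f : 'rV[C]_r -> 'M[C]_n, torus_iso f S.

Definition maximal_torus (C : fieldType) (n : nat)
    (G T : 'M[C]_n -> Prop) : Prop :=
  [/\ is_torus T, forall g, T g -> G g
    & forall T' : 'M[C]_n -> Prop, is_torus T' ->
        (forall g, T' g -> G g) -> (forall g, T g -> T' g) ->
        forall g, T' g -> T g].

(** ** The classical groups of rank l *)

Definition SO_of (C : fieldType) (n : nat) (J g : 'M[C]_n) : Prop :=
  g^T *m J *m g = J /\ \det g = 1.

Definition Sp_of (C : fieldType) (n : nat) (J g : 'M[C]_n) : Prop :=
  g^T *m J *m g = J.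

(* SL_(l+1), SO_(2l+1), Sp_(2l) and SO_(2l), the latter three with respect to
   an arbitrary nondegenerate (symmetric, resp. alternating) bilinear form.
   SO_2 is a torus, hence the bound 1 < l in the last case. *)
Definition classical_group (C : fieldType) (l n : nat)
    (G : 'M[C]_n -> Prop) : Prop :=
  [\/ [/\ (0 < l)%N, n = l.+1 & forall g, G g <-> \det g = 1],
      [/\ (0 < l)%N, n = (2 * l).+1
        & exists J : 'M[C]_n, [/\ J^T = J, J \in unitmx
            & forall g, G g <-> SO_of J g]],
      [/\ (0 < l)%N, n = (2 * l)%N
        & exists J : 'M[C]_n, [/\ J^T = - J, J \in unitmx
            & forall g, G g <-> Sp_of J g]]
    | [/\ (1 < l)%N, n = (2 * l)%N
        & exists J : 'M[C]_n, [/\ J^T = J, J \in unitmx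
            & forall g, G g <-> SO_of J g]]].

(** * Roots and Chevalley bases

   [g] is the Lie algebra of the group, [h] that of the maximal torus. *)

Definition bracket (C : fieldType) (n : nat) (A B : 'M[C]_n) : 'M[C]_n :=
  A *m B - B *m A.

Notation dualv h := 'Hom(subvs_of h, _^o).

Definition root_space (C : fieldType) (n : nat) (g h : {vspace 'M[C]_n})
    (a : dualv h) (A : 'M[C]_n) : Prop :=
  A \in g /\ forall B : subvs_of h, bracket (vsval B) A = a B *: A.

Definition is_root (C : fieldType) (n : nat) (g h : {vspace 'M[C]_n})
    (a : dualv h) : Prop :=
  a != 0 /\ exists2 A, A != 0 & root_space g a A.

Definition root_system (C : fieldType) (n : nat) (g h : {vspace 'M[C]_n})
    (Phi : seq (dualv h)) : Prop :=
  uniq Phi /\ forall a, a \in Phi <-> is_root g a.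

(* [k a i] is the coefficient of the root [a] at the simple root [Delta i]. *)
Definition root_basis (C : fieldType) (n l : nat) (h : {vspace 'M[C]_n})
    (Phi : seq (dualv h)) (Delta : 'I_l -> dualv h)
    (k : dualv h -> 'I_l -> int) : Prop :=
  [/\ forall i, Delta i \in Phi,
      free [seq Delta i | i <- enum 'I_l]
    & forall a, a \in Phi ->
        a = \sum_i Delta i *~ k a i
        /\ ((forall i, 0 <= k a i) \/ (forall i, k a i <= 0))].

Definition negative_root (V : Type) (l : nat) (k : V -> 'I_l -> int) (a : V) :
    bool :=
  [forall i, k a i <= 0].

Definition height (V : Type) (l : nat) (k : V -> 'I_l -> int) (a : V) : int :=
  \sum_i k a i.

Definition negative_root_numbering (C : fieldType) (n l m : nat)
    (h : {vspace 'M[C]_n}) (Phi : seq (dualv h))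
    (k : dualv h -> 'I_l -> int) (beta : m.-tuple (dualv h)) : Prop :=
  perm_eq beta [seq a <- Phi | negative_root k a]
  /\ sorted (fun a b => height k b <= height k a) beta.

(* The coroot of a root [a]: the element of [g_a, g_(-a)] at which [a] takes
   the value 2 (root spaces are lines, so brackets already form a subspace). *)
Definition coroot (C : fieldType) (n : nat) (g h : {vspace 'M[C]_n})
    (a : dualv h) (H : subvs_of h) : Prop :=
  a H = 2%:R /\ exists A B,
    [/\ root_space g a A, root_space g (- a) B & vsval H = bracket A B].

(* As in Humphreys, "Introduction to Lie algebras and representation theory",
   25.2; only the values of [X] on [Phi] matter. *)
Definition chevalley_basis (C : fieldType) (n l : nat)
    (g h : {vspace 'M[C]_n}) (Phi : seq (dualv h)) (Delta : 'I_l -> dualv h)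
    (H : 'I_l -> subvs_of h) (X : dualv h -> 'M[C]_n) : Prop :=
  [/\ basis_of g ([seq vsval (H i) | i <- enum 'I_l] ++ [seq X a | a <- Phi]),
      forall i, coroot g (Delta i) (H i),
      forall a, a \in Phi -> root_space g a (X a),
      forall a, a \in Phi ->
        exists2 Ha, coroot g a Ha & bracket (X a) (X (- a)) = vsval Ha
    & forall a b, a \in Phi -> b \in Phi -> a + b \in Phi ->
        forall c, bracket (X a) (X b) = c *: X (a + b) ->
        bracket (X (- a)) (X (- b)) = - c *: X (- (a + b))].

(** ** The Weyl group, acting on the dual of [h] *)

Definition simple_reflection (C : fieldType) (n l : nat)
    (h : {vspace 'M[C]_n}) (Delta : 'I_l -> dualv h) (H : 'I_l -> subvs_of h)
    (i : 'I_l) (a : dualv h) : dualv h :=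
  a - ((a (H i) : C) *: Delta i : dualv h).

Definition weyl_word (C : fieldType) (n l : nat) (h : {vspace 'M[C]_n})
    (Delta : 'I_l -> dualv h) (H : 'I_l -> subvs_of h) (s : seq 'I_l) :
    dualv h -> dualv h :=
  foldr (fun i w => simple_reflection Delta H i \o w) id s.

Definition weyl_length (C : fieldType) (n l : nat) (h : {vspace 'M[C]_n})
    (Delta : 'I_l -> dualv h) (H : 'I_l -> subvs_of h)
    (w : dualv h -> dualv h) (d : nat) : Prop :=
  (exists2 s, size s = d & w =1 weyl_word Delta H s)
  /\ forall s, w =1 weyl_word Delta H s -> (d <= size s)%N.

Definition longest (C : fieldType) (n l : nat) (h : {vspace 'M[C]_n})
    (Delta : 'I_l -> dualv h) (H : 'I_l -> subvs_of h)
    (w : dualv h -> dualv h) : Prop :=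
  exists2 d, weyl_length Delta H w d
    & forall w' d', weyl_length Delta H w' d' -> (d' <= d)%N.

(* [nw] lies in N_G(T)(C) and induces [w], that is (w a)(A) = a(nw^-1 A nw);
   as [nw] normalizes [T], nw^-1 A nw lies in [h] and [vsproj] only retypes
   it. *)
Definition weyl_representative (C : fieldType) (n : nat)
    (G T : 'M[C]_n -> Prop) (h : {vspace 'M[C]_n}) (w : dualv h -> dualv h)
    (nw : 'M[C]_n) : Prop :=
  [/\ G nw,
      forall t, T t <-> T (nw *m t *m invmx nw)
    & forall (a : dualv h) (A : subvs_of h),
        w a A = a (vsproj h (invmx nw *m vsval A *m nw))].

(** * The parametrizations u and t, over an extension i : C -> K *)

(* exp of a nilpotent n x n matrix: the powers from the n-th on vanish. *)
Definition expmx (K : fieldType) (n : nat) (A : 'M[K]_n) : 'M[K]_n :=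
  \sum_(j < n) (j`!%:R)^-1 *: (A ^+ j).

Definition umap (C K : fieldType) (i : C -> K) (n m : nat)
    (h : {vspace 'M[C]_n}) (X : dualv h -> 'M[C]_n)
    (beta : m.-tuple (dualv h)) (x : 'rV[K]_m) : 'M[K]_n :=
  \prod_(j < m) expmx (x 0 j *: map_mx i (X (tnth beta j))).

Definition tmap (C K : fieldType) (i : C -> K) (n l : nat)
    (t : 'I_l -> 'M[{mpoly C[1 + 1]}]_n) (z : 'rV[K]_l) : 'M[K]_n :=
  \prod_(j < l) laurent_eval i (t j) (const_mx (z 0 j) : 'rV[K]_1).

(* [Ti j] is the one-dimensional torus in [T] with Lie algebra spanned by
   [H j], [t j] an isomorphism from Gm onto it, and multiplication
   Ti 0 x ... x Ti (l - 1) -> T, written in the coordinates provided by the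
   [t j], is an isomorphism. *)
Definition torus_parametrization (C : fieldType) (n l : nat)
    (T : 'M[C]_n -> Prop) (h : {vspace 'M[C]_n}) (H : 'I_l -> subvs_of h)
    (Ti : 'I_l -> 'M[C]_n -> Prop) (t : 'I_l -> 'M[{mpoly C[1 + 1]}]_n) :
    Prop :=
  [/\ forall j g, Ti j g -> T g,
      forall j, torus_iso (laurent_eval idfun (t j)) (Ti j),
      forall j (A : 'M[C]_n),
        lie idfun (Ti j) A <-> exists c, A = c *: vsval (H j)
    & torus_iso (tmap idfun t) T].

(** * Differential fields and Picard-Vessiot extensions *)

Definition derivation (K : fieldType) (d : K -> K) : Prop :=
  (forall a b, d (a + b) = d a + d b)
  /\ (forall a b, d (a * b) = d a * b + a * d b).

Definition has_constants (C K : fieldType) (d : K -> K) (i : C -> K) : Prop :=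
  forall a, d a = 0 <-> exists c, a = i c.

Definition differential_extension (F E : fieldType) (dF : F -> F)
    (dE : E -> E) (i : F -> E) : Prop :=
  derivation dE /\ forall a, dE (i a) = i (dF a).

(* The entries of [Z] generate the field E over F. *)
Definition generates (F E : fieldType) (i : F -> E) (n : nat)
    (Z : 'M[E]_n) : Prop :=
  forall S : {pred E}, GRing.divring_closed S ->
    (forall a, i a \in S) -> (forall j k, Z j k \in S) -> forall e, e \in S.

Definition picard_vessiot (C F E : fieldType) (jC : {rmorphism C -> F})
    (dF : F -> F) (dE : E -> E) (i : {rmorphism F -> E}) : Prop :=
  [/\ differential_extension dF dE i,
      has_constants dE (i \o jC)
    & exists (N : nat) (A : 'M[F]_N) (Z : 'M[E]_N),
        [/\ Z \in unitmx, map_mx dE Z = map_mx i A *m Z & generates i Z]].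

Definition diff_galois (F E : fieldType) (dE : E -> E) (i : F -> E)
    (s : {rmorphism E -> E}) : Prop :=
  [/\ bijective s, forall a, s (i a) = i a & forall e, s (dE e) = dE (s e)].

Definition logder (K : fieldType) (d : K -> K) (n : nat) (g : 'M[K]_n) :
    'M[K]_n :=
  map_mx d g *m invmx g.

(* The differential Galois group is identified with a subgroup of GL_n(C) by
   means of [Y]: s corresponds to the matrix g with s(Y) = Y g. *)
Definition full_primitive (C F E : fieldType) (jC : {rmorphism C -> F})
    (dF : F -> F) (dE : E -> E) (i : {rmorphism F -> E}) (n : nat)
    (G : 'M[C]_n -> Prop) (Y : 'M[E]_n) : Prop :=
  [/\ picard_vessiot jC dF dE i,
      forall g : 'M[C]_n, G g <->
        exists2 s : {rmorphism E -> E}, diff_galois dE i s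
          & map_mx s Y = Y *m map_mx (i \o jC) g,
      points (i \o jC) G Y,
      generates i Y
    & exists2 A : 'M[F]_n, lie jC G A & logder dE Y = map_mx i A].

Definition algebraically_independent (F E : fieldType) (i : F -> E) (N : nat)
    (v : 'rV[E]_N) : Prop :=
  forall p : {mpoly F[N]}, mmap i (fun k => v 0 k) p = 0 -> p = 0.

(* Main.v *)
(** Diagonalize the torus and order its weights by a generic functional which is
    positive on the simple roots. After translation by n(w)^-1, the big cell
    U n(w) T U of G becomes the set of matrices of G with an LDU decomposition:
    by uniqueness the factors of the decomposition of an element of G lie in G
    again, the unipotent ones are products of root elements, as one sees by
    removing their leading terms degree by degree, and the diagonal one is a
    value of t. The coordinates x, z, y on the big cell are therefore unique.
    As the Galois group G(C) acts on Y by translations, a polynomial over F which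
    vanishes at Y vanishes on G. Hence the minors of n(w)^-1 Y, which do not
    vanish at n(w), do not vanish at Y, so that Y lies in the big cell. Its
    coordinates are rational functions of Y, so an algebraic relation over F
    between them holds for the coordinates of almost all points of the big cell,
    which are arbitrary; the relation is trivial. *)

From HB Require Import structures.
From Stdlib Require Import Classical ClassicalEpsilon.
Require Import Defs.
From mathcomp Require Import perm ring zify.

Set Implicit Arguments.
Unset Strict Implicit.
Unset Printing Implicit Defensive.

Import Order.TTheory Num.Theory.

(** Two gradings of the matrix indices are needed, because no single one does both jobs. The LDU
    decomposition wants a total order, hence a functional that separates all the weights of the
    standard representation. The numbering [beta] is sorted by height, and the height functional can
    take the same value on distinct weights, as it does on the last weight of SO_(2l) and its
    opposite. A factor is therefore peeled in a generic order, which shows it to be unipotent for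
    the height grading as well, and then again in the order of [beta]. The type of the group enters
    through its weights. [l] of them form a basis of the character lattice, since the product map of
    the [Ti] is an isomorphism; the form and the determinant determine the others. So a diagonal
    solution of the group equations is a value of [t] over any extension, with no extraction of
    roots. [points] refers to all equations over [C] that hold on G(C), while the decomposition is
    made with the form and the determinant alone; polynomial identities over [C] lead from one to
    the other. *)

Lemma mmap_map_mpoly (R S L : comNzRingType) (f : {rmorphism R -> S}) (f' : {rmorphism S -> L})
    N (v : 'I_N -> L) (p : {mpoly R[N]}) :
  mmap f' v (map_mpoly f p) = mmap (f' \o f) v p.
Proof.
rewrite /map_mpoly {2}/mmap raddf_sum /=; apply: eq_bigr => m _.
rewrite rmorphM /= mmapC; congr (_ * _); rewrite rmorph_prod.
by apply: eq_bigr => k _; rewrite rmorphXn /= mmapX mmap1U.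
Qed.

(** * Polynomial functions and base change *)

(* Evaluating in two extensions of [C] simultaneously is what lets identities
   between [C]-points be transferred to points over an extension field. *)
Section PolynomialFunctions.

Variables (C K1 K2 : fieldType).
Variables (i1 : {rmorphism C -> K1}) (i2 : {rmorphism C -> K2}).
Variables (X1 X2 : Type) (N : nat).
Variables (co1 : X1 -> 'I_N -> K1) (co2 : X2 -> 'I_N -> K2).

Definition polyfun (f1 : X1 -> K1) (f2 : X2 -> K2) : Prop :=
  exists p : {mpoly C[N]}, (forall x, mmap i1 (co1 x) p = f1 x)
    /\ (forall x, mmap i2 (co2 x) p = f2 x).

Lemma polyfun_const c : polyfun (fun=> i1 c) (fun=> i2 c).
Proof. by exists c%:MP; split=> x; rewrite mmapC. Qed.

Lemma polyfun_var j : polyfun (co1^~ j) (co2^~ j).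
Proof. by exists 'X_j; split=> x; rewrite mmapX mmap1U. Qed.

Lemma polyfun_ext f1 f2 g1 g2 :
  polyfun f1 f2 -> f1 =1 g1 -> f2 =1 g2 -> polyfun g1 g2.
Proof. by move=> [p [p1 p2]] e1 e2; exists p; split=> x; rewrite ?p1 ?p2. Qed.

Lemma polyfun0 : polyfun (fun=> 0) (fun=> 0).
Proof.
by apply: (polyfun_ext (polyfun_const 0)) => x; rewrite rmorph0.
Qed.

Lemma polyfun1 : polyfun (fun=> 1) (fun=> 1).
Proof.
by apply: (polyfun_ext (polyfun_const 1)) => x; rewrite rmorph1.
Qed.

Lemma polyfunD f1 f2 g1 g2 : polyfun f1 f2 -> polyfun g1 g2 ->
  polyfun (fun x => f1 x + g1 x) (fun x => f2 x + g2 x).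
Proof.
move=> [p [p1 p2]] [q [q1 q2]]; exists (p + q).
by split=> x; rewrite mmapD ?p1 ?q1 ?p2 ?q2.
Qed.

Lemma polyfunM f1 f2 g1 g2 : polyfun f1 f2 -> polyfun g1 g2 ->
  polyfun (fun x => f1 x * g1 x) (fun x => f2 x * g2 x).
Proof.
move=> [p [p1 p2]] [q [q1 q2]]; exists (p * q).
by split=> x; rewrite rmorphM /= ?p1 ?q1 ?p2 ?q2.
Qed.

Lemma polyfunN f1 f2 : polyfun f1 f2 ->
  polyfun (fun x => - f1 x) (fun x => - f2 x).
Proof.
move=> [p [p1 p2]]; exists (- p).
by split=> x; rewrite mmapN ?p1 ?p2.
Qed.

Lemma polyfunB f1 f2 g1 g2 : polyfun f1 f2 -> polyfun g1 g2 ->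
  polyfun (fun x => f1 x - g1 x) (fun x => f2 x - g2 x).
Proof. by move=> hf hg; apply: polyfunD => //; apply: polyfunN. Qed.

Lemma polyfunX f1 f2 k : polyfun f1 f2 ->
  polyfun (fun x => f1 x ^+ k) (fun x => f2 x ^+ k).
Proof.
move=> hf; elim: k => [|k IH]; first exact: polyfun1.
by apply: (polyfun_ext (polyfunM hf IH)) => x; rewrite exprS.
Qed.

Lemma polyfun_sum (T : Type) (r : seq T) (P : pred T) F1 F2 :
  (forall t, P t -> polyfun (F1 t) (F2 t)) ->
  polyfun (fun x => \sum_(t <- r | P t) F1 t x)
          (fun x => \sum_(t <- r | P t) F2 t x).
Proof.
move=> hF; elim: r => [|t r IH].
  by apply: (polyfun_ext polyfun0) => x; rewrite big_nil.
case Pt: (P t); last by apply: (polyfun_ext IH) => x; rewrite big_cons Pt.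
by apply: (polyfun_ext (polyfunD (hF t Pt) IH)) => x; rewrite big_cons Pt.
Qed.

Lemma polyfun_prod (T : Type) (r : seq T) (P : pred T) F1 F2 :
  (forall t, P t -> polyfun (F1 t) (F2 t)) ->
  polyfun (fun x => \prod_(t <- r | P t) F1 t x)
          (fun x => \prod_(t <- r | P t) F2 t x).
Proof.
move=> hF; elim: r => [|t r IH].
  by apply: (polyfun_ext polyfun1) => x; rewrite big_nil.
case Pt: (P t); last by apply: (polyfun_ext IH) => x; rewrite big_cons Pt.
by apply: (polyfun_ext (polyfunM (hF t Pt) IH)) => x; rewrite big_cons Pt.
Qed.

Lemma polyfun_mmap M (p : {mpoly C[M]}) (G1 : X1 -> 'I_M -> K1)
    (G2 : X2 -> 'I_M -> K2) :
  (forall j, polyfun (G1^~ j) (G2^~ j)) ->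
  polyfun (fun x => mmap i1 (G1 x) p) (fun x => mmap i2 (G2 x) p).
Proof.
move=> hG; apply: polyfun_sum => m _; apply: polyfunM.
  exact: polyfun_const.
by apply: polyfun_prod => j _; apply: polyfunX.
Qed.

Definition polymx a b (F1 : X1 -> 'M[K1]_(a, b)) (F2 : X2 -> 'M[K2]_(a, b)) :=
  forall r s, polyfun (fun x => F1 x r s) (fun x => F2 x r s).

Lemma polymx_const a b (A : 'M[C]_(a, b)) :
  polymx (fun=> map_mx i1 A) (fun=> map_mx i2 A).
Proof.
by move=> r s; apply: (polyfun_ext (polyfun_const (A r s))) => x; rewrite mxE.
Qed.

Lemma polymx_mul a b c (F1 : X1 -> 'M_(a, b)) F2 (G1 : X1 -> 'M_(b, c)) G2 :
  polymx F1 F2 -> polymx G1 G2 ->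
  polymx (fun x => F1 x *m G1 x) (fun x => F2 x *m G2 x).
Proof.
move=> hF hG r s.
have h (j : 'I_b) : true -> polyfun (fun x => F1 x r j * G1 x j s)
  (fun x => F2 x r j * G2 x j s) by move=> _; apply: polyfunM.
by apply: (polyfun_ext (polyfun_sum (index_enum _) h)) => x; rewrite mxE.
Qed.

Lemma polymx_tr a b (F1 : X1 -> 'M_(a, b)) F2 :
  polymx F1 F2 -> polymx (fun x => (F1 x)^T) (fun x => (F2 x)^T).
Proof.
move=> hF r s.
by apply: (polyfun_ext (hF s r)) => x; rewrite mxE.
Qed.

Lemma polymx_scale a b f1 f2 (F1 : X1 -> 'M_(a, b)) F2 :
  polyfun f1 f2 -> polymx F1 F2 ->
  polymx (fun x => f1 x *: F1 x) (fun x => f2 x *: F2 x).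
Proof.
move=> hf hF r s.
by apply: (polyfun_ext (polyfunM hf (hF r s))) => x; rewrite mxE.
Qed.

Lemma polyfun_det a (F1 : X1 -> 'M_a) F2 :
  polymx F1 F2 -> polyfun (fun x => \det (F1 x)) (fun x => \det (F2 x)).
Proof.
move=> hF; apply: polyfun_sum => s _; apply: polyfunM.
  by apply: (polyfun_ext (polyfun_const ((-1) ^+ perm.odd_perm s))) => x;
      rewrite rmorphXn rmorphN rmorph1.
by apply: polyfun_prod => j _.
Qed.

Lemma polymx_adj a (F1 : X1 -> 'M_a) F2 :
  polymx F1 F2 -> polymx (fun x => \adj (F1 x)) (fun x => \adj (F2 x)).
Proof.
move=> hF r s.
have hd : polyfun (fun x => \det (row' s (col' r (F1 x))))
                  (fun x => \det (row' s (col' r (F2 x)))).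
  apply: polyfun_det => u v.
  by apply: (polyfun_ext (hF (lift s u) (lift r v))) => x; rewrite !mxE.
apply: (polyfun_ext (polyfunM (polyfun_const ((-1) ^+ (s + r))) hd)) => x;
  by rewrite mxE /cofactor rmorphXn rmorphN rmorph1.
Qed.

End PolynomialFunctions.

Arguments polyfun_const {C K1 K2 i1 i2 X1 X2 N co1 co2} c.
Arguments polyfun_var {C K1 K2 i1 i2 X1 X2 N co1 co2} j.
Arguments polyfun0 {C K1 K2 i1 i2 X1 X2 N co1 co2}.
Arguments polyfun1 {C K1 K2 i1 i2 X1 X2 N co1 co2}.
Arguments polymx_const {C K1 K2 i1 i2 X1 X2 N co1 co2 a b} A r s.

Section Points.

Variables (C K : fieldType) (i : {rmorphism C -> K}) (n : nat).
Implicit Types (S : 'M[C]_n -> Prop).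

Notation pf := (polyfun (idfun : {rmorphism C -> C}) i
  (fun A : 'M[C]_n => mxvec A 0) (fun A : 'M[K]_n => mxvec A 0)).
Notation pm := (polymx (idfun : {rmorphism C -> C}) i
  (fun A : 'M[C]_n => mxvec A 0) (fun A : 'M[K]_n => mxvec A 0)).

Lemma polymx_id : pm id id.
Proof.
move=> r s; apply: (polyfun_ext (polyfun_var (mxvec_index r s)));
by move=> A; rewrite mxvecE.
Qed.

Lemma points_polyfun S f1 f2 : pf f1 f2 -> (forall g, S g -> f1 g = 0) ->
  forall A, points i S A -> f2 A = 0.
Proof.
move=> [p [p1 p2]] hf A [_ hA]; rewrite -p2; apply: hA => g Sg.
by rewrite /mxeval p1 hf.
Qed.

Lemma polyfun_mxeval (p : {mpoly C[n * n]}) F1 F2 : pm F1 F2 ->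
  pf (fun A => mxeval idfun p (F1 A)) (fun A => mxeval i p (F2 A)).
Proof.
move=> hF; apply: polyfun_mmap => k.
case/mxvec_indexP: k => r s.
by apply: (polyfun_ext (hF r s)) => A; rewrite mxvecE.
Qed.

Lemma mxeval_map (p : {mpoly C[n * n]}) A :
  mxeval i p (map_mx i A) = i (mxeval idfun p A).
Proof.
rewrite /mxeval /mmap rmorph_sum; apply: eq_bigr => m _.
rewrite rmorphM; congr (_ * _); rewrite rmorph_prod; apply: eq_bigr => k _.
by rewrite rmorphXn; congr (_ ^+ _); rewrite -map_mxvec mxE.
Qed.

Lemma points_map S g : g \in unitmx -> S g -> points i S (map_mx i g).
Proof.
move=> ug Sg; split; first by rewrite map_unitmx.
by move=> p /(_ g Sg) hp; rewrite mxeval_map hp rmorph0.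
Qed.

Lemma points_polymx S S' F1 F2 : pm F1 F2 -> (forall g, S g -> S' (F1 g)) ->
  forall A, points i S A -> F2 A \in unitmx -> points i S' (F2 A).
Proof.
move=> hF hS A PA uF; split=> // p hp.
apply: (points_polyfun (polyfun_mxeval p hF)) PA => g Sg.
by apply: hp; apply: hS.
Qed.

End Points.

Arguments polymx_id {C K} i {n} r s.

Section BaseChange.

Variables (C K : fieldType) (i : {rmorphism C -> K}).

Definition lin_indep r (e : 'I_r -> K) : Prop :=
  forall c : 'I_r -> C, \sum_j i (c j) * e j = 0 -> forall j, c j = 0.

(** The list is scanned and [q t0] is adjoined only when it is not a [C]-combination of the elements
    kept so far. The coefficients lie in [C], which allows a polynomial over [K] to be split into
    polynomials over [C]. *)
Lemma basis_of_family (T : eqType) (q : T -> K) (s : seq T) :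
  exists r (e : 'I_r -> K) (c : T -> 'I_r -> C), lin_indep e
    /\ forall t, t \in s -> q t = \sum_j i (c t j) * e j.
Proof.
elim: s => [|t0 s [r [e [c [ie hc]]]]].
  by exists 0%N, (fun=> 0), (fun _ _ => 0); split=> // c _ [].
case: (classic (exists c0, q t0 = \sum_j i (c0 j) * e j)) => [[c0 h0]|hn].
  exists r, e, (fun t => if t == t0 then c0 else c t); split=> // t.
  by rewrite inE; case: eqP => [-> //|_] /= /hc.
pose e' j := oapp e (q t0) (unlift ord_max j).
have e'w j : e' (widen_ord (leqnSn r) j) = e j.
  rewrite /e'; have -> : widen_ord (leqnSn r) j = lift ord_max j.
    by apply: val_inj; rewrite /= /bump leqNgt ltn_ord.
  by rewrite liftK.
have e'm : e' ord_max = q t0 by rewrite /e' unlift_none.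
exists r.+1, e', (fun t j => if t == t0 then (j == ord_max)%:R
  else oapp (c t) 0 (unlift ord_max j)); split=> [a|t].
  rewrite big_ord_recr /= e'm; under eq_bigr do rewrite e'w.
  move=> ha; have am : a ord_max = 0.
    apply: NNPP => /eqP am; apply: hn.
    exists (fun j => - (a (widen_ord (leqnSn r) j) / a ord_max)).
    move/eqP: ha; rewrite addrC addr_eq0 => /eqP ha.
    apply: (mulfI (_ : i (a ord_max) != 0)); first by rewrite fmorph_eq0.
    rewrite ha mulr_sumr -sumrN; apply: eq_bigr => j _.
    by rewrite mulrA -rmorphM mulrN mulrCA divff // mulr1 rmorphN mulNr.

  move: ha; rewrite am rmorph0 mul0r addr0 => /(ie (fun j => _)) h j.
  case: (unliftP ord_max j) => [j' ->|-> //].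
  rewrite -[RHS](h j'); congr a; apply: val_inj.
  by rewrite /= /bump leqNgt ltn_ord.
rewrite inE big_ord_recr /= e'm; case: eqP => [-> _|_ /= /hc ->].
  rewrite eqxx rmorph1 mul1r big1 ?add0r // => j _.
  rewrite -val_eqE /= ltn_eqF ?ltn_ord // rmorph0 mul0r //.
rewrite unlift_none /= rmorph0 mul0r addr0; apply: eq_bigr => j _.
rewrite e'w; have -> : widen_ord (leqnSn r) j = lift ord_max j.
  by apply: val_inj; rewrite /= /bump leqNgt ltn_ord.
by rewrite liftK.
Qed.

(* The coefficients of [Q] in a [C]-basis of the span of its coefficients are
   polynomials over [C] which vanish on [S]. *)
Lemma vanish_base_change N (S : ('I_N -> C) -> Prop) (Q : {mpoly K[N]}) :
  (forall v, S v -> mmap idfun (fun j => i (v j)) Q = 0) ->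
  forall w : 'I_N -> K,
    (forall p : {mpoly C[N]}, (forall v, S v -> mmap idfun v p = 0) ->
       mmap i w p = 0) ->
  mmap idfun w Q = 0.
Proof.
move=> hQ w hw.
have [r [e [c [ie hc]]]] := basis_of_family (fun m => Q@_m) (msupp Q).
pose P j : {mpoly C[N]} := \sum_(m <- msupp Q) c m j *: 'X_[m].
have evP (L : fieldType) (f : {rmorphism C -> L}) (v : 'I_N -> L) j :
    mmap f v (P j) = \sum_(m <- msupp Q) f (c m j) * mmap1 v m.
  rewrite /P raddf_sum /=; apply: eq_bigr => m _.
  by rewrite mmapZ mmapX.
have evQ (v : 'I_N -> K) :
    mmap idfun v Q = \sum_j mmap i v (P j) * e j.
  rewrite /(mmap _ _ Q) big_seq; under eq_bigr => m /hc -> do rewrite /= mulr_suml.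
  rewrite -big_seq exchange_big; apply: eq_bigr => j _; rewrite evP mulr_suml.
  by apply: eq_bigr => m _; rewrite mulrAC.
rewrite evQ big1 // => j _; rewrite hw ?mul0r // => v Sv.
apply: (ie (fun j => mmap idfun v (P j))) => {j}.
rewrite -[RHS](hQ v Sv) evQ; apply: eq_bigr => j _; congr (_ * _).
rewrite !evP rmorph_sum; apply: eq_bigr => m _; rewrite rmorphM.
congr (_ * _); rewrite rmorph_prod; apply: eq_bigr => k _.
by rewrite rmorphXn.
Qed.

End BaseChange.

Section PointsGroup.

Variables (C K : fieldType) (i : {rmorphism C -> K}) (n : nat).
Variable (S : 'M[C]_n -> Prop).

(** A point is only required to satisfy the equations over [C]; by [vanish_base_change] it also
    satisfies those over [K]. This is the density of the [C]-points in the group over [K]. *)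
Lemma points_vanish (Q : {mpoly K[n * n]}) :
  (forall g, S g -> mxeval idfun Q (map_mx i g) = 0) ->
  forall A, points i S A -> mxeval idfun Q A = 0.
Proof.
move=> hQ A [_ hA].
apply: (vanish_base_change (i := i) (S := fun v => exists2 g, S g & v =1 mxvec g 0)).
  move=> v [g Sg hv]; rewrite -[RHS](hQ g Sg) /mxeval.
  apply: eq_bigr => m _; congr (_ * _); apply: eq_bigr => k _.
  by rewrite hv -map_mxvec mxE.
move=> p hp; apply: hA => g Sg.
by apply: hp; exists g.
Qed.

Hypothesis S_unit : forall g, S g -> g \in unitmx.
Hypothesis S_mul : forall g h, S g -> S h -> S (g *m h).

(** Closure under products is known for pairs of [C]-points. It is extended to the second factor
    with equations over [C], and then to the first one with equations over [K], because the second
    factor is now a constant in [K]. *)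
Lemma points_mul A B : points i S A -> points i S B -> points i S (A *m B).
Proof.
move=> PA PB; have uA := PA.1; have uB := PB.1.
split; first by rewrite unitmx_mul uA.
move=> p hp.
(* For fixed [B], the condition [p (X *m B) = 0] is polynomial over [K]. *)
have [Q [hQ _]] := polyfun_mxeval (i := (idfun : {rmorphism K -> K}))
  (map_mpoly i p)
  (polymx_mul (polymx_id (idfun : {rmorphism K -> K})) (polymx_const B)).
have evp D : mxeval idfun (map_mpoly i p) D = mxeval i p D by exact: mmap_map_mpoly.
have idB : map_mx (idfun : {rmorphism K -> K}) B = B by apply/matrixP=> r s; rewrite mxE.
have hQ' D : mxeval idfun Q D = mxeval i p (D *m B).
  by rewrite /mxeval hQ evp idB.
rewrite -hQ'; apply: points_vanish PA => g Sg; rewrite hQ'.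
have [ug _] := points_map i (S_unit Sg) Sg.
apply: (points_polyfun (polyfun_mxeval p (polymx_mul
  (polymx_const g) (polymx_id i)))) PB => h Sh.
by have -> : map_mx idfun g = g; [apply/matrixP=> r s; rewrite mxE|apply/hp/S_mul].
Qed.

Hypothesis S_inv : forall g, S g -> S (invmx g).
Hypothesis S_det : forall g, S g -> \det g ^+ 2 = 1.

(* As [\det ^+ 2 = 1] on [S], inversion is the polynomial map
   [\det A *: \adj A]. *)
Lemma points_inv A : points i S A -> points i S (invmx A).
Proof.
move=> PA; have uA := PA.1.
have pd := polyfun_det (@polymx_id _ _ i n).
have dA : \det A ^+ 2 = 1.
  apply/eqP; rewrite -subr_eq0; apply/eqP.
  apply: (points_polyfun (polyfunB (polyfunX 2 pd) polyfun1) _ PA).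
  by move=> g /S_det ->; rewrite subrr.
have inv_det (L : fieldType) (B : 'M[L]_n) : B \in unitmx -> \det B ^+ 2 = 1 ->
    invmx B = \det B *: \adj B.
  move=> uB dB; rewrite /invmx uB; congr (_ *: _).
  have dB0 : \det B != 0 by rewrite -unitfE -unitmxE.
  by apply: (mulfI dB0); rewrite divff // -expr2.
rewrite (inv_det _ A) //.
apply: (points_polymx (polymx_scale pd (polymx_adj (polymx_id i))) _ PA).
  by move=> g Sg; rewrite -inv_det ?S_unit ?S_det //; apply: S_inv.
by rewrite -inv_det // unitmx_inv.
Qed.

End PointsGroup.

(** * Induction on polynomials and consequences of characteristic zero *)

Lemma mpoly_ring_ind (R : comNzRingType) N (P : {mpoly R[N]} -> Prop) :
  (forall c, P c%:MP) -> (forall j, P 'X_j) ->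
  (forall p q, P p -> P q -> P (p + q)) ->
  (forall p q, P p -> P q -> P (p * q)) -> forall p, P p.
Proof.
move=> PC PX PD PM p; rewrite [p]mpolyE; apply: big_ind => [||m _].
- by rewrite -(mpolyC0 N R); apply: PC.
- exact: PD.
rewrite -mul_mpolyC; apply: (PM) => //.
rewrite mpolyXE_id; apply: big_ind => [||j _].
- by rewrite -(mpolyC1 N R); apply: PC.
- exact: PM.
elim: (m j) => [|k IH]; first by rewrite expr0 -(mpolyC1 N R); apply: PC.
by rewrite exprS; apply: PM.
Qed.

Section CharZero.

Variables (C : fieldType) (charC : [pchar C] =i pred0).

Lemma natf_eq0 k : (k%:R == 0 :> C) = (k == 0%N).
Proof. exact: (pcharf0P C).1 charC k. Qed.

Lemma natf_inj : injective (fun k : nat => k%:R : C).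
Proof.
move=> a b; wlog: a b / (a <= b)%N => [hw e|hab /eqP].
  by case: (leqP a b) => [/hw|/ltnW/hw]; [apply|move=> <-].
by rewrite eq_sym -subr_eq0 -natrB // natf_eq0 subn_eq0 => hba; apply/eqP; rewrite eqn_leq hab.
Qed.

Lemma intf_inj : injective (fun k : int => k%:~R : C).
Proof.
move=> a b /eqP; rewrite -subr_eq0 -rmorphB /= => h; apply/eqP; rewrite -subr_eq0.
move: h; case: (a - b) => k; first by rewrite -pmulrn natf_eq0.
by rewrite NegzE rmorphN /= oppr_eq0 -pmulrn natf_eq0.
Qed.

Lemma intf_eq0 (k : int) : (k%:~R == 0 :> C) = (k == 0).
Proof. by rewrite -(inj_eq intf_inj). Qed.

Lemma poly_eq0_infinite (p : {poly C}) : (forall z, z != 0 -> p.[z] = 0) -> p = 0.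
Proof.
move=> hp; apply/eqP/negP => /negP p0.
have := max_poly_roots p0 (rs := [seq k.+1%:R | k <- iota 0 (size p)]).
rewrite size_map size_iota ltnn => H; apply: notF; apply: H.
  by apply/allP => _ /mapP [k _ ->]; apply/rootP/hp; rewrite natf_eq0.
by rewrite map_inj_uniq ?iota_uniq // => a b /natf_inj [].
Qed.

End CharZero.

Section MxEval.

Variables (C K : fieldType) (i : {rmorphism C -> K}) (n : nat).

Lemma mxevalC c (M : 'M_n) : mxeval i c%:MP M = i c.
Proof. by rewrite /mxeval mmapC. Qed.
Lemma mxevalX j (M : 'M_n) : mxeval i 'X_j M = mxvec M 0 j.
Proof. by rewrite /mxeval mmapX mmap1U. Qed.
Lemma mxevalD p q (M : 'M_n) :
  mxeval i (p + q) M = mxeval i p M + mxeval i q M.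
Proof. by rewrite /mxeval mmapD. Qed.
Lemma mxevalM p q (M : 'M_n) :
  mxeval i (p * q) M = mxeval i p M * mxeval i q M.
Proof. by rewrite /mxeval rmorphM. Qed.

End MxEval.

(** * Lie algebras and curves *)

Section Lie.

Variables (C : fieldType) (charC : [pchar C] =i pred0).

(* [phi] is a Laurent polynomial in [z], with derivative [d] at [z = 1]. *)
Definition diff_at1 (phi : C -> C) (d : C) : Prop :=
  exists (a : {poly C}) (N : nat),
    (forall z, z != 0 -> phi z * z ^+ N = a.[z])
    /\ d = a^`().[1] - N%:R * a.[1].

Lemma diff_at1_const c : diff_at1 (fun=> c) 0.
Proof.
exists c%:P, 0%N; split=> [z _|]; first by rewrite mulr1 hornerC.
by rewrite derivC horner0 mul0r subr0.
Qed.

Lemma diff_at1_poly (a : {poly C}) : diff_at1 (horner a) a^`().[1].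
Proof. by exists a, 0%N; split=> [z _|]; rewrite ?mulr1 // mul0r subr0. Qed.

Lemma diff_at1_ext f g d : diff_at1 f d -> (forall z, z != 0 -> f z = g z) ->
  diff_at1 g d.
Proof.
by move=> [a [N [h ->]]] e; exists a, N; split=> // z z0; rewrite -e // h.
Qed.

Lemma diff_at1D f g c d : diff_at1 f c -> diff_at1 g d ->
  diff_at1 (fun z => f z + g z) (c + d).
Proof.
move=> [a [N [ha ->]]] [b [M [hb ->]]].
exists (a * 'X^M + b * 'X^N), (N + M)%N; split=> [z z0|].
  by rewrite hornerD !hornerM !hornerXn -ha // -hb // exprD; set u := z ^+ N; set v := z ^+ M; ring.
rewrite derivD !derivM !derivXn !hornerD !hornerM !hornerMn !hornerXn !expr1n natrD.
by set u := N%:R; set v := M%:R; ring.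
Qed.

Lemma diff_at1M f g c d : diff_at1 f c -> diff_at1 g d ->
  diff_at1 (fun z => f z * g z) (c * g 1 + f 1 * d).
Proof.
move=> [a [N [ha ->]]] [b [M [hb ->]]].
have [fa gb] : f 1 = a.[1] /\ g 1 = b.[1].
  by rewrite -ha ?oner_neq0 // -hb ?oner_neq0 // !expr1n !mulr1.
exists (a * b), (N + M)%N; split=> [z z0|].
  by rewrite hornerM -ha // -hb // exprD; set u := z ^+ N; set v := z ^+ M; ring.
by rewrite fa gb derivM hornerD !hornerM natrD; set u := N%:R; set v := M%:R; ring.
Qed.

Lemma diff_at1_sum (T : Type) (r : seq T) (P : pred T) F D :
  (forall t, P t -> diff_at1 (F t) (D t)) ->
  diff_at1 (fun z => \sum_(t <- r | P t) F t z) (\sum_(t <- r | P t) D t).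
Proof.
move=> hF; elim: r => [|t r IH].
  by rewrite big_nil; apply: (diff_at1_ext (diff_at1_const 0)) => z; rewrite big_nil.
rewrite big_cons; case Pt: (P t); last first.
  by apply: (diff_at1_ext IH) => z; rewrite big_cons Pt.
by apply: (diff_at1_ext (diff_at1D (hF t Pt) IH)) => z; rewrite big_cons Pt.
Qed.

Lemma diff_at1_zero f d : diff_at1 f d -> (forall z, z != 0 -> f z = 0) -> d = 0.
Proof.
move=> [a [N [ha ->]]] f0.
have -> : a = 0.
  by apply: (poly_eq0_infinite charC) => z z0; rewrite -ha // f0 // mul0r.
by rewrite linear0 !horner0 mulr0 subr0.
Qed.

(** The condition in [lie] is that this derivative vanish at the base point [M = 1%:M]. *)
Definition dirder (K : fieldType) (i : C -> K) n (p : {mpoly C[n * n]}) (M A : 'M[K]_n) : K :=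
  \sum_k mxeval i (mderiv k p) M * mxvec A 0 k.

Section DirDer.

Variables (K : fieldType) (i : {rmorphism C -> K}) (n : nat).
Implicit Types (p q : {mpoly C[n * n]}) (M A : 'M[K]_n).

Lemma dirderC c M A : dirder i c%:MP M A = 0.
Proof. by rewrite /dirder big1 // => k _; rewrite mderivC /mxeval mmap0 mul0r. Qed.

Lemma dirderX j M A : dirder i 'X_j M A = mxvec A 0 j.
Proof.
rewrite /dirder (bigD1 j) //= big1 ?addr0 => [|k kj].
  rewrite mderivX mnm1E eqxx scale1r.
  have -> : (U_(j) - U_(j) = 0 :> 'X_{1.. n * n})%MM.
    by apply/mnmP => u; rewrite mnmBE subnn mnm0E.
  by rewrite mpolyX0 /mxeval rmorph1 mul1r.
by rewrite mderivX mnm1E eq_sym (negbTE kj) scale0r /mxeval mmap0 mul0r.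
Qed.

Lemma dirderD p q M A : dirder i (p + q) M A = dirder i p M A + dirder i q M A.
Proof.
rewrite /dirder -big_split; apply: eq_bigr => k _ /=.
by rewrite mderivD /mxeval mmapD mulrDl.
Qed.

Lemma dirderM p q M A : dirder i (p * q) M A =
  dirder i p M A * mxeval i q M + mxeval i p M * dirder i q M A.
Proof.
rewrite /dirder mulr_suml mulr_sumr -big_split; apply: eq_bigr => k _ /=.
rewrite mderivM /mxeval mmapD !rmorphM /=; ring.
Qed.

End DirDer.

Lemma dirder_curve n (p : {mpoly C[n * n]}) (M : C -> 'M[C]_n) (A : 'M[C]_n) :
  (forall r s, diff_at1 (fun z => M z r s) (A r s)) ->
  diff_at1 (fun z => mxeval idfun p (M z)) (dirder idfun p (M 1) A).
Proof.
move=> hM; pose id' := idfun : {rmorphism C -> C}.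
elim/mpoly_ring_ind: p => [c|j|p q hp hq|p q hp hq].
- rewrite (dirderC id'); apply: (diff_at1_ext (diff_at1_const c)) => z _.
  by rewrite (mxevalC id').
- rewrite (dirderX id'); case/mxvec_indexP: j => r s; rewrite mxvecE.
  by apply: (diff_at1_ext (hM r s)) => z _; rewrite (mxevalX id') mxvecE.
- rewrite (dirderD id'); apply: (diff_at1_ext (diff_at1D hp hq)) => z _.
  by rewrite (mxevalD id').
- rewrite (dirderM id'); apply: (diff_at1_ext (diff_at1M hp hq)) => z _.
  by rewrite (mxevalM id').
Qed.

(** The curve need only lie in [S] for [z != 0], so that one-parameter tori qualify as well as
    exponential curves; the base point [z = 1] is the unit of Gm. *)
Lemma lie_curve n (S : 'M[C]_n -> Prop) (M : C -> 'M[C]_n) (A : 'M[C]_n) :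
  (forall r s, diff_at1 (fun z => M z r s) (A r s)) ->
  M 1 = 1%:M -> (forall z, z != 0 -> S (M z)) -> lie idfun S A.
Proof.
move=> hM M1 SM p hp; move: (dirder_curve p hM); rewrite M1.
by move/diff_at1_zero; apply=> z z0; apply: hp; apply: SM.
Qed.

Lemma lie_subset n (S S' : 'M[C]_n -> Prop) A :
  (forall g, S g -> S' g) -> lie idfun S A -> lie idfun S' A.
Proof. by move=> sub hA p hp; apply: hA => g /sub; apply: hp. Qed.

Section LinearSubstitution.

Variables (K : fieldType) (i : {rmorphism C -> K}) (n : nat).
Variables (sub : 'I_(n * n) -> 'rV[C]_(n * n)) (L : 'M[K]_n -> 'M[K]_n).
Hypothesis subL : forall M k,
  mxvec (L M) 0 k = \sum_j i (sub k 0 j) * mxvec M 0 j.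

Definition linsub (p : {mpoly C[n * n]}) : {mpoly C[n * n]} :=
  mmap (@mpolyC _ C) (fun k => \sum_j (sub k 0 j)%:MP * 'X_j) p.

Lemma dirder_sum (I : Type) (r : seq I) (F : I -> {mpoly C[n * n]}) (M D : 'M[K]_n) :
  dirder i (\sum_(j <- r) F j) M D = \sum_(j <- r) dirder i (F j) M D.
Proof.
elim: r => [|j r IH]; first by rewrite !big_nil -(mpolyC0 (n * n) C) dirderC.
by rewrite !big_cons dirderD IH.
Qed.

Lemma mxeval_sum (I : Type) (r : seq I) (F : I -> {mpoly C[n * n]}) (M : 'M[K]_n) :
  mxeval i (\sum_(j <- r) F j) M = \sum_(j <- r) mxeval i (F j) M.
Proof.
elim: r => [|j r IH]; first by rewrite !big_nil -(mpolyC0 (n * n) C) mxevalC rmorph0.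
by rewrite !big_cons mxevalD IH.
Qed.

Lemma linsubC c : linsub c%:MP = c%:MP.
Proof. exact: mmapC. Qed.

Lemma linsubX k : linsub 'X_k = \sum_j (sub k 0 j)%:MP * 'X_j.
Proof. by rewrite /linsub mmapX mmap1U. Qed.

Lemma linsubD p q : linsub (p + q) = linsub p + linsub q.
Proof. exact: mmapD. Qed.

Lemma linsubM p q : linsub (p * q) = linsub p * linsub q.
Proof. exact: rmorphM. Qed.

Lemma mxeval_linsub p (M : 'M[K]_n) : mxeval i (linsub p) M = mxeval i p (L M).
Proof.
elim/mpoly_ring_ind: p => [c|k|p q hp hq|p q hp hq].
- by rewrite linsubC !mxevalC.
- rewrite linsubX mxevalX subL mxeval_sum; apply: eq_bigr => j _.
  by rewrite mxevalM mxevalC mxevalX.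
- by rewrite linsubD !mxevalD hp hq.
- by rewrite linsubM !mxevalM hp hq.
Qed.

Lemma dirder_linsub p (M D : 'M[K]_n) :
  dirder i (linsub p) M D = dirder i p (L M) (L D).
Proof.
elim/mpoly_ring_ind: p => [c|k|p q hp hq|p q hp hq].
- by rewrite linsubC !dirderC.
- rewrite linsubX dirderX subL dirder_sum; apply: eq_bigr => j _.
  by rewrite dirderM dirderC mul0r add0r dirderX mxevalC.
- by rewrite linsubD !dirderD hp hq.
- by rewrite linsubM !dirderM !mxeval_linsub hp hq.
Qed.

End LinearSubstitution.

(** Conjugation is linear, so composing an equation of [S'] with it gives an equation of [S]. Its
    derivative in the direction [A] is that of the original one in the conjugated direction, and
    [B *m B' = 1%:M] keeps the base point at the identity. *)
Lemma lie_conj n (S S' : 'M[C]_n -> Prop) (B B' : 'M[C]_n) A :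
  B *m B' = 1%:M -> (forall g, S g -> S' (B *m g *m B')) ->
  lie idfun S A -> lie idfun S' (B *m A *m B').
Proof.
move=> BB' hS hA p hp.
pose U := lin_mulmx B *m lin_mulmxr B'.
pose sub k := \row_j U j k.
have subL (M : 'M[C]_n) k :
    mxvec (B *m M *m B') 0 k = \sum_j sub k 0 j * mxvec M 0 j.
  have -> : mxvec (B *m M *m B') = mxvec M *m U.
    by rewrite mulmxA !mul_vec_lin.
  by rewrite mxE; apply: eq_bigr => j _; rewrite /sub mxE; exact: mulrC.
have ev := mxeval_linsub (i := (idfun : {rmorphism C -> C})) subL.
have dd := dirder_linsub (i := (idfun : {rmorphism C -> C})) subL.
have hq : vanishing S (linsub sub p) by move=> g /hS/hp h; rewrite ev.
by have := hA _ hq; rewrite -[LHS]/(dirder idfun _ 1%:M A) dd mulmx1 BB'.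
Qed.

End Lie.

(** * Matrix exponentials and gradings *)

Section MatrixExponential.

Variables (K : fieldType) (charK : [pchar K] =i pred0).

Lemma factf_neq0 k : k`!%:R != 0 :> K.
Proof. by rewrite natf_eq0 // -lt0n fact_gt0. Qed.

Lemma expmx_widen n (X : 'M[K]_n) N : X ^+ n = 0 -> (n <= N)%N ->
  \sum_(j < N) (j`!%:R)^-1 *: X ^+ j = expmx X.
Proof.
move=> Xn le_nN; rewrite /expmx [RHS](big_ord_widen N (fun j => (j`!%:R)^-1 *: X ^+ j)) //.
rewrite [LHS](bigID (fun j : 'I_N => (j < n)%N)) /= [X in _ + X]big1 ?addr0 //.
move=> j; rewrite -leqNgt => le_nj.
by rewrite -(subnKC le_nj) exprD Xn mul0r scaler0.
Qed.

Lemma expmx0 n : expmx (0 : 'M[K]_n) = 1%:M.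
Proof.
(* With [n.+1] terms the constant term exists even for [n = 0]. *)
rewrite -(@expmx_widen _ _ n.+1) ?leqnSn //; last first.
  case: n => [|n]; last by rewrite expr0n.
  by apply/matrixP => [[]].
rewrite big_ord_recl expr0 fact0 invr1 scale1r big1 ?addr0 // => j _.
by rewrite exprS mul0r scaler0.
Qed.

(** The truncated series of [X] and [- X] are values at [X] of two polynomials. Modulo a power of
    the variable that kills [X], their product has the coefficients (1 - 1)^s / s!, which vanish for
    s > 0. *)
Lemma expmxN n (X : 'M[K]_n) : X ^+ n = 0 -> expmx X *m expmx (- X) = 1%:M.
Proof.
case: n X => [|n] X Xn; first by apply/matrixP => [[]].
pose P : {poly K} := \poly_(j < n.+1) (j`!%:R)^-1.
pose Q : {poly K} := \poly_(j < n.+1) ((-1) ^+ j * (j`!%:R)^-1).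
have hP : expmx X = horner_mx X P.
  rewrite /P poly_def rmorph_sum; apply: eq_bigr => j _.
  rewrite -mul_polyC rmorphM /= horner_mx_C rmorphXn /= horner_mx_X.
  by rewrite -[RHS]/(_ *m _) mul_scalar_mx.
have hQ : expmx (- X) = horner_mx X Q.
  rewrite /Q poly_def rmorph_sum; apply: eq_bigr => j _.
  rewrite -mul_polyC rmorphM /= horner_mx_C rmorphXn /= horner_mx_X.
  by rewrite -[RHS]/(_ *m _) mul_scalar_mx -scaleN1r exprZn scalerA mulrC.
rewrite hP hQ -[_ *m _]/(_ * _) -rmorphM.
rewrite -[P * Q](poly_take_drop n.+1) rmorphD rmorphM rmorphXn /= horner_mx_X Xn mulr0 addr0.
suff -> : take_poly n.+1 (P * Q) = 1 by rewrite rmorph1.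
apply/polyP => s; rewrite coef_take_poly coef1; case: ltnP => hs; last by case: s hs.
rewrite coefM; apply: (mulfI (factf_neq0 s)); rewrite mulr_sumr.
transitivity (\sum_(j < s.+1) (-1) ^+ (s - j) * 1 ^+ j *+ 'C(s, j) : K).
  apply: eq_bigr => j _; rewrite !coef_poly.
  have js : (j <= s)%N by rewrite -ltnS.
  rewrite (leq_ltn_trans js hs) (leq_ltn_trans (leq_subr _ _) hs).
  rewrite expr1n mulr1 -mulr_natr -(bin_fact js) !natrM.
  have := factf_neq0 j; have := factf_neq0 (s - j).
  set a := j`!%:R; set b := (s - j)`!%:R => b0 a0; field.
  by rewrite a0 b0.
rewrite -exprDn addNr expr0n; case: s hs => [|s] _ /=; last by rewrite mulr0.
by rewrite fact0 mulr1.
Qed.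

Lemma expmx_conj n (P Q X : 'M[K]_n) : Q *m P = 1%:M ->
  expmx (P *m X *m Q) = P *m expmx X *m Q.
Proof.
move=> QP; have PQ := mulmx1C QP.
rewrite /expmx mulmx_sumr mulmx_suml; apply: eq_bigr => j _.
rewrite -scalemxAr -scalemxAl; congr (_ *: _); elim: (val j) => [|k IH].
  by rewrite !expr0 mulmx1 PQ.
by rewrite !exprS IH -!mulmxE !mulmxA -(mulmxA _ Q P) QP mulmx1.
Qed.

(** This is exp(X) Z exp(-X) = exp(ad X) Z when the string of [Z] under ad X stops after two steps:
    [A] is [X, Z], [D] is [X, A], and [X, D] = 0. The simple reflections need no longer string. *)
Lemma expmx_ad2 n (X Z A D : 'M[K]_n) : X ^+ n = 0 ->
  X * Z = Z * X + A -> X * A = A * X + D -> X * D = D * X ->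
  expmx X *m Z = (Z + A + 2^-1 *: D) *m expmx X.
Proof.
move=> Xn hZ hA hD.
have XX k : X * X ^+ k = X ^+ k.+1 by rewrite exprS.
have XkD k : X ^+ k * D = D * X ^+ k by apply: esym (commrX k (esym hD)).
have XkA k : X ^+ k.+1 * A = A * X ^+ k.+1 + (D * X ^+ k) *+ k.+1.
  elim: k => [|k IH]; first by rewrite !expr1 expr0 mulr1 mulr1n.
  rewrite exprS -mulrA IH mulrDr mulrA hA mulrnAr mulrA hD mulrDl -!mulrA -!exprS.
  by rewrite -addrA -mulrS.
have XkZ k : X ^+ k.+2 * Z = Z * X ^+ k.+2 + (A * X ^+ k.+1) *+ k.+2
    + (D * X ^+ k) *+ 'C(k.+2, 2).
  elim: k => [|k IH].
    rewrite expr2 -mulrA hZ mulrDr mulrA hZ mulrDl hA expr1 expr0 mulr1.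
    by rewrite -!addrA -mulrA; congr (_ + _); rewrite addrA -mulr2n.
  move: IH (XX k) (XX k.+1) (XX k.+2).
  move: (X ^+ k) (X ^+ k.+1) (X ^+ k.+2) (X ^+ k.+3) => a b c d IH ab bc cd.
  have e0 : X * (Z * c) = Z * d + A * c by rewrite mulrA hZ mulrDl -mulrA cd.
  have e1 : X * (A * b) = A * c + D * b by rewrite mulrA hA mulrDl -mulrA bc.
  have e2 : X * (D * a) = D * b by rewrite mulrA hD -mulrA ab.
  have -> : 'C(k.+3, 2) = (k.+2 + 'C(k.+2, 2))%N by rewrite binS bin1 addnC.
  rewrite -cd -(mulrA X) IH cd (mulrSr (A * c) k.+2) (mulrnDr _ k.+2); move: k.+2 'C(k.+2, 2) => u v.
  rewrite 2!mulrDr mulrnAr mulrnAr e0 e1 e2 mulrnDl !addrA.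
  by congr (_ + _ + _); rewrite -!addrA; congr (_ + _); rewrite addrC.
pose T N := \sum_(j < N) (j`!%:R)^-1 *: X ^+ j.
(* Each application of ad X uses up one factor [X], so truncating at [N.+2], [N.+1] and [N] makes
   the identity exact. As soon as [n <= N], all three truncations equal [expmx X]. *)
have key N : T N.+2 *m Z = Z *m T N.+2 + A *m T N.+1 + 2^-1 *: D *m T N.
  elim: N => [|N IH].
    rewrite /T !big_ord_recr !big_ord0 /= !add0r !expr0 !expr1 !fact0 !invr1 !scale1r.
    rewrite mulmx0 addr0 mulmxDl mulmxDr !mulmx1 mul1mx -addrA; congr (_ + _).
    exact: hZ.
  have TS k : T k.+1 = T k + (k`!%:R)^-1 *: X ^+ k by rewrite /T big_ord_recr.
  have e0 : (N.+2`!%:R)^-1 *: X ^+ N.+2 *m Z = (N.+2`!%:R)^-1 *: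
      (Z * X ^+ N.+2 + (A * X ^+ N.+1) *+ N.+2 + (D * X ^+ N) *+ 'C(N.+2, 2)).
    by rewrite -XkZ -scalemxAl.
  have e1 : (N.+2`!%:R)^-1 *: ((A * X ^+ N.+1) *+ N.+2) = A *m ((N.+1`!%:R)^-1 *: X ^+ N.+1).
    rewrite -scaler_nat scalerA -scalemxAr; congr (_ *: _).
    apply: (mulfI (factf_neq0 N.+2)); rewrite mulrA mulfV ?factf_neq0 // mul1r.
    by rewrite factS natrM mulfK ?factf_neq0.
  have e2 : (N.+2`!%:R)^-1 *: ((D * X ^+ N) *+ 'C(N.+2, 2)) =
     2^-1 *: D *m ((N`!%:R)^-1 *: X ^+ N).
    rewrite -scaler_nat scalerA -scalemxAl -scalemxAr scalerA; congr (_ *: _).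
    have n0 k : k.+1%:R != 0 :> K by rewrite natf_eq0.
    apply: (mulfI (factf_neq0 N.+2)); rewrite mulrA mulfV ?factf_neq0 // mul1r.
    rewrite -(@bin_fact N.+2 2) // !subSS subn0 !natrM.
    by rewrite !mulr1 -invfM mulfK // mulf_neq0 ?factf_neq0 ?(n0 1%N).
  rewrite [in LHS](TS N.+2) mulmxDl IH e0 2!scalerDr e1 e2.
  rewrite [in RHS](TS N.+2) [in RHS]mulmxDr [X in _ = _ + X + _](_ : _ = A *m T N.+1 + A *m ((N.+1`!%:R)^-1 *: X ^+ N.+1)); last first.
    by rewrite -mulmxDr -TS.
  rewrite [X in _ = _ + X](_ : _ = 2^-1 *: D *m T N + 2^-1 *: D *m ((N`!%:R)^-1 *: X ^+ N)); last first.
    by rewrite -mulmxDr -TS.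
  rewrite [Z *m (_ *: _)](_ : _ = (N.+2`!%:R)^-1 *: (Z * X ^+ N.+2)); last by rewrite -scalemxAr.
  by rewrite addrACA [X in X + _]addrACA.
have hT N : (n <= N)%N -> T N = expmx X by move=> ?; apply: expmx_widen.
have le1 := leqnSn n; have le2 := leqW le1.
by have := key n; rewrite (hT _ le2) (hT _ le1) (hT _ (leqnn n)) !mulmxDl.
Qed.

End MatrixExponential.

(** * Gradings of matrices by integer functions on the indices *)

Section Grading.

Variables (n : nat) (gr : 'I_n -> int).

Section OverField.

Variable (K : fieldType).
Implicit Types (A B : 'M[K]_n) (d : int).

Definition degle d A : Prop := forall p q, A p q != 0 -> gr p - gr q <= d.

Definition homdeg d A : Prop := forall p q, A p q != 0 -> gr p - gr q = d.

Definition comp d A : 'M[K]_n := \matrix_(p, q) if gr p - gr q == d then A p q else 0.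

Lemma degle0 d : degle d (0 : 'M[K]_n).
Proof. by move=> p q; rewrite mxE eqxx. Qed.

Lemma degle1 : degle 0 (1%:M : 'M[K]_n).
Proof. by move=> p q; rewrite !mxE; case: (eqVneq p q) => [->|_]; rewrite ?subrr ?eqxx. Qed.

Lemma degleW d d' A : d <= d' -> degle d A -> degle d' A.
Proof. by move=> le h p q /h; lia. Qed.

Lemma degleD d A B : degle d A -> degle d B -> degle d (A + B).
Proof.
move=> hA hB p q; rewrite mxE; case: (eqVneq (A p q) 0) => [->|/hA //].
by rewrite add0r => /hB.
Qed.

Lemma degleN d A : degle d A -> degle d (- A).
Proof. by move=> hA p q; rewrite mxE oppr_eq0 => /hA. Qed.

Lemma degleZ d c A : degle d A -> degle d (c *: A).
Proof. by move=> hA p q; rewrite mxE mulf_eq0 negb_or => /andP [_ /hA]. Qed.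

Lemma degleM d d' A B : degle d A -> degle d' B -> degle (d + d') (A *m B).
Proof.
move=> hA hB p q; rewrite mxE => nz.
have [r] : exists r, A p r * B r q != 0.
  apply: NNPP => hn; case/eqP: nz; apply: big1 => r _; apply/eqP.
  by apply: NNPP => h; apply: hn; exists r; apply/negP.
by rewrite mulf_eq0 negb_or => /andP [/hA ? /hB ?]; lia.
Qed.

Lemma degleX d A k : d <= 0 -> degle d A -> degle (d *+ k) (A ^+ k).
Proof.
move=> d0 hA; elim: k => [|k IH]; first exact: degle1.
by rewrite exprS mulrS; apply: degleM.
Qed.

Lemma degle_sum (I : Type) (r : seq I) (P : pred I) F d :
  (forall j, P j -> degle d (F j)) -> degle d (\sum_(j <- r | P j) F j).
Proof.
by move=> hF; apply: big_ind => //; [apply: degle0|move=> *; apply: degleD].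
Qed.

Lemma homog_degle d A : homdeg d A -> degle d A.
Proof. by move=> hA p q /hA ->. Qed.

Lemma homogZ d c A : homdeg d A -> homdeg d (c *: A).
Proof. by move=> hA p q; rewrite mxE mulf_eq0 negb_or => /andP [_ /hA]. Qed.

Lemma homog_comp d A : homdeg d (comp d A).
Proof. by move=> p q; rewrite mxE; case: (gr p - gr q =P d) => //; rewrite eqxx. Qed.

Lemma comp_homog d A : homdeg d A -> comp d A = A.
Proof.
move=> hA; apply/matrixP => p q; rewrite mxE; case: eqP => // h.
by case: (eqVneq (A p q) 0) => [->//|/hA].
Qed.

Lemma compD d A B : comp d (A + B) = comp d A + comp d B.
Proof. by apply/matrixP => p q; rewrite !mxE; case: ifP; rewrite ?addr0. Qed.

Lemma compN d A : comp d (- A) = - comp d A.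
Proof. by apply/matrixP => p q; rewrite !mxE; case: ifP; rewrite ?oppr0. Qed.

Lemma compB d A B : comp d (A - B) = comp d A - comp d B.
Proof. by rewrite compD compN. Qed.

Lemma comp_degle d d' A : degle d' A -> d' < d -> comp d A = 0.
Proof.
move=> hA lt; apply/matrixP => p q; rewrite !mxE; case: eqP => // h.
by case: (eqVneq (A p q) 0) => // /hA; lia.
Qed.

Lemma comp1 d : d != 0 -> comp d (1%:M : 'M[K]_n) = 0.
Proof.
move=> d0; apply/matrixP => p q; rewrite !mxE; case: eqP => //; case: eqP => //= ->.
by rewrite subrr => /esym/eqP; rewrite (negbTE d0).
Qed.

Lemma degle_pred d A : degle d A -> comp d A = 0 -> degle (d - 1) A.
Proof.
move=> hA c0 p q nz; have := hA p q nz; move/matrixP: c0 => /(_ p q).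
rewrite !mxE; case: eqP => [_ e|]; last by lia.
by rewrite e eqxx in nz.
Qed.

Lemma degle_eq0 A : (forall d, degle d A) -> A = 0.
Proof.
move=> hA; apply/matrixP => p q; rewrite mxE; apply/eqP.
by apply: contraT => /(hA (gr p - gr q - 1)); lia.
Qed.

(* A strictly lowering matrix strictly raises the number of indices of
   smaller degree, which is less than n. *)
Lemma degle_nilp A : degle (-1) A -> A ^+ n = 0.
Proof.
move=> hA; pose rk p := #|[pred r | gr r < gr p]|.
have rk_lt p q : gr p < gr q -> (rk p < rk q)%N.
  move=> lt; apply: proper_card; apply/properP; split.
    by apply/subsetP => r; rewrite !inE => /lt_trans; apply.
  by exists p; rewrite !inE // ltxx.
have key k : forall p q, (A ^+ k) p q != 0 -> (rk p + k <= rk q)%N.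
  elim: k => [|k IH] p q.
    by rewrite expr0 mxE; case: (eqVneq p q) => [->|_]; rewrite ?addn0 //= eqxx.
  rewrite exprS -mulmxE mxE => nz.
  have [r] : exists r, A p r * (A ^+ k) r q != 0.
    apply: NNPP => hn; case/eqP: nz; apply: big1 => r _; apply/eqP.
    by apply: NNPP => h; apply: hn; exists r; apply/negP.
  rewrite mulf_eq0 negb_or => /andP [/hA h1 /IH h2].
  by have := @rk_lt p r; lia.
apply/matrixP => p q; rewrite [RHS]mxE; apply/eqP/negP => /negP /key.
suff : (rk q < n)%N by lia.
have := cardC [pred r | gr r < gr q]; rewrite card_ord -/(rk q) => h.
rewrite -h -[X in (X < _)%N]addn0 ltn_add2l.
by apply/card_gt0P; exists q; rewrite !inE ltxx.
Qed.

End OverField.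

Section Exponential.

Variables (K : fieldType) (charK : [pchar K] =i pred0).
Implicit Types (A B : 'M[K]_n) (d : int).

Lemma degle_expmx d A : 0 < d -> degle (- d) A ->
  degle (- d - d) (expmx A - 1%:M - A).
Proof.
move=> d0 hA; have nil : A ^+ n = 0 by apply: degle_nilp; apply: degleW hA; lia.
(* Two extra terms, so that the terms of order 0 and 1 can be split off for every [n]. *)
rewrite -(@expmx_widen _ _ _ n.+2) //; last lia.
rewrite -(big_mkord xpredT (fun j => (j`!%:R)^-1 *: A ^+ j)) 2?big_nat_recl //.
rewrite !fact0 expr0 expr1 !invr1 !scale1r.
rewrite [1 + _]addrC addrK [A + _]addrC addrK.
apply: degle_sum => j _; apply: degleZ.
apply: (@degleW _ (- d *+ j.+2)); last by apply: degleX => //; lia.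
by rewrite -mulr_natr; nia.
Qed.

Lemma degle_expmx1 d A : 0 < d -> degle (- d) A -> degle (- d) (expmx A - 1%:M).
Proof.
move=> d0 hA; rewrite -[X in degle _ X](subrK A); apply: degleD => //.
by apply: (degleW _ (degle_expmx d0 hA)); lia.
Qed.

Lemma degle_unip_mul d A B : 0 < d -> degle (- d) (A - 1%:M) ->
  degle (- d) (B - 1%:M) -> degle (- d) (A *m B - 1%:M).
Proof.
move=> d0 hA hB.
have -> : A *m B - 1%:M = (A - 1%:M) *m (B - 1%:M) + (A - 1%:M) + (B - 1%:M).
  by rewrite mulmxBr mulmxBl mulmx1 mul1mx subrK addrA subrK.
by apply: degleD => //; apply: degleD => //; apply: (degleW _ (degleM hA hB)); lia.
Qed.

(** Leading terms add under multiplication, because the product of the two nilpotent parts has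
    degree at most -2d. *)
Lemma comp_unip_mul d A B : 0 < d -> degle (- d) (A - 1%:M) ->
  degle (- d) (B - 1%:M) -> comp (- d) (A *m B) = comp (- d) A + comp (- d) B.
Proof.
move=> d0 hA hB.
have -> : A *m B = (A - 1%:M) *m (B - 1%:M) + (A - 1%:M) + (B - 1%:M) + 1%:M.
  by rewrite mulmxBr mulmxBl mulmx1 mul1mx subrK addrA subrK subrK.
rewrite !compD !compN comp1; last lia.
rewrite (comp_degle (degleM hA hB)); last lia.
by rewrite add0r !subr0 addr0.
Qed.

Lemma comp_expmx d A : 0 < d -> homdeg (- d) A -> comp (- d) (expmx A) = A.
Proof.
move=> d0 hA; have h := degle_expmx d0 (homog_degle hA).
rewrite -[expmx A](subrK 1%:M) -[expmx A - _](subrK A) 2!compD.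
rewrite (comp_degle h); last lia.
by rewrite comp1 ?comp_homog ?add0r ?addr0 //; lia.
Qed.

Section Peel.

Variables (m : nat) (X : 'I_m -> 'M[K]_n) (deg : 'I_m -> int).
Hypothesis deg_gt0 : forall j, 0 < deg j.
Hypothesis homX : forall j, homdeg (- deg j) (X j).

Definition expprod (s : seq 'I_m) (y : 'I_m -> K) : 'M[K]_n :=
  \prod_(j <- s) expmx (y j *: X j).

Notation by_degree := (fun a b => deg a <= deg b).

Lemma expX_degle y j : degle (- deg j) (expmx (y *: X j) - 1%:M).
Proof. by apply: degle_expmx1 => //; apply/homog_degle/homogZ. Qed.

Lemma expX_inv y j : expmx (- (y *: X j)) *m expmx (y *: X j) = 1%:M
  /\ expmx (y *: X j) *m expmx (- (y *: X j)) = 1%:M.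
Proof.
have h : expmx (y *: X j) *m expmx (- (y *: X j)) = 1%:M.
  apply: expmxN => //; apply: degle_nilp; apply: (@degleW _ (- deg j)).
    by have := deg_gt0 j; lia.
  exact/homog_degle/homogZ.
by split=> //; apply: mulmx1C.
Qed.

Lemma expprod_degle s y d : 0 < d -> (forall j, j \in s -> d <= deg j) ->
  degle (- d) (expprod s y - 1%:M).
Proof.
move=> d0; rewrite /expprod; elim: s => [|j s IH] hs.
  by rewrite big_nil subrr; apply: degle0.
rewrite big_cons; apply: degle_unip_mul => //.
  by apply: (degleW _ (@expX_degle (y j) j)); have := hs j (mem_head _ _); lia.
by apply: IH => k ks; apply: hs; rewrite inE ks orbT.
Qed.

Lemma comp_expprod s y d : 0 < d -> (forall j, j \in s -> d <= deg j) ->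
  comp (- d) (expprod s y) = \sum_(j <- s | deg j == d) y j *: X j.
Proof.
move=> d0; elim: s => [|j s IH] hs.
  by rewrite /expprod !big_nil comp1 //; lia.
have hj := hs j (mem_head _ _).
have hs' k : k \in s -> d <= deg k by move=> ks; apply: hs; rewrite inE ks orbT.
rewrite /expprod !big_cons comp_unip_mul //; first last.
- exact: expprod_degle.
- by apply: (degleW _ (@expX_degle (y j) j)); lia.
rewrite IH //; case: eqP => [<-|ne].
  by rewrite comp_expmx //; apply: homogZ.
rewrite -[expmx _](subrK 1%:M) compD comp1 ?addr0; last lia.
by rewrite (comp_degle (@expX_degle _ _)) ?add0r //; lia.
Qed.

(** As the list is sorted, the leading component of the product is the sum of the [y j *: X j] over
    the indices of the least degree in it. Freeness recovers [y] at the head, and the head factor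
    can be cancelled. *)
Lemma expprod_inj s y y' :
  (forall c : 'I_m -> K, \sum_j c j *: X j = 0 -> forall j, c j = 0) ->
  uniq s -> sorted by_degree s -> expprod s y = expprod s y' ->
  forall j, j \in s -> y j = y' j.
Proof.
move=> free; elim: s => [|j0 s IH] //= /andP [j0s us] srt e.
have srt' : sorted by_degree s by apply: path_sorted srt.
have trD : transitive by_degree by move=> a b c; apply: le_trans.
have hD j : j \in j0 :: s -> deg j0 <= deg j.
  rewrite inE => /orP [/eqP -> //|js].
  by move: (order_path_min trD srt) => /allP /(_ j js).
have e0 : y j0 = y' j0.
  have : comp (- deg j0) (expprod (j0 :: s) y) = comp (- deg j0) (expprod (j0 :: s) y').
    by rewrite e.
  rewrite !comp_expprod // => /eqP; rewrite -subr_eq0 -sumrB => /eqP h.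
  pose c j := if (j \in j0 :: s) && (deg j == deg j0) then y j - y' j else 0.
  suff /free /(_ j0) : \sum_j c j *: X j = 0.
    by rewrite /c mem_head eqxx /= => /eqP; rewrite subr_eq0 => /eqP.
  rewrite -[RHS]h [RHS]big_mkcond [RHS]big_uniq /=; last by rewrite j0s.
  rewrite [LHS](bigID (mem (j0 :: s))) /= [X in _ + X]big1 ?addr0 => [|j /negbTE js].
    apply: eq_bigr => j js; rewrite /c js /=.
    by case: eqP => _; rewrite ?scale0r // scalerBl.
  by rewrite /c js scale0r.
move=> j; rewrite inE => /orP [/eqP -> //|]; apply: IH => //.
move: e; rewrite /expprod !big_cons e0 => /(congr1 (mulmx (expmx (- (y' j0 *: X j0))))).
by rewrite -[_ * _]/(_ *m _) -[X in _ = _ *m X]/(_ *m _) !mulmxA (expX_inv _ _).1 !mul1mx.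
Qed.

Variable eqn : 'M[K]_n -> Prop.
Hypothesis eqn_exp : forall j y L, eqn L -> eqn (expmx (y *: X j) *m L).
Hypothesis eqn_lead : forall L d, 0 < d -> eqn L -> degle (- d) (L - 1%:M) ->
  exists c : 'I_m -> K, comp (- d) L = \sum_(j | deg j == d) c j *: X j.

(** The last hypothesis is the invariant of the induction: leading components of [L] involve only
    the indices still in [s]. [eqn_lead] alone would let factors already removed come back. It
    suffices in degrees above that of the head, where by the third hypothesis every index belongs to
    [s]; in the degree of the head, multiplication by the inverse of its factor deletes exactly its
    term from the leading component. *)
Lemma peel_aux s : uniq s -> sorted by_degree s ->
  (forall j k, j \notin s -> k \in s -> deg j <= deg k) ->
  forall L, eqn L -> degle (-1) (L - 1%:M) ->
  (forall d, 0 < d -> degle (- d) (L - 1%:M) ->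
     exists c : 'I_m -> K, comp (- d) L = \sum_(j <- s | deg j == d) c j *: X j) ->
  exists y, L = expprod s y.
Proof.
elim: s => [|j0 s IH] /=.
  move=> _ _ _ L eL L1 lead; exists (fun=> 0); rewrite /expprod big_nil.
  apply/eqP; rewrite -subr_eq0; apply/eqP/degle_eq0 => d.
  have key k : degle (- k.+1%:Z) (L - 1%:M).
    elim: k => [//|k IH]; have [//|c] := lead k.+1%:Z _ IH.
    rewrite big_nil => c0; apply: (@degleW _ (- k.+1%:Z - 1)); first lia.
    by apply: degle_pred => //; rewrite compB c0 comp1 ?subr0 //; lia.
  by apply: (degleW _ (key `|d|%N)); lia.
move=> /andP [j0s us] srt hs L eL L1 lead.
have srt' : sorted by_degree s by apply: path_sorted srt.
have trD : transitive by_degree by move=> a b c; apply: le_trans.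
have hD j : j \in j0 :: s -> deg j0 <= deg j.
  rewrite inE => /orP [/eqP -> //|js].
  by move: (order_path_min trD srt) => /allP /(_ j js).
set D := deg j0 in hD; have D0 : 0 < D by apply: deg_gt0.
(* No index of the list has degree below [D], so the leading component vanishes there and the bound
   improves by one degree at a time. *)
have LD : degle (- D) (L - 1%:M).
  have key k : k.+1%:Z <= D -> degle (- k.+1%:Z) (L - 1%:M).
    elim: k => [//|k IHk] kD; have hk : degle (- k.+1%:Z) (L - 1%:M) by apply: IHk; lia.
    have [//|c hc] := lead k.+1%:Z _ hk.
    apply: (@degleW _ (- k.+1%:Z - 1)); first lia.
    apply: degle_pred => //; rewrite compB comp1 ?subr0; last lia.
    rewrite hc big_seq_cond big1 // => j /andP [/hD h1 /eqP h2]; lia.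
  have -> : D = (`|D|.-1).+1%:Z by lia.
  by apply: key; lia.
have [c hc] := lead D D0 LD.
move: hc; rewrite big_cons -/D eqxx => hc.
pose L' := expmx (- c j0 *: X j0) *m L.
have eXD : degle (- D) (expmx (- c j0 *: X j0) - 1%:M) by apply: expX_degle.
have L'D : degle (- D) (L' - 1%:M) by apply: degle_unip_mul.
have cL' : comp (- D) L' = \sum_(j <- s | deg j == D) c j *: X j.
  rewrite comp_unip_mul // hc comp_expmx //; last exact: (homogZ (@homX j0)).
  by rewrite scaleNr addrA addNr add0r.
have eL' : eqn L' by apply: eqn_exp.
have [|||y hy] := IH us srt' _ L' eL'.
- move=> j k; have [->|/eqP jj0] := eqVneq j j0.
    by move=> _ ks; apply: hD; rewrite inE ks orbT.
  move=> js ks; apply: hs; rewrite inE ?ks ?orbT // negb_or js andbT.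
  exact/eqP.
- by apply: degleW L'D; lia.
- move=> d d0 L'd; have [lt|lt|->] := ltgtP d D; last by exists c.
    exists (fun=> 0); rewrite big1 => [|j _]; last by rewrite scale0r.
    rewrite -[L'](subrK 1%:M) compD comp1 ?addr0; last lia.
    by rewrite (comp_degle L'D) //; lia.
  have [c' ->] := eqn_lead d0 eL' L'd; exists c'.
  rewrite [LHS](bigID (mem s)) /= [X in _ + X]big1 ?addr0; last first.
    move=> j /andP [/eqP jd js]; exfalso.
    suff : deg j <= D by lia.
    have [->//|jj] := eqVneq j j0.
    by apply: hs; rewrite ?mem_head // inE negb_or jj.
  rewrite [RHS]big_mkcond [RHS]big_uniq //= -[RHS]big_mkcondr.
  by apply: eq_bigl => j; rewrite andbC.
exists (fun j => if j == j0 then c j0 else y j).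
rewrite /expprod big_cons eqxx -[_ * _]/(_ *m _).
have -> : \prod_(j <- s) expmx ((if j == j0 then c j0 else y j) *: X j) = expprod s y.
  apply: eq_big_seq => j js; case: eqP => // jj; by rewrite -jj js in j0s.
by rewrite -hy /L' mulmxA scaleNr (expX_inv _ _).2 mul1mx.
Qed.

End Peel.
End Exponential.
End Grading.

Section UnipotentInverse.

Variables (n : nat) (gr : 'I_n -> int) (K : fieldType).
Implicit Types (A B : 'M[K]_n).

Definition unip A : Prop := degle gr (-1) (A - 1%:M).

Lemma unip_mul A B : unip A -> unip B -> unip (A *m B).
Proof. exact: (@degle_unip_mul _ _ _ 1). Qed.

(** The geometric series in [1%:M - A] ends by nilpotency, and all its terms after the first one are
    lowering. *)
Lemma unip_inv A : unip A -> exists2 B, unip B & A *m B = 1%:M.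
Proof.
move=> hA; pose N := 1%:M - A.
have hN : degle gr (-1) N by rewrite /N -opprB; apply: degleN.
have Nn := degle_nilp hN.
have hS k : (0 < k)%N -> degle gr (-1) (\sum_(j < k) N ^+ j - 1%:M).
  case: k => // k _; rewrite big_ord_recl expr0 addrAC subrr add0r.
  apply: degle_sum => j _.
  have hj : degle gr (- (1 : int) *+ bump 0 j) (N ^+ bump 0 j) by apply: degleX.
  by apply: (degleW _ hj); rewrite /bump add1n -mulr_natr; nia.
exists (\sum_(k < n) N ^+ k).
  have [n0|/hS //] := posnP n.
  by move=> p; have := ltn_ord p; lia.
have -> : A = - (N - 1) by rewrite /N addrAC subrr add0r opprK.
by rewrite mulNmx mulmxE -subrX1 Nn sub0r opprK.
Qed.

Lemma unip_unit A : unip A -> A \in unitmx.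
Proof. by move=> /unip_inv [B _ /mulmx1_unit []]. Qed.

Lemma unip_diag A : unip A -> (forall p q, p != q -> A p q = 0) -> A = 1%:M.
Proof.
move=> uA dA; apply/matrixP => p q; rewrite mxE; case: (eqVneq p q) => [->|/dA //].
apply/eqP; rewrite -subr_eq0; apply: contraT => h.
have := uA q q; rewrite !mxE eqxx => /(_ h); lia.
Qed.

End UnipotentInverse.

(** * LDU decompositions *)

Section LDU.

Variable K : fieldType.

(** Padding by the identity turns the leading principal minor of size [k] into the determinant of a
    matrix that keeps the size [n], for every natural number [k]. *)
Definition corner n k (A : 'M[K]_n) : 'M[K]_n :=
  \matrix_(p, q) if (p < k)%N && (q < k)%N then A p q else (p == q)%:R.

(** Gaussian elimination: the first row and column are cleared with the pivot [a0], and the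
    induction goes on with the Schur complement. Its leading minors are those of [A], of size one
    more, divided by [a0], hence nonzero. *)
Lemma ldu_exists n (A : 'M[K]_n) : (forall k, \det (corner k A) != 0) ->
  exists L D U : 'M[K]_n, [/\ A = L *m D *m U, is_diag_mx D,
    forall p q : 'I_n, (p <= q)%N -> L p q = (p == q)%:R
  & forall p q : 'I_n, (q <= p)%N -> U p q = (p == q)%:R].
Proof.
elim: n A => [|n IH] A hA.
  exists 1%:M, 1%:M, 1%:M; split; [|exact: scalar_mx_is_diag| |] => //.
  - by apply/matrixP => [[]].
  - by move=> [].
  - by move=> [].
move: A hA; rewrite -[n.+1]/(1 + n)%N => A hA.
pose a := ulsubmx A; pose r := ursubmx A.
pose c := dlsubmx A; pose B := drsubmx A.
have defA : A = block_mx a r c B by rewrite submxK.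
pose a0 := a 0 0; have ea : a = a0%:M by apply: mx11_scalar.
have det_block (r' : 'rV[K]_n) (c' : 'cV[K]_n) (B' : 'M[K]_n) : a0 != 0 ->
    \det (block_mx a r' c' B') = a0 * \det (B' - a0^-1 *: (c' *m r')).
  move=> a00; have -> : block_mx a r' c' B' =
     block_mx 1%:M 0 (a0^-1 *: c') 1%:M *m block_mx a r' 0 (B' - a0^-1 *: (c' *m r')).
    rewrite mulmx_block !mul1mx !mul0mx !addr0 -!scalemxAl; congr block_mx.
      by rewrite ea mul_mx_scalar scalerA mulVf // scale1r.
    by rewrite addrC subrK.
  by rewrite det_mulmx det_lblock det_ublock !det1 !mul1r ea det_scalar1.
have corner_block k : corner k.+1 A = block_mx a
   (\row_q if (q < k)%N then r 0 q else 0) (\col_p if (p < k)%N then c p 0 else 0) (corner k B).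
  apply/matrixP => p q; rewrite [in LHS]defA.
  case: (@split_ordP 1 n p) => p' ->; case: (@split_ordP 1 n q) => q' ->;
    rewrite ?(block_mxEul, block_mxEur, block_mxEdl, block_mxEdr) mxE
      ?(block_mxEul, block_mxEur, block_mxEdl, block_mxEdr) ?ord1 //=.
  - by rewrite [LHS]mxE /= block_mxEur.
  - by rewrite [LHS]mxE /= block_mxEdl andbT.
  - by rewrite [RHS]mxE eq_rshift.
have a00 : a0 != 0.
  have := hA 1%N; rewrite corner_block [X in block_mx _ X](_ : _ = 0); last first.
    by apply/rowP => q; rewrite !mxE.
  by rewrite det_lblock ea det_scalar1 mulf_eq0 negb_or => /andP [].
have [L [D [U [eB dD hL hU]]]] : exists L D U : 'M[K]_n, [/\ B - a0^-1 *: (c *m r) = L *m D *m U, is_diag_mx D,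
    forall p q : 'I_n, (p <= q)%N -> L p q = (p == q)%:R
  & forall p q : 'I_n, (q <= p)%N -> U p q = (p == q)%:R].
  apply: IH => k; have := hA k.+1; rewrite corner_block det_block // mulf_eq0 negb_or => /andP [_].
  congr (_ != 0); congr (\det _); apply/matrixP => p q; rewrite !mxE !big_ord1 !mxE.
  by case: (p < k)%N; case: (q < k)%N; rewrite /= ?mulr0 ?mul0r ?mulr0 ?subr0.
exists (block_mx 1%:M 0 (a0^-1 *: c) L : 'M_(1 + n)), (block_mx a 0 0 D : 'M_(1 + n)),
  (block_mx 1%:M (a0^-1 *: r) 0 U : 'M_(1 + n)); split.
- rewrite defA !mulmx_block !mul1mx !mul0mx !mulmx1 !mulmx0 !addr0 !add0r ea.
  have ec : a0^-1 *: c *m a0%:M = c by rewrite mul_mx_scalar scalerA mulfV // scale1r.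
  rewrite ec -eB; congr block_mx.
    by rewrite mul0mx addr0 mul_scalar_mx scalerA mulfV // scale1r.
  by rewrite -scalemxAr addrC subrK.
- apply/is_diag_mxP => p q.
  case: (@split_ordP 1 n p) => p' ->; case: (@split_ordP 1 n q) => q' ->;
    rewrite ?(block_mxEul, block_mxEur, block_mxEdl, block_mxEdr) ?mxE ?ord1 //=.
  by move=> h; apply: (is_diag_mxP dD).
- move=> p q; case: (@split_ordP 1 n p) => p' ->; case: (@split_ordP 1 n q) => q' ->;
    rewrite ?(block_mxEul, block_mxEur, block_mxEdl, block_mxEdr) ?ord1 ?mxE //=.
  by rewrite eq_rshift; apply: hL.
- move=> p q; case: (@split_ordP 1 n p) => p' ->; case: (@split_ordP 1 n q) => q' ->;
    rewrite ?(block_mxEul, block_mxEur, block_mxEdl, block_mxEdr) ?ord1 ?mxE //=.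
  by rewrite eq_rshift; apply: hU.
Qed.

End LDU.

Section LDUUnique.

Variables (n : nat) (gr : 'I_n -> int) (K : fieldType).
Let rg := fun p => - gr p.

(** Diagonal factors do not change supports. Off the diagonal, the quotient of the left factors has
    entries only where [gr p > gr q], and that of the right factors only where [gr p < gr q]; as the
    two quotients have the same support, both are diagonal and unipotent. *)
Lemma ldu_unique (A A' D D' B B' : 'M[K]_n) :
  unip rg A -> unip rg A' -> is_diag_mx D -> is_diag_mx D' -> D \in unitmx ->
  D' \in unitmx -> unip gr B -> unip gr B' ->
  A *m D *m B = A' *m D' *m B' -> [/\ A = A', D = D' & B = B'].
Proof.
move=> uA uA' dD dD' iD iD' uB uB' e.
have [A1 uA1 eA1] := unip_inv uA'; have [B1 uB1 eB1] := unip_inv uB.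
have e1 : (A1 *m A) *m D = D' *m (B' *m B1).
  have := congr1 (fun M => A1 *m M *m B1) e.
  by rewrite -!mulmxA eB1 mulmx1 !mulmxA (mulmx1C eA1) mul1mx -!mulmxA.
have dd (M : 'M[K]_n) : is_diag_mx M -> M \in unitmx -> forall p, M p p != 0.
  move=> /is_diag_mxP hM; rewrite unitmxE unitfE => dM p; apply: contraNneq dM => Mp.
  rewrite det_trig; last by apply/is_trig_mxP => u v uv; apply: hM; rewrite neq_ltn uv.
  by rewrite (bigD1 p) //= Mp mul0r.
have uA2 := unip_mul uA1 uA; have uB2 := unip_mul uB' uB1.
have offdiag (M1 M2 : 'M[K]_n) p q : M1 *m D = D' *m M2 ->
    p != q -> M1 p q * D q q = D' p p * M2 p q.
  move=> e2 pq; have := congr1 (fun M : 'M[K]_n => M p q) e2; rewrite !mxE.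
  rewrite (bigD1 q) //= big1 ?addr0 => [|u uq]; last first.
    by rewrite ((is_diag_mxP dD) u q) ?mulr0.
  rewrite [RHS](bigD1 p) //= [X in _ + X]big1 ?addr0 // => u up.
  by rewrite ((is_diag_mxP dD') p u) ?mul0r // eq_sym.
have unip_off (g : 'I_n -> int) (M : 'M[K]_n) p q : unip g M -> p != q ->
    M p q != 0 -> g p - g q <= -1.
  move=> uM pq nz; apply: uM; rewrite !mxE (negbTE pq) subr0 //.
have off p q : p != q -> (A1 *m A) p q = 0 /\ (B' *m B1) p q = 0.
  move=> pq; have := offdiag _ _ p q e1 pq.
  case: (eqVneq ((A1 *m A) p q) 0) => [-> | nA].
    rewrite mul0r => /esym/eqP; rewrite mulf_eq0 (negbTE (dd _ dD' iD' p)) /=.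
    by move/eqP.
  case: (eqVneq ((B' *m B1) p q) 0) => [-> /eqP | nB _].
    by rewrite mulr0 mulf_eq0 (negbTE nA) (negbTE (dd _ dD iD q)).
  have := unip_off _ _ _ _ uA2 pq nA; have := unip_off _ _ _ _ uB2 pq nB.
  by rewrite /rg; lia.
have A1A : A1 *m A = 1%:M.
  by apply: (unip_diag uA2) => p q /off [].
have B1B : B' *m B1 = 1%:M by apply: (unip_diag uB2) => p q /off [].
have eA : A = A' by rewrite -[LHS]mul1mx -eA1 -mulmxA A1A mulmx1.
have eB : B = B' by rewrite -[RHS]mulmx1 -(mulmx1C eB1) mulmxA B1B mul1mx.
by split=> //; move: e1; rewrite A1A B1B mul1mx mulmx1.
Qed.

End LDUUnique.

(** * Diagonalization of tori *)

Section LaurentPoly.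

Variables (C : fieldType).

(** This is P(z, 1/z) z^N. The truncated subtraction in the exponent is exact once [N] is at least
    [msize P]. *)
Definition laurent_poly N (P : {mpoly C[1 + 1]}) : {poly C} :=
  \sum_(m <- msupp P) P@_m *: 'X^(N + m (lshift 1 ord0) - m (rshift 1 ord0)).

Lemma laurent_polyE N P (K : fieldType) (i : {rmorphism C -> K}) (z : K) :
  (msize P <= N)%N -> z != 0 ->
  mmap i (fun k => row_mx (const_mx z : 'rV_1) (map_mx GRing.inv (const_mx z)) 0 k) P * z ^+ N
    = (map_poly i (laurent_poly N P)).[z].
Proof.
move=> hN z0; rewrite /mmap mulr_suml /laurent_poly rmorph_sum horner_sum.
rewrite big_seq [RHS]big_seq; apply: eq_bigr => m hm.
rewrite -mul_polyC rmorphM /= map_polyC map_polyXn hornerCM hornerXn -mulrA.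
congr (_ * _); rewrite /mmap1 big_split_ord !big_ord1 /= row_mxEl row_mxEr !mxE.
have le1 : (m (rshift 1 ord0) <= N)%N.
  apply: leq_trans hN; apply: leq_trans (ltnW (msize_mdeg_lt hm)).
  by rewrite mdegE (bigD1 (rshift 1 ord0)) //= leq_addr.
rewrite -addnBAC // addnC exprD -mulrA; congr (_ * _).
by rewrite exprB ?unitfE // exprVn mulrC.
Qed.

Lemma poly_coef_inj (charC : [pchar C] =i pred0) M a b (F G : nat -> 'M[C]_(a, b)) :
  (forall z, z != 0 -> \sum_(k < M) z ^+ k *: F k = \sum_(k < M) z ^+ k *: G k) ->
  forall k, (k < M)%N -> F k = G k.
Proof.
move=> e k kM; apply/matrixP => p q.
have : \poly_(j < M) (F j p q - G j p q) = 0.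
  apply: (poly_eq0_infinite charC) => z z0; rewrite horner_poly.
  have := congr1 (fun A : 'M_(a, b) => A p q) (e z z0); rewrite !summxE => /eqP.
  rewrite -subr_eq0 -sumrB => /eqP h; rewrite -[RHS]h; apply: eq_bigr => j _.
  by rewrite !mxE mulrBl ![_ * z ^+ _]mulrC.
by move/polyP/(_ k); rewrite coef_poly kM coef0 => /eqP; rewrite subr_eq0 => /eqP.
Qed.

Lemma idempotent_diagonalizable n (A : 'M[C]_n) : A *m A = A -> diagonalizable A.
Proof.
case: n A => [|n] A AA.
  by exists 1%:M; rewrite ?unitmx1 //; apply/is_diag_mxP => [[]].
apply/diagonalizableP; exists [:: 0; 1].
  by rewrite /= inE eq_sym oner_eq0.
rewrite !big_cons big_nil mulr1; apply: mxminpoly_min.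
rewrite polyC0 subr0 polyC1 rmorphM rmorphB rmorph1 /= horner_mx_X mulrBr.
by rewrite mulr1 -mulmxE AA subrr.
Qed.

End LaurentPoly.

Section TorusDiag.

Variables (C : closedFieldType) (charC : [pchar C] =i pred0).
Variables (l n : nat) (T : 'M[C]_n -> Prop) (h : {vspace 'M[C]_n}).
Variables (H : 'I_l -> subvs_of h) (Ti : 'I_l -> 'M[C]_n -> Prop).
Variable (t : 'I_l -> 'M[{mpoly C[1 + 1]}]_n).
Hypothesis ht : torus_parametrization T H Ti t.

Let f j (c : C) : 'M[C]_n := laurent_eval idfun (t j) (const_mx c).

Lemma one_param_mul j y z : y != 0 -> z != 0 -> f j (y * z) = f j y *m f j z.
Proof.
move=> y0 z0; case: ht => _ /(_ j) [_ _ hm _ _] _ _; rewrite -hm; first last.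
- by move=> k; rewrite mxE.
- by move=> k; rewrite mxE.
by congr laurent_eval; apply/rowP => k; rewrite !mxE.
Qed.

Lemma one_param_unit j z : z != 0 -> f j z \in unitmx.
Proof.
move=> z0; case: ht => _ /(_ j) [[hS _ _ _] _ _ hE _] _ _.
have : Ti j (f j z) by apply/hE; exists (const_mx z) => // k; rewrite mxE.
by move/hS => [].
Qed.

Lemma one_param1 j : f j 1 = 1%:M.
Proof.
have u := one_param_unit j (oner_neq0 C).
by rewrite -[LHS](mulKmx u) -one_param_mul ?oner_neq0 // mulr1 mulVmx.
Qed.

Lemma one_param_comm j k y z : y != 0 -> z != 0 -> f j y *m f k z = f k z *m f j y.
Proof.
move=> y0 z0; have [_ _ _ [_ _ hm _ _]] := ht.
pose r j y : 'rV[C]_l := \row_k if k == j then y else 1.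
have Gr j' y' : y' != 0 -> Gm (r j' y').
  by move=> ny k'; rewrite mxE; case: ifP => // _; apply: oner_neq0.
have tr j' y' : tmap idfun t (r j' y') = f j' y'.
  rewrite /tmap (eq_bigr (fun k' => if k' == j' then f j' y' else 1)); last first.
    move=> k' _; rewrite mxE; case: eqP => [->//|_]; exact: one_param1.
  by rewrite -big_mkcond big_pred1_eq.
rewrite -!tr -!hm //; try exact: Gr.
by congr tmap; apply/rowP => k'; rewrite !mxE mulrC.
Qed.

Let N := \max_j \max_p \max_q msize (t j p q).
Let M := \max_j \max_p \max_q size (laurent_poly N (t j p q)).
Let Q j k : 'M[C]_n := \matrix_(p, q) (laurent_poly N (t j p q))`_k.

Lemma one_paramE (K : fieldType) (i : {rmorphism C -> K}) j z : z != 0 ->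
  z ^+ N *: laurent_eval i (t j) (const_mx z) = \sum_(k < M) z ^+ k *: map_mx i (Q j k).
Proof.
move=> z0; apply/matrixP => p q; rewrite summxE !mxE mulrC laurent_polyE //; last first.
  apply: leq_trans (leq_bigmax j); apply: leq_trans (leq_bigmax p).
  exact: (leq_bigmax q).
rewrite (@horner_coef_wide _ M); last first.
  rewrite size_map_poly; apply: leq_trans (leq_bigmax j).
  by apply: leq_trans (leq_bigmax p); apply: (leq_bigmax q).
by apply: eq_bigr => k _; rewrite !mxE coef_map mulrC.
Qed.

Lemma coefQE j z : z != 0 -> z ^+ N *: f j z = \sum_(k < M) z ^+ k *: Q j k.
Proof.
move=> z0; rewrite (one_paramE idfun) //; apply: eq_bigr => k _; congr (_ *: _).
by apply/matrixP => p q; rewrite !mxE.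
Qed.

(** Comparing the coefficients of z and of y in f(yz) = f(y) f(z) shows the coefficient matrices to
    be orthogonal idempotents, the projections to the weight spaces of the one-parameter group. *)
Lemma coefQ_mul j a b : (a < M)%N -> (b < M)%N ->
  Q j a *m Q j b = if a == b then Q j b else 0.
Proof.
move=> aM bM.
have key y : y != 0 -> y ^+ b *: Q j b = \sum_(k < M) y ^+ k *: (Q j k *m Q j b).
  move=> y0; have := poly_coef_inj charC
    (F := fun k => y ^+ k *: Q j k) (G := fun k => y ^+ N *: f j y *m Q j k).
  move/(_ M) => ->//; first by rewrite coefQE // mulmx_suml; apply: eq_bigr => k _; rewrite scalemxAl.
  move=> z z0; transitivity ((y * z) ^+ N *: f j (y * z)).
    rewrite coefQE ?mulf_neq0 //; apply: eq_bigr => k _.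
    by rewrite scalerA exprMn mulrC.
  rewrite one_param_mul // exprMn -scalerA scalemxAr scalemxAl (coefQE j z0) mulmx_sumr.
  by apply: eq_bigr => k _; rewrite scalemxAr.
rewrite eq_sym; symmetry; apply: (poly_coef_inj charC (M := M)
  (F := fun k => if b == k then Q j b else 0) (G := fun k => Q j k *m Q j b)) aM => y y0.
rewrite -key // (bigD1 (Ordinal bM)) //= eqxx big1 ?addr0 // => k kb.
rewrite ifN ?scaler0 //; apply: contra kb => /eqP e.
by apply/eqP/val_inj.
Qed.

Lemma coefQ_comm j k a b : (a < M)%N -> (b < M)%N -> Q j a *m Q k b = Q k b *m Q j a.
Proof.
move=> aM bM.
have key y : y != 0 -> y ^+ N *: f j y *m Q k b = Q k b *m (y ^+ N *: f j y).
  move=> y0; apply: (poly_coef_inj charC (M := M)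
    (F := fun b => y ^+ N *: f j y *m Q k b)
    (G := fun b => Q k b *m (y ^+ N *: f j y))) bM => z z0.
  transitivity ((y ^+ N *: f j y) *m (z ^+ N *: f k z)).
    by rewrite (coefQE k z0) mulmx_sumr; apply: eq_bigr => c _; rewrite scalemxAr.
  have -> : (y ^+ N *: f j y) *m (z ^+ N *: f k z) = (z ^+ N *: f k z) *m (y ^+ N *: f j y).
    by rewrite -!scalemxAl -!scalemxAr one_param_comm // !scalerA mulrC.
  rewrite (coefQE k z0).
  by rewrite mulmx_suml; apply: eq_bigr => c _; rewrite scalemxAl.
apply: (poly_coef_inj charC (M := M)
  (F := fun a => Q j a *m Q k b) (G := fun a => Q k b *m Q j a)) aM => y y0.
transitivity (y ^+ N *: f j y *m Q k b).
  by rewrite coefQE // mulmx_suml; apply: eq_bigr => c _; rewrite scalemxAl.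
by rewrite key // coefQE // mulmx_sumr; apply: eq_bigr => c _; rewrite scalemxAr.
Qed.

Lemma coefQ_sum j : \sum_(k < M) Q j k = 1%:M.
Proof.
have := coefQE j (oner_neq0 C); rewrite expr1n scale1r one_param1 => ->.
by apply: eq_bigr => k _; rewrite expr1n scale1r.
Qed.

(** The commuting idempotents [Q j k] are diagonalized simultaneously over [C]. The one-parameter
    groups are combinations of these constant matrices over every extension [K], so the same [S] and
    the same exponents serve there. *)
Lemma one_param_diag : exists (S : 'M[C]_n) (e : 'I_n -> 'I_l -> int),
  S \in unitmx /\ forall (K : fieldType) (i : {rmorphism C -> K}) j z, z != 0 ->
    laurent_eval i (t j) (const_mx z) =
      map_mx i S *m diag_mx (\row_p z ^ e p j) *m map_mx i (invmx S).
Proof.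
pose Qs := [seq Q x.1 (x.2 : 'I_M) | x <- enum {: 'I_l * 'I_M}].
have [P uP /allP dP] : codiagonalizable Qs.
  apply/codiagonalizableP; split=> [A B|A].
    by move=> /mapP [[j k] _ ->] /mapP [[j' k'] _ ->]; apply: coefQ_comm.
  move=> /mapP [[j k] _ ->]; apply: idempotent_diagonalizable.
  by rewrite coefQ_mul // eqxx.
pose D j k := P *m Q j k *m invmx P.
have dD j (k : 'I_M) : is_diag_mx (D j k).
  have /dP : Q j k \in Qs by apply/mapP; exists (j, k); rewrite ?mem_enum.
  by move=> /similar_diagPp hp; apply/is_diag_mxP => p q pq; rewrite -(hp _ _ pq) conjumx.
have DM j a b : (a < M)%N -> (b < M)%N -> D j a *m D j b = if a == b then D j b else 0.
  move=> aM bM; rewrite /D !mulmxA mulmxKV // -(mulmxA P) coefQ_mul //.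
  by case: ifP; rewrite ?mulmx0 ?mul0mx.
have Dsum j : \sum_(k < M) D j k = 1%:M.
  by rewrite /D -mulmx_suml -mulmx_sumr coefQ_sum mulmx1 mulmxV.
have QD j k : Q j k = invmx P *m D j k *m P by rewrite /D !mulmxA mulVmx // mul1mx mulmxKV.
clearbody D.
have diagM (A B : 'M[C]_n) p : is_diag_mx A -> (A *m B) p p = A p p * B p p.
  move=> /is_diag_mxP dA; rewrite mxE (bigD1 p) //= big1 ?addr0 // => q qp.
  by rewrite dA ?mul0r // eq_sym.
(* The idempotents are orthogonal with sum 1, so exactly one of them has the entry 1 at the place
   [p] of the diagonal. *)
have ex p : exists e : 'I_l -> 'I_M, forall j (k : 'I_M), D j k p p = (k == e j)%:R.
  apply: (@fin_all_exists _ (fun=> 'I_M) (fun j e => forall k : 'I_M, D j k p p = (k == e)%:R)) => j.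
  have [k0 hk0] : exists k : 'I_M, D j k p p != 0.
    apply: NNPP => hn; have := congr1 (fun A : 'M_n => A p p) (Dsum j).
    rewrite summxE mxE eqxx big1 => [/esym/eqP|k _]; first by rewrite oner_eq0.
    by apply/eqP; apply: NNPP => hk; apply: hn; exists k; apply/negP.
  exists k0 => k; have := congr1 (fun A : 'M_n => A p p) (DM j k k0 (ltn_ord _) (ltn_ord _)).
  rewrite diagM //; case: (eqVneq k k0) => [->|ne]; last first.
    by rewrite [X in if X then _ else _](negbTE ne) [RHS]mxE => /eqP; rewrite mulf_eq0 (negbTE hk0) orbF => /eqP.
  by rewrite eqxx => e1; apply: (mulIf hk0); rewrite e1 mul1r.
have [e0 he0] := fin_all_exists ex.
(* The shift by [N] undoes the factor z^N that cleared the denominators. *)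
exists (invmx P), (fun p j => (e0 p j)%:Z - N%:Z); split; first by rewrite unitmx_inv.
move=> K i j z z0; have zN : z ^+ N != 0 by rewrite expf_neq0.
apply: (scalerI zN); rewrite one_paramE // invmxK.
rewrite (eq_bigr (fun k : 'I_M => map_mx i (invmx P) *m (z ^+ k *: map_mx i (D j k)) *m map_mx i P)); last first.
  by move=> k _; rewrite {1}QD !map_mxM -scalemxAr -scalemxAl.
rewrite -mulmx_suml -mulmx_sumr scalemxAl scalemxAr; congr (_ *m _ *m _).
apply/matrixP => p q; rewrite summxE !mxE; case: (eqVneq p q) => [<-|pq].
  rewrite mulr1n (bigD1 (e0 p j)) //= big1 ?addr0 => [|k ke]; last first.
    by rewrite !mxE he0 (negbTE ke) rmorph0 mulr0.
  rewrite !mxE he0 eqxx rmorph1 mulr1 expfzDr // -exprnN -exprnP mulrC.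
  by rewrite divfK.
rewrite mulr0n mulr0 big1 // => k _; rewrite !mxE.
by have /is_diag_mxP/(_ p q pq) -> := dD j k; rewrite rmorph0 mulr0.
Qed.

End TorusDiag.

(** * Root spaces *)

Section SpanMap.

Variables (K : fieldType) (V : vectType K) (T : eqType) (F : T -> V).

Lemma span_mapP (s : seq T) v : uniq s -> v \in <<[seq F x | x <- s]>>%VS ->
  exists c : T -> K, v = \sum_(x <- s) c x *: F x.
Proof.
elim: s v => [|x s IH] v /= => [_|/andP [xs us]].
  by rewrite span_nil memv0 => /eqP ->; exists (fun=> 0); rewrite big_nil.
rewrite span_cons => /memv_addP [u /vlineP [a ->] [w /(IH _ us) [c ->] ->]].
exists (fun y => if y == x then a else c y); rewrite big_cons eqxx.
congr (_ + _); apply: eq_big_seq => y ys; case: eqP => // e.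
by rewrite -e ys in xs.
Qed.

Lemma free_mapP (s : seq T) (c : T -> K) : uniq s -> free [seq F x | x <- s] ->
  \sum_(x <- s) c x *: F x = 0 -> forall x, x \in s -> c x = 0.
Proof.
elim: s => [|x s IH] //= /andP [xs us]; rewrite free_cons => /andP [nx fs].
rewrite big_cons => e.
have cx : c x = 0.
  apply/eqP; apply: contraNT nx => cx.
  have -> : F x = - (c x)^-1 *: \sum_(y <- s) c y *: F y.
    move/eqP: e; rewrite addr_eq0 => /eqP e.
    by rewrite -[X in _ *: X]opprK -e scaleNr scalerN opprK scalerA mulVf // scale1r.
  rewrite memvZ // big_seq; apply: memv_suml => y ys; rewrite memvZ //.
  by apply: memv_span; apply: map_f.
move=> y; rewrite inE => /orP [/eqP -> //|]; apply: (IH us fs).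
by move: e; rewrite cx scale0r add0r.
Qed.

End SpanMap.

Section Bracket.

Variables (C : fieldType) (n : nat).
Implicit Types (A B D : 'M[C]_n).

Lemma bracketDr A B D : bracket A (B + D) = bracket A B + bracket A D.
Proof. by rewrite /bracket mulmxDr mulmxDl opprD addrACA. Qed.

Lemma bracketZr A c B : bracket A (c *: B) = c *: bracket A B.
Proof. by rewrite /bracket -scalemxAr -scalemxAl scalerBr. Qed.

Lemma bracketZl c A B : bracket (c *: A) B = c *: bracket A B.
Proof. by rewrite /bracket -scalemxAr -scalemxAl scalerBr. Qed.

Lemma bracketC A B : bracket A B = - bracket B A.
Proof. by rewrite /bracket opprB. Qed.

Lemma bracket0 A : bracket A 0 = 0.
Proof. by rewrite /bracket mulmx0 mul0mx subrr. Qed.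

Lemma bracket_sumr A (T : Type) (r : seq T) (P : pred T) F :
  bracket A (\sum_(t <- r | P t) F t) = \sum_(t <- r | P t) bracket A (F t).
Proof.
apply: (big_morph (bracket A)); last exact: bracket0.
by move=> x y; apply: bracketDr.
Qed.

Lemma bracket_conj (P Q A B : 'M[C]_n) : Q *m P = 1%:M ->
  bracket (P *m A *m Q) (P *m B *m Q) = P *m bracket A B *m Q.
Proof.
move=> QP; rewrite /bracket mulmxBr mulmxBl; congr (_ - _).
  by rewrite !mulmxA -(mulmxA _ Q P) QP mulmx1.
by rewrite !mulmxA -(mulmxA _ Q P) QP mulmx1.
Qed.

End Bracket.

Section RootSpaces.

Variables (C : fieldType) (l n : nat) (g h : {vspace 'M[C]_n}).
Variables (Phi : seq (dualv h)) (H : 'I_l -> subvs_of h) (X : dualv h -> 'M[C]_n).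
Hypothesis hPhi : root_system g Phi.
Hypothesis basisX : basis_of g ([seq vsval (H i) | i <- enum 'I_l] ++ [seq X a | a <- Phi]).
Hypothesis rootX : forall a, a \in Phi -> root_space g a (X a).
Hypothesis h_abel : forall A B : subvs_of h, bracket (vsval A) (vsval B) = 0.
Hypothesis h_sub : forall A : subvs_of h, vsval A \in g.

Let comb (u : 'I_l -> C) (v : dualv h -> C) : 'M[C]_n :=
  \sum_j u j *: vsval (H j) + \sum_(b <- Phi) v b *: X b.

Lemma root_uniq : uniq Phi. Proof. exact: hPhi.1. Qed.

Lemma expand_g A : A \in g -> exists u v, A = comb u v.
Proof.
move=> Ag; have : A \in <<[seq vsval (H i) | i <- enum 'I_l] ++ [seq X a | a <- Phi]>>%VS.
  by rewrite (span_basis basisX).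
rewrite span_cat => /memv_addP [A1 /(span_mapP (enum_uniq _)) [u ->]].
move=> [A2 /(span_mapP root_uniq) [v ->] ->].
by exists u, v; rewrite /comb big_enum.
Qed.

Lemma comb_free u v : comb u v = 0 -> (forall j, u j = 0) /\ forall b, b \in Phi -> v b = 0.
Proof.
have := basis_free basisX; rewrite cat_free => /and3P [f1 f2 dx] e.
have e1 : \sum_j u j *: vsval (H j) = 0 /\ \sum_(b <- Phi) v b *: X b = 0.
  have := directv_addP dx.
  set V1 := <<_>>%VS; set V2 := <<_>>%VS => dx'.
  have m1 : \sum_j u j *: vsval (H j) \in V1.
    by apply: memv_suml => j _; apply/memvZ/memv_span/mapP; exists j; rewrite ?mem_enum.
  have m2 : \sum_(b <- Phi) v b *: X b \in V2.
    by rewrite big_seq; apply: memv_suml => b bP; apply/memvZ/memv_span/mapP; exists b.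
  have m12 : \sum_j u j *: vsval (H j) \in (V1 :&: V2)%VS.
    rewrite memv_cap m1 /=; move/eqP: e; rewrite addr_eq0 => /eqP ->.
    by rewrite memvN.
  move: m12; rewrite dx' memv0 => /eqP e1; split=> //.
  by move: e; rewrite /comb e1 add0r.
split=> [j|b bP]; last exact: (free_mapP root_uniq f2 e1.2).
have e2 : \sum_(j <- enum 'I_l) u j *: vsval (H j) = 0 by rewrite big_enum e1.1.
by apply: (free_mapP (enum_uniq _) f1 e2); rewrite mem_enum.
Qed.

Lemma dual_neq (a b : dualv h) : a != b -> exists B, a B != b B.
Proof.
move=> ab; apply: NNPP => hn; case/eqP: ab; apply/lfunP => B.
by apply/eqP; apply: NNPP => h'; apply: hn; exists B; apply/negP.
Qed.

Lemma root_neq0 a : a \in Phi -> a != 0.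
Proof. by move/hPhi.2 => []. Qed.

Lemma rootX_neq0 a : a \in Phi -> X a != 0.
Proof.
move=> aP; apply/eqP => X0.
have : comb (fun=> 0) (fun b => (b == a)%:R) = 0.
  rewrite /comb big1 ?add0r => [|j _]; last by rewrite scale0r.
  by rewrite big1 // => b _; case: eqP => [->|_]; rewrite ?X0 ?scaler0 ?scale0r.
move=> /comb_free [_ /(_ a aP) /eqP].
by rewrite eqxx oner_eq0.
Qed.

(* The coefficients of [A] which belong to the weight [a] are the only ones
   that survive in [bracket B A - a B *: A]. *)
Lemma bracket_comb (a : dualv h) (B : subvs_of h) u v :
  bracket (vsval B) (comb u v) - a B *: comb u v =
  comb (fun j => - (a B) * u j) (fun b => (b B - a B) * v b).
Proof.
rewrite /comb bracketDr !bracket_sumr big1 ?add0r => [|j _]; last first.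
  by rewrite bracketZr h_abel scaler0.
rewrite scalerDr opprD addrCA !scaler_sumr -!sumrN -big_split /=; congr (_ + _).
  by apply: eq_bigr => j _; rewrite scalerA mulNr scaleNr.
rewrite big_seq [RHS]big_seq; apply: eq_bigr => b /rootX [_ hb].
by rewrite bracketZr hb !scalerA mulrBl scalerBl [b B * _]mulrC.
Qed.

(** When [A] is expanded in the Chevalley basis, [bracket_comb] multiplies each coefficient by a
    difference of weights. For every basis vector other than [X a] this difference is nonzero at
    some [B], so its coefficient vanishes. *)
Lemma root_space_line a A : a != 0 -> root_space g a A -> A != 0 ->
  a \in Phi /\ exists c, A = c *: X a.
Proof.
move=> a0 [Ag hA] A0; have aP : a \in Phi by apply/hPhi.2; split=> //; exists A.
split=> //; have [u [v eA]] := expand_g Ag; exists (v a).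
have key B : (forall j, - (a B) * u j = 0) /\ forall b, b \in Phi -> (b B - a B) * v b = 0.
  by apply: comb_free; rewrite -bracket_comb -eA hA subrr.
have u0 j : u j = 0.
  have [B] := dual_neq a0; rewrite lfunE /= => aB.
  by have [/(_ j) /eqP] := key B; rewrite mulf_eq0 oppr_eq0 (negbTE aB) => /eqP.
rewrite eA /comb big1 ?add0r => [|j _]; last by rewrite u0 scale0r.
rewrite (bigD1_seq a) ?root_uniq //= big_seq_cond big1 ?addr0 // => b /andP [bP ba].
have [B bB] := dual_neq ba; have [_ /(_ b bP) /eqP] := key B.
by rewrite mulf_eq0 subr_eq0 (negbTE bB) => /eqP ->; rewrite scale0r.
Qed.

(** The argument of [root_space_line] for the weight 0, which is the weight of [h] as [h] is
    abelian. *)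
Lemma h_span (B : subvs_of h) : exists u, vsval B = \sum_j u j *: vsval (H j).
Proof.
have [u [v eB]] := expand_g (h_sub B); exists u; rewrite eB /comb.
rewrite [X in _ + X]big1_seq ?addr0 // => b /andP [_ bP].
have [B' bB'] := dual_neq (root_neq0 bP); rewrite lfunE /= in bB'.
have : comb (fun j => - ((0 : dualv h) B') * u j) (fun b => (b B' - (0 : dualv h) B') * v b) = 0.
  by rewrite -bracket_comb -eB h_abel lfunE /= scale0r subr0.
move=> /comb_free [_ /(_ b bP)] /eqP.
by rewrite [(0 : dualv h) _]lfunE /= subr0 mulf_eq0 (negbTE bB') => /eqP ->; rewrite scale0r.
Qed.

Lemma H_indep (u : 'I_l -> C) : \sum_j u j *: vsval (H j) = 0 -> forall j, u j = 0.
Proof.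
move=> e; have : comb u (fun=> 0) = 0.
  by rewrite /comb e add0r big1 // => b _; rewrite scale0r.
by case/comb_free.
Qed.

Lemma dual_ext (a b : dualv h) : (forall j, a (H j) = b (H j)) -> a = b.
Proof.
move=> e; apply/lfunP => B; have [u eB] := h_span B.
have -> : B = \sum_j u j *: H j.
  by apply: subvs_inj; rewrite [LHS]eB linear_sum; apply: eq_bigr => j _.
by rewrite !linear_sum; apply: eq_bigr => j _; rewrite !linearZ /= e.
Qed.

Lemma coroot_neg a (Ha : subvs_of h) : (2%:R : C) != 0 -> a \in Phi -> coroot g a Ha -> - a \in Phi.
Proof.
move=> two aP [a2 [A [B [_ hB e]]]].
have B0 : B != 0.
  apply: contraTneq two => B0; rewrite -a2.
  have -> : Ha = 0 by apply: subvs_inj; rewrite [LHS]e B0 bracket0 linear0.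
  by rewrite linear0 eqxx.
by apply/hPhi.2; split; [rewrite oppr_eq0 root_neq0|exists B].
Qed.

Lemma coroot_unique a (H1 H2 : subvs_of h) : (2%:R : C) != 0 -> a \in Phi ->
  coroot g a H1 -> coroot g a H2 -> H1 = H2.
Proof.
move=> two aP c1 c2; have nP := coroot_neg two aP c1.
have line H' : coroot g a H' -> exists d, vsval H' = d *: bracket (X a) (X (- a)).
  move=> [a2 [A [B [hA hB e]]]].
  have [A0|A0] := eqVneq A 0.
    by exists 0; rewrite e A0 bracketC bracket0 oppr0 scale0r.
  have [B0|B0] := eqVneq B 0; first by exists 0; rewrite e B0 bracket0 scale0r.
  have [_ [d1 eA]] := root_space_line (root_neq0 aP) hA A0.
  have [_ [d2 eB]] := root_space_line (root_neq0 nP) hB B0.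
  by exists (d1 * d2); rewrite e eA eB bracketZl bracketZr scalerA.
have [d1 e1] := line _ c1; have [d2 e2] := line _ c2.
have d20 : d2 != 0.
  apply: contraTneq two => d0; rewrite -c2.1.
  have -> : H2 = 0 by apply: subvs_inj; rewrite [LHS]e2 d0 scale0r linear0.
  by rewrite linear0 eqxx.
have e12 : H1 = (d1 / d2) *: H2.
  by apply: subvs_inj; rewrite linearZ /= e2 scalerA divfK // e1.
have := c1.1; rewrite {1}e12 linearZ /= c2.1 => /eqP.
rewrite -[X in _ == X]mul1r (inj_eq (mulIf two)) => /eqP d12.
by rewrite e12 d12 scale1r.
Qed.

End RootSpaces.

Lemma conj_unitK (C : fieldType) n (r Z : 'M[C]_n) : r \in unitmx ->
  invmx r *m (r *m Z *m invmx r) *m r = Z.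
Proof. by move=> u; rewrite !mulmxA mulVmx // mul1mx mulmxKV. Qed.

(** * The Weyl group *)

Section Weyl.

Variables (C : fieldType) (charC : [pchar C] =i pred0).
Variables (l n : nat) (G : 'M[C]_n -> Prop) (g h : {vspace 'M[C]_n}).
Variables (Phi : seq (dualv h)) (Delta : 'I_l -> dualv h) (k : dualv h -> 'I_l -> int).
Variables (H : 'I_l -> subvs_of h) (X : dualv h -> 'M[C]_n).
Hypothesis hPhi : root_system g Phi.
Hypothesis hDelta : root_basis Phi Delta k.
Hypothesis hX : chevalley_basis g Phi Delta H X.
Hypothesis h_abel : forall A B : subvs_of h, bracket (vsval A) (vsval B) = 0.
Hypothesis G_mul : forall x y, G x -> G y -> G (x *m y).
Hypothesis G_unit : forall x, G x -> x \in unitmx.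
Hypothesis adG : forall x A, G x -> A \in g -> x *m A *m invmx x \in g.
Hypothesis brX : forall a B, a \in Phi -> B \in g -> bracket (X a) B \in g.
Hypothesis nilX : forall a, a \in Phi -> X a ^+ n = 0.
Hypothesis expX : forall a c, a \in Phi -> G (expmx (c *: X a)).

Lemma two_neq0 : (2%:R : C) != 0. Proof. by rewrite natf_eq0. Qed.

Notation s_ := (simple_reflection Delta H).
Notation word := (weyl_word Delta H).

Let basisX := let: And5 b _ _ _ _ := hX in b.
Let rootX : forall a, a \in Phi -> root_space g a (X a) := let: And5 _ _ r _ _ := hX in r.
Let corootH : forall i, coroot g (Delta i) (H i) := let: And5 _ c _ _ _ := hX in c.
Let DeltaP : forall i, Delta i \in Phi := let: And3 d _ _ := hDelta in d.

Definition sv i (B : subvs_of h) : subvs_of h := B - (Delta i B : C) *: H i.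

Lemma DeltaH i : Delta i (H i) = 2%:R. Proof. by case: (corootH i). Qed.

Lemma svK i B : sv i (sv i B) = B.
Proof.
rewrite /sv linearB /= [Delta i (_ *: H i)]linearZ /= DeltaH.
set c : C := Delta i B; have -> : (c - c *: (2%:R : C^o) : C) = - c.
  by rewrite -[c *: _]/(c * 2%:R) mulr_natr mulr2n opprD addrA subrr sub0r.
by rewrite scaleNr opprK subrK.
Qed.

Lemma s_E i (a : dualv h) B : s_ i a B = a (sv i B).
Proof.
rewrite /simple_reflection /sv lfunE /= lfunE /= lfunE /= linearB /= [a (_ *: H i)]linearZ /=.
by congr (_ - _); rewrite -[LHS]/(_ * _) -[RHS]/(_ * _) mulrC.
Qed.

Lemma s_K i a : s_ i (s_ i a) = a.
Proof. by apply/lfunP => B; rewrite !s_E svK. Qed.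

Lemma s_D i a b : s_ i (a + b) = s_ i a + s_ i b.
Proof. by apply/lfunP => B; rewrite s_E lfunE /= lfunE /= !s_E. Qed.

Lemma s_Z i c a : s_ i (c *: a) = c *: s_ i a.
Proof. by apply/lfunP => B; rewrite s_E lfunE /= lfunE /= !s_E. Qed.

Lemma s_N i a : s_ i (- a) = - s_ i a.
Proof. by rewrite -scaleN1r s_Z scaleN1r. Qed.

Lemma s_0 i : s_ i 0 = 0.
Proof. by have := s_Z i 0 0; rewrite !scale0r. Qed.

Lemma opp_root a : a \in Phi -> - a \in Phi.
Proof.
case: hX => _ _ _ hcr _ aP; have [Ha cHa _] := hcr a aP.
exact: (coroot_neg hPhi two_neq0 aP cHa).
Qed.

(** The image of the matrix with rows (0, 1) and (-1, 0) in the SL_2 attached to the simple root.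
    Realizing the reflection by an element of [G] shows that it permutes the roots. *)
Definition refl_rep i : 'M[C]_n :=
  expmx (X (Delta i)) *m expmx (- X (- Delta i)) *m expmx (X (Delta i)).

Lemma refl_rep_G i : G (refl_rep i).
Proof.
have e1 := expX 1 (DeltaP i); have e2 := expX (-1) (opp_root (DeltaP i)).
by rewrite scale1r in e1; rewrite scaleN1r in e2; apply: (G_mul (G_mul _ _)).
Qed.

Lemma bracket_simple i : bracket (X (Delta i)) (X (- Delta i)) = vsval (H i).
Proof.
case: hX => _ _ _ hcr _; have [Ha cHa ->] := hcr _ (DeltaP i).
by rewrite (coroot_unique hPhi basisX rootX h_abel two_neq0 (DeltaP i) cHa (corootH i)).
Qed.

(* exp(X) exp(-Y) exp(X) acts on h as the reflection, by three applications
   of the exponential of ad. *)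
Lemma refl_rep_conj i B :
  refl_rep i *m vsval B = vsval (sv i B) *m refl_rep i.
Proof.
set a := Delta i; set Xa := X a; set Y := X (- a).
have aP : a \in Phi := DeltaP i; have naP := opp_root aP.
have rX (B' : subvs_of h) : vsval B' *m Xa = Xa *m vsval B' + (a B' : C) *: Xa.
  by have [_ /(_ B') e] := rootX aP; rewrite -e /bracket addrC subrK.
have rY (B' : subvs_of h) : vsval B' *m Y = Y *m vsval B' - (a B' : C) *: Y.
  have [_ /(_ B') e] := rootX naP; move: e; rewrite lfunE /= scaleNr => <-.
  by rewrite /bracket addrC subrK.
have XY : Xa *m Y = Y *m Xa + vsval (H i).
  by rewrite -bracket_simple /bracket addrC subrK.
have nX := nilX aP; have nY : (- Y) ^+ n = 0.
  by rewrite exprNn nilX ?mulr0.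
have step1 : expmx Xa *m vsval B = (vsval B - (a B : C) *: Xa) *m expmx Xa.
  rewrite (@expmx_ad2 _ charC _ Xa (vsval B) (- ((a B : C) *: Xa)) 0) //.
  - by rewrite scaler0 addr0.
  - by rewrite -!mulmxE rX addrK.
  - by rewrite addr0 mulrN mulNr -!mulmxE -scalemxAl -scalemxAr.
  - by rewrite mulr0 mul0r.
set b : C := a B in step1 *.
have svB : vsval (sv i B) = vsval B - b *: vsval (H i).
  by rewrite /sv linearB.
have rXB : vsval B *m Xa = Xa *m vsval B + b *: Xa := rX B.
have rYB : vsval B *m Y = Y *m vsval B - b *: Y := rY B.
have HY : vsval (H i) *m Y = Y *m vsval (H i) - 2%:R *: Y by rewrite rY DeltaH.
have HX : vsval (H i) *m Xa = Xa *m vsval (H i) + 2%:R *: Xa by rewrite rX DeltaH.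
clearbody b.
have step2 : expmx (- Y) *m (vsval B - b *: Xa) = (vsval (sv i B) - b *: Xa) *m expmx (- Y).
  rewrite (@expmx_ad2 _ charC _ (- Y) _ (- (b *: Y) - b *: vsval (H i)) ((b * 2%:R) *: Y)) //.
  - congr (_ *m _); rewrite scalerA mulrCA mulVf ?two_neq0 // mulr1 svB.
    by apply/matrixP => p q; rewrite !mxE; ring.
  - rewrite -!mulmxE !(mulNmx, mulmxN, mulmxBl, mulmxBr) -!(scalemxAl, scalemxAr) rYB XY.
    move: (Y *m vsval B) (Y *m Xa) => u v.
    by apply/matrixP => p q; rewrite !mxE; ring.
  - rewrite -!mulmxE !(mulNmx, mulmxN, mulmxBl, mulmxBr) -!(scalemxAl, scalemxAr) HY.
    move: (Y *m vsval (H i)) (Y *m Y) => u v.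
    by apply/matrixP => p q; rewrite !mxE; ring.
  - by rewrite -!mulmxE !(mulNmx, mulmxN) -scalemxAl -scalemxAr.
have step3 : expmx Xa *m (vsval (sv i B) - b *: Xa) = vsval (sv i B) *m expmx Xa.
  rewrite (@expmx_ad2 _ charC _ Xa _ (b *: Xa) 0) //.
  - by rewrite scaler0 addr0 subrK.
  - rewrite -!mulmxE svB !(mulmxBl, mulmxBr) -!(scalemxAl, scalemxAr) rXB HX.
    move: (Xa *m vsval B) (Xa *m vsval (H i)) (Xa *m Xa) => u v w.
    by apply/matrixP => p q; rewrite !mxE; ring.
  - by rewrite addr0 -!mulmxE -scalemxAl -scalemxAr.
  - by rewrite mulr0 mul0r.
by rewrite /refl_rep -/a -/Xa -/Y -!mulmxA step1 !mulmxA -(mulmxA _ _ (_ - _)) step2 !mulmxA step3.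
Qed.

Lemma refl_rep_conjV i B : invmx (refl_rep i) *m vsval B *m refl_rep i = vsval (sv i B).
Proof.
have u := G_unit (refl_rep_G i).
by rewrite -{1}[B](svK i) -mulmxA -refl_rep_conj mulKmx.
Qed.

Lemma conj_root_space x (a b : dualv h) A : G x -> root_space g a A ->
  (forall B : subvs_of h, exists2 B' : subvs_of h,
     vsval B' = invmx x *m vsval B *m x & a B' = b B) ->
  root_space g b (x *m A *m invmx x).
Proof.
move=> Gx [Ag hA] hb; have u := G_unit Gx; split; first exact: adG.
move=> B; have [B' eB' <-] := hb B.
have -> : vsval B = x *m vsval B' *m invmx x.
  by rewrite eB' !mulmxA mulmxV // mul1mx -mulmxA mulmxV // mulmx1.
by rewrite bracket_conj ?mulVmx // hA -scalemxAr -scalemxAl.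
Qed.

Lemma refl_root_space i a A : root_space g a A ->
  root_space g (s_ i a) (refl_rep i *m A *m invmx (refl_rep i)).
Proof.
move=> hA; apply: conj_root_space hA _; first exact: refl_rep_G.
by move=> B; exists (sv i B); rewrite ?refl_rep_conjV ?s_E.
Qed.

Lemma s_root i a : a \in Phi -> s_ i a \in Phi.
Proof.
move=> aP; have := refl_root_space i (rootX aP).
have u := G_unit (refl_rep_G i).
move/(root_space_line hPhi basisX rootX h_abel) => h'; apply: (h' _ _).1.
  apply/eqP => s0; have := root_neq0 hPhi aP; rewrite -[a](s_K i) s0.
  by rewrite s_0 eqxx.
apply/eqP => X0; have := rootX_neq0 hPhi basisX aP.
have -> : X a = invmx (refl_rep i) *m (refl_rep i *m X a *m invmx (refl_rep i)) *m refl_rep i.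
  by rewrite conj_unitK.
by rewrite X0 mulmx0 mul0mx eqxx.
Qed.

Lemma s_coroot i a Ha : coroot g a Ha -> coroot g (s_ i a) (sv i Ha).
Proof.
move=> [a2 [A [B [hA hB e]]]]; split; first by rewrite s_E svK.
have u := G_unit (refl_rep_G i).
exists (refl_rep i *m A *m invmx (refl_rep i)), (refl_rep i *m B *m invmx (refl_rep i)); split.
- exact: refl_root_space.
- by rewrite -s_N; apply: refl_root_space.
- by rewrite bracket_conj ?mulVmx // -e refl_rep_conj mulmxK.
Qed.

Definition pos (a : dualv h) : bool := [forall j, 0 <= k a j].

Lemma root_coef a : a \in Phi -> a = \sum_i Delta i *~ k a i.
Proof. by case: hDelta => _ _ e /e []. Qed.

Lemma root_sign a : a \in Phi -> ~~ pos a -> forall i, k a i <= 0.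
Proof.
case: hDelta => _ _ e /e [_ [p|//]] /negP []; by apply/forallP.
Qed.

Lemma Delta_indep (c : 'I_l -> C) : \sum_i c i *: Delta i = 0 -> forall i, c i = 0.
Proof.
case: hDelta => _ fr _ e i; rewrite -big_enum in e.
by apply: (free_mapP (enum_uniq _) fr e); rewrite mem_enum.
Qed.

Lemma DeltaZ (c : 'I_l -> int) : \sum_i Delta i *~ c i = \sum_i (c i)%:~R *: Delta i.
Proof. by apply: eq_bigr => i _; rewrite scaler_int. Qed.

Lemma coef_unique a c : a \in Phi -> a = \sum_i Delta i *~ c i -> forall i, k a i = c i.
Proof.
move=> aP e i; apply: (intf_inj charC); apply/eqP; rewrite -subr_eq0; apply/eqP.
apply: (Delta_indep (c := fun i => (k a i)%:~R - (c i)%:~R)) i.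
under eq_bigr do rewrite scalerBl; rewrite sumrB -!DeltaZ -root_coef // -e subrr //.
Qed.

Lemma pos_neq a : a \in Phi -> pos a -> exists i, 0 < k a i.
Proof.
move=> aP /forallP p; apply: NNPP => hn.
have /eqP := root_neq0 hPhi aP; apply; rewrite (root_coef aP) big1 // => i _.
have -> : k a i = 0; last by rewrite mulr0z.
apply/eqP; rewrite eq_le p andbT leNgt; apply/negP => lt; apply: hn; by exists i.
Qed.

Lemma posN a : a \in Phi -> pos (- a) = ~~ pos a.
Proof.
move=> aP; have naP := opp_root aP.
have kN i : k (- a) i = - k a i.
  apply: (coef_unique (c := fun i => - k a i)) => //.
  by rewrite {1}(root_coef aP) -sumrN; apply: eq_bigr => j _; rewrite mulrNz.
apply/idP/idP => [pn|/(root_sign aP) p]; last first.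
  by apply/forallP => i; rewrite kN oppr_ge0.
apply/negP => /forallP p; have [i] := pos_neq naP pn.
by rewrite kN oppr_gt0 ltNge p.
Qed.

Lemma pos_Delta i : pos (Delta i).
Proof.
apply/forallP => j; have -> : k (Delta i) j = (j == i)%:R.
  apply: (coef_unique (c := fun j => (j == i)%:R)) => //.
  rewrite (bigD1 i) //= eqxx big1 ?addr0 // => j' /negbTE ->; by rewrite mulr0z.
by case: (j == i).
Qed.

Lemma bracket_rs (a b : dualv h) A B : root_space g a A -> root_space g b B ->
  bracket A B \in g -> root_space g (a + b) (bracket A B).
Proof.
move=> [_ hA] [_ hB] AB; split=> // D; rewrite lfunE /=.
have := hA D; have := hB D; rewrite /bracket => eB eA.
transitivity (bracket (bracket (vsval D) A) B + bracket A (bracket (vsval D) B)).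
  rewrite /bracket !mulmxBr !mulmxBl !mulmxA; move: (_ *m A *m B) => u.
  set v := _ *m _ *m _; set w := _ *m _ *m _; set x := _ *m _ *m _.
  by apply/matrixP => p q; rewrite !mxE; ring.
by rewrite /bracket eA eB -/(bracket _ _) -/(bracket A _) bracketZl bracketZr -scalerDl.
Qed.

Lemma jacobi (A B D : 'M[C]_n) :
  bracket A (bracket B D) = bracket (bracket A B) D + bracket B (bracket A D).
Proof.
rewrite /bracket !mulmxBr !mulmxBl !mulmxA.
do !move: (_ *m _ *m _) => ?.
by apply/matrixP => p q; rewrite !mxE; ring.
Qed.

Lemma Delta_mulzI i (a b : int) : Delta i *~ a = Delta i *~ b -> a = b.
Proof.
move=> e; apply: (intf_inj charC); have := two_neq0 => two; apply: (mulIf two).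
have ev c : (Delta i *~ c) (H i) = c%:~R * 2%:R.
  by rewrite -scaler_int lfunE /= DeltaH.
by rewrite -!ev e.
Qed.

(* The alpha-string argument: the lowering string from a highest multiple
   c alpha reaches a multiple of X_alpha, which is killed by ad X_alpha. *)
Lemma no_multiple i (c : nat) : (1 < c)%N -> Delta i *~ c \notin Phi.
Proof.
move=> c1; apply/negP => cP.
(* Since [Phi] is finite, the multiples beginning at [c] cannot all be roots; [c'] is the last one
   before the first failure. *)
have [c' [c'1 c'P c'S]] : exists c' : nat, [/\ (1 < c')%N, Delta i *~ c' \in Phi
    & Delta i *~ c'.+1 \notin Phi].
  apply: NNPP => hn.
  have all_c j : Delta i *~ (c + j)%N%:Z \in Phi.
    elim: j => [|j IH]; first by rewrite addn0.
    apply: contraT => hj; case: hn; exists (c + j)%N; split=> //; first lia.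
    by rewrite -addnS.
  have us : uniq [seq Delta i *~ (c + j)%N%:Z | j <- iota 0 (size Phi).+1].
    by rewrite map_inj_uniq ?iota_uniq // => a b /Delta_mulzI; lia.
  have := @uniq_leq_size _ _ Phi us; rewrite size_map size_iota ltnn => h'.
  by apply: notF; apply: h' => _ /mapP [j _ ->].
move: c'1 c'P c'S {c c1 cP}; case: c' => [|[|c]] // _ cP cS.
set a := Delta i in cP cS; pose Y := X (- a); pose v j := iter j (bracket Y) (X (a *~ c.+2)).
have aP : a \in Phi := DeltaP i; have naP := opp_root aP.
have a0 := root_neq0 hPhi aP.
have az (z : int) : z != 0 -> a *~ z != 0.
  by apply: contraNneq => e; apply/eqP/(@Delta_mulzI i); rewrite mulr0z.
have hv j : root_space g (a *~ (c.+2%:Z - j%:Z)) (v j).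
  elim: j => [|j IH]; first by rewrite subr0; apply: rootX.
  have -> : a *~ (c.+2%:Z - j.+1%:Z) = - a + a *~ (c.+2%:Z - j%:Z).
    by rewrite -{2}[a]mulr1z -mulrNz -mulrzDr; congr (_ *~ _); lia.
  apply: bracket_rs => //; first exact: rootX.
  by apply: brX => //; case: IH.
have hv0 : bracket (X a) (v 0%N) = 0.
  apply/eqP; apply: contraNT cS => nz.
  have : root_space g (a + a *~ c.+2) (bracket (X a) (v 0%N)).
    by apply: bracket_rs; [apply: rootX|apply: rootX|apply: brX => //; case: (hv 0%N)].
  have -> : a + a *~ c.+2 = a *~ c.+3 by rewrite -{1}[a]mulr1z -mulrzDr.
  by move/(root_space_line hPhi basisX rootX h_abel (az c.+3 isT)) => /(_ nz) [].
(* The usual formula for sl_2: the string starts at a vector of weight 2(c+2) for [H i], because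
   [Delta i] takes the value 2 there. The factor does not vanish for j up to c. *)
have hx j : bracket (X a) (v j.+1) = (j.+1%:R * (2%:R * c.+2%:R - j%:R)) *: v j.
  have step j' : bracket (X a) (v j'.+1) = (2%:R * (c.+2%:R - j'%:R)) *: v j' + bracket Y (bracket (X a) (v j')).
    rewrite /= jacobi bracket_simple (hv j').2; congr (_ *: _ + _).
    rewrite -scaler_int lfunE /= DeltaH mulrC; congr (_ * _).
    by rewrite rmorphB.
  elim: j => [|j IH]; rewrite step.
    by rewrite hv0 bracket0 addr0 !subr0 mul1r.
  rewrite IH bracketZr -/(v j.+1) -scalerDl; congr (_ *: _).
  by rewrite -[j.+2]addn1 -[j.+1]addn1 !natrD; set u := c.+2%:R; set u' := j%:R; ring.
have top : bracket (X a) (v c.+1) = 0.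
  have [->|nz] := eqVneq (v c.+1) 0; first exact: bracket0.
  have hvc := hv c.+1; have e1 : a *~ (c.+2%:Z - c.+1%:Z) = a.
    by rewrite -[RHS]mulr1z; congr (_ *~ _); lia.
  rewrite e1 in hvc.
  have [_ [d ->]] := root_space_line hPhi basisX rootX h_abel a0 hvc nz.
  by rewrite bracketZr /bracket subrr scaler0.
have down j : (j <= c)%N -> bracket (X a) (v j.+1) = 0 -> v j = 0.
  move=> jc; rewrite hx => /eqP; rewrite scaler_eq0 => /orP [|/eqP //].
  rewrite -natrM -natrB; last lia.
  by rewrite -natrM natf_eq0 // muln_eq0; lia.
have vanish j : (j <= c)%N -> v (c - j)%N = 0.
  elim: j => [|j IH] jc; first by rewrite subn0; apply: down.
  apply: down; first lia.
  by rewrite subnSK // IH ?bracket0 //; lia.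
have := rootX_neq0 hPhi basisX cP; rewrite -[X _]/(v 0%N) -(subnn c) vanish ?eqxx //.
Qed.

(** A simple reflection changes only the coefficient at [i]. If the root became negative, all its
    other coefficients would be zero and it would be a multiple of [Delta i], which [no_multiple]
    forbids. *)
Lemma pos_refl i a : a \in Phi -> pos a -> a != Delta i -> pos (s_ i a).
Proof.
move=> aP pa ai; have sP := s_root i aP; apply: contraT => /(root_sign sP) np.
have kE j : j != i -> k (s_ i a) j = k a j.
  move=> ji; apply: (intf_inj charC); apply/eqP; rewrite -subr_eq0; apply/eqP.
  have := Delta_indep (c := fun j => (k (s_ i a) j)%:~R - (k a j)%:~R + (j == i)%:R * (a (H i) : C)).
  move/(_ _ j); rewrite (negbTE ji) mul0r addr0; apply.
  under eq_bigr do rewrite scalerDl scalerBl; rewrite big_split sumrB /= -!DeltaZ -!root_coef //.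
  rewrite (bigD1 i) //= eqxx mul1r [X in _ + (_ + X)]big1 ?addr0 => [|j' /negbTE ->]; last first.
    by rewrite mul0r scale0r.
  by rewrite /simple_reflection addrAC subrK subrr.
have k0 j : j != i -> k a j = 0.
  by move=> ji; have := np j; rewrite kE //; have /forallP/(_ j) := pa; lia.
have eA : a = Delta i *~ k a i.
  by rewrite {1}(root_coef aP) (bigD1 i) //= big1 ?addr0 // => j /k0 ->; rewrite mulr0z.
have [j kj] := pos_neq aP pa.
have ji : j = i by apply/eqP; apply: contraTT kj => /k0 ->.
rewrite {}ji in kj; case: (k a i) eA kj => [[|[|c]]|//] eA _.
- by have := root_neq0 hPhi aP; rewrite eA mulr0z eqxx.
- by rewrite eA mulr1z eqxx in ai.
- by have := no_multiple i (c := c.+2) isT; rewrite -eA aP.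
Qed.

Definition winv (s : seq 'I_l) (a : dualv h) : dualv h := foldl (fun b i => s_ i b) a s.

Lemma winv_cons i s a : winv (i :: s) a = winv s (s_ i a). Proof. by []. Qed.

Lemma wordK s a : winv s (word s a) = a.
Proof. by elim: s a => [|i s IH] a //; rewrite winv_cons /= s_K IH. Qed.

Lemma winvK s a : word s (winv s a) = a.
Proof. by elim: s a => [|i s IH] a //; rewrite winv_cons /= IH s_K. Qed.

Lemma winv_ext s s' : word s =1 word s' -> winv s =1 winv s'.
Proof. by move=> e a; rewrite -{1}(winvK s' a) -e wordK. Qed.

Lemma word_root s a : a \in Phi -> word s a \in Phi.
Proof. by elim: s => //= i s IH aP; apply: s_root; apply: IH. Qed.

Lemma winv_root s a : a \in Phi -> winv s a \in Phi.
Proof. by elim: s a => //= i s IH a aP; apply: IH; apply: s_root. Qed.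

Lemma winv_D s a b : winv s (a + b) = winv s a + winv s b.
Proof. by elim: s a b => //= i s IH a b; rewrite s_D IH. Qed.

Lemma winv_Z s c a : winv s (c *: a) = c *: winv s a.
Proof. by elim: s a => //= i s IH a; rewrite s_Z IH. Qed.

Lemma winv_N s a : winv s (- a) = - winv s a.
Proof. by rewrite -scaleN1r winv_Z scaleN1r. Qed.

Lemma s_Delta i : s_ i (Delta i) = - Delta i.
Proof.
rewrite /simple_reflection DeltaH scaler_nat mulr2n opprD addrA subrr.
by rewrite sub0r.
Qed.

Definition refl (a : dualv h) (Ha : subvs_of h) (v : dualv h) : dualv h :=
  v - ((v Ha : C) *: a : dualv h).

Lemma refl_s i a Ha v : refl a Ha (s_ i v) = s_ i (refl (s_ i a) (sv i Ha) v).
Proof.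
by rewrite /refl s_D s_N s_Z s_K s_E.
Qed.

(** The exchange condition. By [pos_refl], the root stays positive along the word until it meets the
    simple root of a letter; there the reflection cancels this letter, and by [refl_s] the earlier
    letters carry the cancellation back to [a]. *)
Lemma exchange s a Ha : a \in Phi -> pos a -> coroot g a Ha -> ~~ pos (winv s a) ->
  exists2 s', size s = (size s').+1 & forall v, refl a Ha (word s v) = word s' v.
Proof.
elim: s a Ha => [|i s IH] a Ha aP pa cHa; first by rewrite /winv /= pa.
rewrite winv_cons => np.
have [ai|ai] := eqVneq a (Delta i).
  exists s => //= v.
  rewrite ai in cHa; have -> : Ha = H i.
    exact: (coroot_unique hPhi basisX rootX h_abel two_neq0 (DeltaP i) cHa (corootH i)).
  by rewrite ai -[RHS](s_K i).
have [s' sz e] := IH _ _ (s_root i aP) (pos_refl aP pa ai) (s_coroot i cHa) np.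
by exists (i :: s') => [|v]; rewrite /= ?sz // refl_s e.
Qed.

Section Longest.

Variables (w : dualv h -> dualv h).
Hypothesis hw : longest Delta H w.

(** If the image of a simple root were positive, putting its reflection in front would give an
    element of length [d.+1]: a word for it with at most [d] letters would, by [exchange], leave a
    word for [w] with fewer than [d] letters. *)
Lemma longest_simple : exists2 s, w =1 word s & forall i, ~~ pos (winv s (Delta i)).
Proof.
case: hw => d [[s0 sz0 e0] mind] maxd; exists s0 => // i; apply/negP => p.
suff : (d.+1 <= d)%N by rewrite ltnn.
apply: (maxd (word (i :: s0))); split=> [|s es].
  by exists (i :: s0); rewrite //= sz0.
rewrite leqNgt; apply/negP => lt.
have ew : winv s (Delta i) = - winv s0 (Delta i).
  by rewrite -(winv_ext es) winv_cons s_Delta winv_N.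
have [|s' sz e] := @exchange s (Delta i) (H i) (DeltaP i) (pos_Delta i) (corootH i).
- by rewrite ew posN ?winv_root // p.
have : (d <= size s')%N; last by lia.
apply: mind => v; rewrite e0 -e -es /=.
by rewrite -[LHS](s_K i).
Qed.

Lemma longest_neg : exists2 s, w =1 word s & forall a, a \in Phi -> pos (winv s a) = ~~ pos a.
Proof.
have [s ws hs] := longest_simple; exists s => //.
have np a : a \in Phi -> pos a -> ~~ pos (winv s a).
  move=> aP /forallP pa; have wP := winv_root s aP.
  have sum_winv (I : Type) (r : seq I) F : winv s (\sum_(i <- r) F i) = \sum_(i <- r) winv s (F i).
    apply: (big_morph (winv s)) => [x y|]; first exact: winv_D.
    by have := winv_Z s 0 0; rewrite !scale0r.
  have kw j : k (winv s a) j = \sum_i k a i * k (winv s (Delta i)) j.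
    apply: (coef_unique (c := fun j => \sum_i k a i * k (winv s (Delta i)) j)) => //.
    rewrite {1}(root_coef aP) sum_winv.
    under [RHS]eq_bigr do rewrite mulrz_sumr.
    rewrite exchange_big; apply: eq_bigr => i _.
    rewrite -scaler_int winv_Z {1}(root_coef (winv_root s (DeltaP i))) scaler_int mulrz_suml.
    by apply: eq_bigr => j' _; rewrite mulrC mulrzA.
  apply/negP => pw; have [j] := pos_neq wP pw; rewrite ltNge => /negP; apply.
  rewrite kw; apply: sumr_le0 => i _; apply: mulr_ge0_le0 => //.
  exact: root_sign (winv_root s (DeltaP i)) (hs i) j.
move=> a aP; case pa: (pos a); first by apply/negbTE/np.
by have := np _ (opp_root aP); rewrite posN // pa winv_N posN ?winv_root // negbK; apply.
Qed.

Lemma w_root a : a \in Phi -> w a \in Phi.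
Proof. by have [s ws _] := longest_neg; rewrite ws; apply: word_root. Qed.

Lemma w_pos a : a \in Phi -> pos (w a) = ~~ pos a.
Proof.
have [s ws hs] := longest_neg => aP.
by have := hs _ (w_root aP); rewrite {1}ws wordK => ->; rewrite negbK.
Qed.

Lemma w_surj b : b \in Phi -> exists2 a, a \in Phi & w a = b.
Proof.
have [s ws _] := longest_neg => bP; exists (winv s b); first exact: winv_root.
by rewrite ws winvK.
Qed.

End Longest.

End Weyl.

(** * Weights of classical groups *)

(* [oJ] is the bilinear form, or [None] for the special linear group; [b] tells
   whether the determinant is required to be 1. *)
Definition classical_eqn (K : fieldType) n (oJ : option 'M[K]_n) (b : bool) (A : 'M[K]_n) : Prop :=
  (if oJ is Some J then A^T *m J *m A = J else True) /\ (b -> \det A = 1).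

Definition classical_data (K : fieldType) l n (oJ : option 'M[K]_n) (b : bool) : Prop :=
  (0 < l)%N /\ if oJ is Some J then
    [/\ J \in unitmx, J^T = J \/ J^T = - J & n = (2 * l)%N \/ (n = (2 * l).+1 /\ b)]
  else n = l.+1 /\ b.

Definition weight_mx (K : fieldType) l n (e : 'I_n -> 'I_l -> int) (z : 'rV[K]_l) : 'M[K]_n :=
  diag_mx (\row_p \prod_j z 0 j ^ e p j).

Section Weights.

Variables (C : closedFieldType) (charC : [pchar C] =i pred0) (l n : nat).
Variables (e : 'I_n -> 'I_l -> int) (oJ : option 'M[C]_n) (b : bool).
Hypothesis data : classical_data l oJ b.
Hypothesis tor_eqn : forall z : 'rV[C]_l, Gm z -> classical_eqn oJ b (weight_mx e z).
Hypothesis tor_inj : forall z : 'rV[C]_l, Gm z -> weight_mx e z = 1%:M -> forall j, z 0 j = 1.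
Hypothesis e_indep : forall u : 'I_l -> C,
  (forall p, \sum_j u j * (e p j)%:~R = 0) -> forall j, u j = 0.

(** In characteristic zero 2 has infinite order, so evaluating an identity on the torus at 2 in one
    coordinate and 1 in the others gives an identity between exponents. *)
Lemma pow2_inj (m : int) : (2%:R : C) ^ m = 1 -> m = 0.
Proof.
have h k : (2%:R : C) ^+ k.+1 != 1.
  by rewrite -natrX -[1]/(1%:R) (inj_eq (natf_inj charC)) expnS; have := expn_gt0 2 k; lia.
case: m => [[|k]|k] //; first by rewrite -exprnP => /eqP; rewrite (negbTE (h k)).
rewrite NegzE -exprnN => /(congr1 GRing.inv); rewrite invrK invr1 => /eqP.
by rewrite (negbTE (h k)).
Qed.

Let z2 (j : 'I_l) : 'rV[C]_l := \row_k if k == j then 2%:R else 1.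

Lemma Gm_z2 j : Gm (z2 j).
Proof. by move=> k; rewrite mxE; case: ifP => _; rewrite ?oner_neq0 // natf_eq0. Qed.

Lemma prod_z2 j (a : 'I_l -> int) : \prod_k z2 j 0 k ^ a k = 2%:R ^ a j.
Proof.
rewrite (bigD1 j) //= mxE eqxx big1 ?mulr1 // => k /negbTE kj.
by rewrite mxE kj exp1rz.
Qed.

Lemma form_graded J p q : oJ = Some J -> J p q != 0 -> forall j, e p j + e q j = 0.
Proof.
move=> eJ Jpq j; have [+ _] := tor_eqn (Gm_z2 j); rewrite eJ tr_diag_mx.
move=> /(congr1 (fun A : 'M_n => A p q)); rewrite mul_diag_mx mul_mx_diag !mxE !prod_z2 => h.
apply: pow2_inj; rewrite expfzDr ?natf_eq0 //; apply: (mulIf Jpq).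
by rewrite mul1r -[RHS]h mulrAC.
Qed.

Lemma det_graded : b -> forall j, \sum_p e p j = 0.
Proof.
move=> hb j; have [_ /(_ hb)] := tor_eqn (Gm_z2 j).
rewrite det_diag; under eq_bigr do rewrite mxE prod_z2.
suff -> : \prod_p (2%:R : C) ^ e p j = 2%:R ^ (\sum_p e p j) by apply: pow2_inj.
symmetry; apply: (big_morph (fun m : int => (2%:R : C) ^ m)) => // x y.
by rewrite expfzDr ?natf_eq0.
Qed.

(** The weight matrix has rank [l] over [C]; [f] selects [l] indices whose rows are independent. *)
Lemma half_exists : exists f : 'I_l -> 'I_n, forall u : 'I_l -> C,
  (forall j, \sum_i u i * (e (f i) j)%:~R = 0) -> forall i, u i = 0.
Proof.
pose Ec : 'M[C]_(n, l) := \matrix_(p, j) (e p j)%:~R.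
have fullE : row_full Ec.
  rewrite /row_full -mxrank_tr -/(row_free _); apply: inj_row_free => v hv.
  apply/rowP => j; rewrite [RHS]mxE; apply: (e_indep (u := v 0)) => p.
  have := congr1 (fun A : 'rV_n => A 0 p) hv; rewrite !mxE => h; rewrite -[RHS]h.
  by apply: eq_bigr => k _; rewrite !mxE.
exists (fullrankfun fullE) => u hu i.
have uE := fullrowsub_unit fullE.
suff /rowP/(_ i) : (\row_i u i) = 0 :> 'rV[C]_l by rewrite !mxE.
rewrite -[LHS]mulmx1 -(mulmxV uE) mulmxA.
rewrite (_ : _ *m rowsub _ Ec = 0) ?mul0mx //; apply/rowP => j; rewrite !mxE -[RHS](hu j).
by apply: eq_bigr => i' _; rewrite !mxE.
Qed.

Lemma leftover (T : finType) (F : T -> 'I_n) : injective F -> n = #|T|.+1 ->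
  exists2 r0, (forall x, F x != r0) & forall p, p = r0 \/ exists x, p = F x.
Proof.
move=> Finj nT; have := cardC [pred p | p \in codom F].
have -> : #|[pred p | p \in codom F]| = #|T|.
  by rewrite -(card_codom Finj); apply: eq_card.
rewrite card_ord => hc.
have hc1 : #|[predC [pred p | p \in codom F]]| = 1%N.
  by apply: (@addnI #|T|); rewrite hc nT addn1.
have /card_gt0P [r0 hr0] : (0 < #|[predC [pred p | p \in codom F]]|)%N by rewrite hc1.
exists r0 => [x|p].
  by apply: contraTneq hr0 => <-; rewrite !inE codom_f.
case pF: (p \in codom F); first by right; have /codomP [x ->] := pF; exists x.
left; apply/eqP; apply: contraT => pr.
suff : (#|pred2 p r0| <= 1)%N by rewrite card2 pr.
rewrite -hc1; apply: subset_leq_card.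
by apply/subsetP => x; rewrite !inE => /orP [/eqP ->|/eqP -> //]; rewrite pF.
Qed.

Lemma no_leftover (T : finType) (F : T -> 'I_n) : injective F -> n = #|T| ->
  forall p, exists x, p = F x.
Proof.
move=> Finj nT p; have le : (#|'I_n| <= #|T|)%N by rewrite card_ord nT.
by have /codomP [x ->] := inj_card_onto Finj le p; exists x.
Qed.

Section Half.

Variable f : 'I_l -> 'I_n.
Hypothesis f_indep : forall u : 'I_l -> C,
  (forall j, \sum_i u i * (e (f i) j)%:~R = 0) -> forall i, u i = 0.

(** Two cases in one: for [c = -1], selected weights at different indices are distinct, and for
    [c = 1] no two of them, even at the same index, are opposite. *)
Lemma half_pair (c : int) i i' : (forall j, e (f i) j + c * e (f i') j = 0) ->
  1 + c * (i == i')%:R = 0.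
Proof.
move=> h; apply/eqP; rewrite -(intf_eq0 charC); apply/eqP.
have := f_indep (u := fun x => ((x == i)%:R + c * (x == i')%:R)%:~R) _ i.
rewrite eqxx; apply=> j; under eq_bigr do rewrite -intrM mulrDl.
rewrite -rmorph_sum big_split /= (bigD1 i) //= eqxx mul1r big1 ?addr0 => [|x /negbTE ->]; last first.
  by rewrite mul0r.
rewrite (bigD1 i') //= eqxx mulr1 big1 ?addr0 => [|x /negbTE ->]; last by rewrite mulr0 mul0r.
by rewrite h.
Qed.

Lemma half_inj i i' : (forall j, e (f i) j = e (f i') j) -> i = i'.
Proof.
move=> h; have := @half_pair (-1) i i'; case: eqVneq => // _ h'.
have : 1 + -1 * 0 = 0 :> int by apply: h' => j; rewrite h mulN1r subrr.
by [].
Qed.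

Lemma f_inj : injective f.
Proof. by move=> i i' h; apply: half_inj => j; rewrite h. Qed.

Lemma half_opp i i' : ~ (forall j, e (f i) j = - e (f i') j).
Proof.
move=> h; have : 1 + 1 * (i == i')%:R = 0 :> int.
  by apply: half_pair => j; rewrite mul1r h addNr.
by case: (i == i').
Qed.

Lemma half_nz i : ~ (forall j, e (f i) j = 0).
Proof. by move=> h; apply: (@half_opp i i) => j; rewrite h oppr0. Qed.

(* Every index carries a weight of the half system, or the opposite of one,
   except perhaps one index which is governed by the determinant. *)
Lemma half_cover_form J : oJ = Some J ->
  exists f' : 'I_l -> 'I_n, (forall i, J (f i) (f' i) != 0) /\
   ((forall p, exists i, p = f i \/ p = f' i)
    \/ b /\ exists r0, [/\ forall j, e r0 j = 0, forall i, f i != r0 /\ f' i != r0 &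
         forall p, p = r0 \/ exists i, p = f i \/ p = f' i]).
Proof.
move=> eJ; have [l0] := data; rewrite eJ => -[uJ sJ dim].
have rowJ p : exists q, J p q != 0.
  apply: NNPP => hn; have : row p J = 0.
    apply/rowP => q; rewrite !mxE; apply/eqP; apply: NNPP => h; apply: hn; exists q; exact/negP.
  rewrite rowE => /(congr1 (mulmxr (invmx J))) /=; rewrite mulmxK // mul0mx.
  by move/rowP/(_ p)/eqP; rewrite !mxE !eqxx oner_eq0.
have [f' hf'] := fin_all_exists (fun i => rowJ (f i)).
exists f'; split=> //.
have ef' i j : e (f' i) j = - e (f i) j.
  by apply/eqP; rewrite -addr_eq0 addrC (form_graded eJ (hf' i)).
pose F (x : 'I_l + 'I_l) := match x with inl i => f i | inr i => f' i end.
have Finj : injective F.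
  move=> [i|i] [i'|i'] /= h.
  - by rewrite (f_inj h).
  - by case: (@half_opp i i') => j; rewrite h ef'.
  - by case: (@half_opp i' i) => j; rewrite -h ef'.
  - by congr inr; apply: half_inj => j; apply: oppr_inj; rewrite -!ef' h.
have cardF : #|{: 'I_l + 'I_l}| = (2 * l)%N by rewrite card_sum card_ord mul2n addnn.
case: dim => [nl|[nl hb]]; [left => p|right; split=> //].
  by have [[i|i] ->] := no_leftover Finj (etrans nl (esym cardF)) p; exists i; [left|right].
have [r0 nr0 hr0] := leftover Finj (etrans nl (congr1 S (esym cardF))).
exists r0; split; last first.
- by move=> p; case: (hr0 p) => [->|[[i|i] ->]]; [left|right; exists i; left|right; exists i; right].
- by move=> i; split; [apply: (nr0 (inl i))|apply: (nr0 (inr i))].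
(* two rows of J supported on the same column are proportional *)
have twoRows p q c : p != q -> J p c != 0 ->
    (forall x, x != c -> J p x = 0 /\ J q x = 0) -> False.
  move=> pq Jpc hx.
  pose v : 'rV[C]_n := J p c *: delta_mx 0 q - J q c *: delta_mx 0 p.
  have : v *m J = 0.
    rewrite mulmxBl -!scalemxAl -!rowE; apply/rowP => x; rewrite !mxE.
    have [->|/hx [-> ->]] := eqVneq x c; last by rewrite !mulr0 subrr.
    by rewrite mulrC subrr.
  move/(congr1 (mulmxr (invmx J))); rewrite /= mulmxK // mul0mx => /rowP/(_ q)/eqP.
  have qp : (q == p) = false by rewrite eq_sym (negbTE pq).
  by rewrite !mxE !eqxx qp mulr0 subr0 mulr1 (negbTE Jpc).
(* [r0] is paired by [J] with some [r'] of opposite weight. If [r'] were in the image of [f] or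
   [f'], then two rows of [J], that of [r0] and that of the index paired with [r'], would be
   supported on the column [r'], and [J] would be singular. So [r'] is [r0], whose weight is its own
   opposite. *)
have [r' Jr'] := rowJ r0; have gr := form_graded eJ Jr'.
case: (hr0 r') => [e0|[[i|i] eF]] j.
- by have := gr j; rewrite e0; lia.
- exfalso; rewrite /= in eF; subst r'.
  apply: (@twoRows r0 (f' i) (f i)) => //; first by rewrite eq_sym; apply: (nr0 (inr i)).
  have supp x p : (forall j, e p j = - e (f i) j) -> x != f i -> J p x = 0.
    move=> ep xf; apply/eqP; apply: contraT => nz; have g := form_graded eJ nz.
    have ex k : e x k = e (f i) k by have := g k; rewrite ep; lia.
    case: (hr0 x) => [xr|[[i'|i'] xF]].
    + by case: (@half_nz i) => k; have := gr k; have := ex k; rewrite xr; lia.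
    + by rewrite xF /= -(@half_inj i' i) ?eqxx // in xf => k; rewrite -ex xF.
    + by case: (@half_opp i i') => k; rewrite -ex xF /= ef'.
  move=> x xf; split; apply: supp => // k; first by have := gr k; lia.
- exfalso; rewrite /= in eF; subst r'.
  apply: (@twoRows r0 (f i) (f' i)) => //; first by rewrite eq_sym; apply: (nr0 (inl i)).
  have supp x p : (forall j, e p j = e (f i) j) -> x != f' i -> J p x = 0.
    move=> ep xf; apply/eqP; apply: contraT => nz; have g := form_graded eJ nz.
    have ex k : e x k = - e (f i) k by have := g k; rewrite ep; lia.
    case: (hr0 x) => [xr|[[i'|i'] xF]].
    + by case: (@half_nz i) => k; have := gr k; have := ex k; rewrite xr ef'; lia.
    + by case: (@half_opp i' i) => k; rewrite -ex xF.
    + have ii : i' = i by apply: half_inj => k; have := ex k; rewrite xF /= ef'; lia.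
      by rewrite xF ii eqxx in xf.
  move=> x xf; split; apply: supp => // k; by have := gr k; rewrite ef'; lia.
Qed.

Lemma half_cover_sl : oJ = None -> b /\ exists2 r0, (forall i, f i != r0) &
  forall p, p = r0 \/ exists i, p = f i.
Proof.
move=> eJ; have [l0] := data; rewrite eJ => -[nl hb]; split=> //.
by apply: leftover; [apply: f_inj|rewrite card_ord].
Qed.

(** This makes a functional possible which is injective on the indices, hence a total order for the
    LDU decomposition. *)
Lemma weights_distinct p q : (forall j, e p j = e q j) -> p = q.
Proof.
case eJ: oJ => [J|].
  have [f' [hf' cover]] := half_cover_form eJ.
  have ef' i j : e (f' i) j = - e (f i) j.
    by apply/eqP; rewrite -addr_eq0 addrC (form_graded eJ (hf' i)).
  have main p' q' i i' : p' = f i \/ p' = f' i -> q' = f i' \/ q' = f' i' ->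
      (forall j, e p' j = e q' j) -> p' = q'.
    move=> [->|->] [->|->] h.
    - by rewrite (half_inj h).
    - by case: (@half_opp i i') => j; rewrite h ef'.
    - by case: (@half_opp i' i) => j; rewrite -h ef'.
    - have -> // : i = i' by apply: half_inj => j; apply: oppr_inj; rewrite -!ef'.
  case: cover => [cover|[hb [r0 [er0 _ cover]]]] h.
    by have [i hi] := cover p; have [i' hi'] := cover q; apply: main hi hi' h.
  have nz p' i : p' = f i \/ p' = f' i -> ~ (forall j, e p' j = 0).
    by move=> [->|->] h0; apply: (@half_nz i) => j; have := h0 j; rewrite ?ef'; lia.
  case: (cover p) (cover q) => [pr|[i hi]] [qr|[i' hi']].
  - by rewrite pr qr.
  - by case: (nz _ _ hi') => j; rewrite -h pr.
  - by case: (nz _ _ hi) => j; rewrite h qr.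
  - exact: main hi hi' h.
have [hb [r0 nr0 cover]] := half_cover_sl eJ => h.
have er0 j : e r0 j = - \sum_i e (f i) j.
  have := det_graded hb j; rewrite (bigD1 r0) //= => /eqP; rewrite addr_eq0 => /eqP ->.
  (* The default of the inverse of [f] exists because [0 < l]; it would be taken only at [r0], which
     is left out of the sum. *)
  congr (- _); rewrite (reindex_onto f (fun p => odflt (Ordinal data.1) [pick i | f i == p])) /=; last first.
    by move=> p' /negP; case: (cover p') => [->|[i ->] _]; rewrite ?eqxx //; case: pickP => [i' /eqP ->|/(_ i)]; rewrite ?eqxx.
  apply: eq_bigl => i; rewrite nr0 /=; case: pickP => [i' /eqP /f_inj ->|/(_ i)]; by rewrite ?eqxx.
(* Since the weight at [r0] is minus the sum of the others, equality would be a relation between the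
   selected weights with coefficient 2 at [i] and 1 elsewhere. *)
have bad i : ~ (forall j, e r0 j = e (f i) j).
  move=> h0; have := f_indep (u := fun x => (1 + (x == i)%:R)%:~R) _ i.
  rewrite eqxx => /(_ _)/eqP; rewrite intf_eq0 // => h1; suff : (1 + 1 == 0 :> int) by [].
  apply: h1 => j; under eq_bigr do rewrite -intrM mulrDl mul1r.
  rewrite -rmorph_sum big_split /= [X in _ + X](bigD1 i) //= eqxx mul1r [X in _ + (_ + X)]big1 => [|x /negbTE ->]; last by rewrite mul0r.
  by have := er0 j; rewrite h0 => ->; rewrite addr0 subrr.
case: (cover p) (cover q) => [pr|[i hi]] [qr|[i' hi']].
- by rewrite pr qr.
- by case: (bad i') => j; rewrite -pr -hi'.
- by case: (bad i) => j; rewrite -qr -hi h.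
- by rewrite hi hi'; congr f; apply: half_inj => j; rewrite -hi -hi'.
Qed.

Section OverExtension.

Variables (K : fieldType) (i : {rmorphism C -> K}).

Lemma prod_expz (I : Type) (r : seq I) (x : K) (F : I -> int) : x != 0 ->
  \prod_(k <- r) x ^ F k = x ^ (\sum_(k <- r) F k).
Proof.
move=> x0; symmetry; apply: (big_morph (fun m : int => x ^ m)) => // u v.
by rewrite expfzDr.
Qed.

Lemma prod_exchange (T1 T2 : finType) (x : T1 -> K) (M : T2 -> T1 -> int) (a : T2 -> int) :
  (forall k, x k != 0) ->
  \prod_j (\prod_k x k ^ M j k) ^ a j = \prod_k x k ^ (\sum_j a j * M j k).
Proof.
move=> x0; under eq_bigr => j _.
  have -> : (\prod_k x k ^ M j k) ^ a j = \prod_k x k ^ (a j * M j k).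
    rewrite (big_morph (fun y : K => y ^ a j) (id1 := 1) (op1 := *%R)).
    - by apply: eq_bigr => k _; rewrite exprz_exp mulrC.
    - by move=> u v; apply: expfzMl.
    - by rewrite exp1rz.
  over.
by rewrite exchange_big; apply: eq_bigr => k _; apply: prod_expz.
Qed.

(** The equations only express relations between exponents. These were read off over [C] and give
    the equations over every extension. *)
Lemma weight_eqn (z : 'rV[K]_l) : Gm z ->
  classical_eqn (omap (map_mx i) oJ) b (weight_mx e z).
Proof.
move=> gz; split=> [|hb].
  case eJ: oJ => [J|] //=; rewrite tr_diag_mx; apply/matrixP => p q.
  rewrite mul_diag_mx mul_mx_diag !mxE; have [->|nz] := eqVneq (J p q) 0.
    by rewrite rmorph0 mulr0 mul0r.
  rewrite mulrAC -big_split big1 ?mul1r //= => j _.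
  by rewrite -expfzDr // (form_graded eJ nz).
rewrite det_diag; under eq_bigr do rewrite mxE.
rewrite exchange_big big1 // => j _; rewrite prod_expz //.
by rewrite det_graded.
Qed.

Lemma diag_det (D : 'M[K]_n) : is_diag_mx D -> \det D = \prod_p D p p.
Proof.
move=> /is_diag_mxP dD; rewrite det_trig //; apply/is_trig_mxP => u v uv.
by apply: dD; rewrite neq_ltn uv.
Qed.

Lemma diag_form J (D : 'M[K]_n) p q : is_diag_mx D ->
  D^T *m J *m D = J -> D p p * J p q * D q q = J p q.
Proof.
move=> /is_diag_mxP dD h; rewrite -[RHS](congr1 (fun A : 'M_n => A p q) h).
rewrite mxE (bigD1 q) //= big1 ?addr0 => [|r rq]; last by rewrite (dD r q) ?mulr0.
rewrite mxE (bigD1 p) //= big1 ?addr0 => [|r rp]; last by rewrite mxE (dD r p) ?mul0r.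
by rewrite mxE.
Qed.

(** The form relates the entries at [f k] and [f' k], and the determinant fixes the entry at the
    index that may be left over. *)
Lemma half_det (D D' : 'M[K]_n) : is_diag_mx D -> is_diag_mx D' ->
  classical_eqn (omap (map_mx i) oJ) b D -> classical_eqn (omap (map_mx i) oJ) b D' ->
  (forall k, D (f k) (f k) = D' (f k) (f k)) -> D = D'.
Proof.
move=> dD dD' [fD tD] [fD' tD'] hf.
suff h p : D p p = D' p p.
  apply/matrixP => p q; have [->|pq] := eqVneq p q; first exact: h.
  by rewrite (is_diag_mxP dD p q pq) (is_diag_mxP dD' p q pq).
have by_det r0 : b -> (forall p, p != r0 -> D p p = D' p p) -> forall p, D p p = D' p p.
  move=> hb hr q; have [->|/hr //] := eqVneq q r0.
  have := tD hb; have := tD' hb; rewrite !diag_det // (bigD1 r0) // [X in _ -> X = _ -> _](bigD1 r0) //=.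
  have -> : \prod_(p | p != r0) D p p = \prod_(p | p != r0) D' p p by apply: eq_bigr.
  set P := \prod_(_ | _) _ => e1 e2; have P0 : P != 0.
    by apply: contraTneq (oner_neq0 K) => P0; rewrite -e1 P0 mulr0 eqxx.
  by apply: (mulIf P0); rewrite e1 e2.
case eJ: oJ => [J|] in fD fD' *; last first.
  have [hb [r0 nr0 cover]] := half_cover_sl eJ; move: p; apply: (by_det r0 hb) => p pr.
  case: (cover p) => [e0|[k ->]]; last exact: hf.
  by rewrite e0 eqxx in pr.
have [f' [hf' cover]] := half_cover_form eJ; rewrite /= in fD fD'.
have hh k : D (f' k) (f' k) = D' (f' k) (f' k).
  have nz : map_mx i J (f k) (f' k) != 0 by rewrite mxE fmorph_eq0.
  have e1 := diag_form (f k) (f' k) dD fD; have e2 := diag_form (f k) (f' k) dD' fD'.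
  have nz2 : D' (f k) (f k) * map_mx i J (f k) (f' k) != 0.
    by apply: contraTneq nz => h0; rewrite -e2 h0 mul0r eqxx.
  by apply: (mulfI nz2); rewrite e2 -hf e1.
case: cover => [cover|[hb [r0 [_ _ cover]]]].
  by case: (cover p) => k [->|->].
move: p; apply: (by_det r0 hb) => p pr.
case: (cover p) => [e0|[k [->|->]]]; [|exact: hf|exact: hh].
by rewrite e0 eqxx in pr.
Qed.

End OverExtension.

(* If a prime p divided the determinant, a kernel vector mod p would give an
   element of order p of the torus on which all the weights are trivial. *)
Lemma half_unimodular :
  ((\matrix_(k, j) e (f k) j : 'M[int]_l) \in unitmx).
Proof.
set E := \matrix_(k, j) _; rewrite unitmxE.
suff : `|\det E|%N = 1%N by case: (\det E) => [[|[]]|[]].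
apply/eqP; apply: contraT => ne1.
have [p p_pr p_dvd] : exists2 p, prime p & (p%:Z %| \det E)%Z.
  have [d0|d0] := eqVneq (\det E) 0; first by exists 2%N; rewrite // d0 dvdz0.
  exists (pdiv `|\det E|%N); last by rewrite dvdzE /= pdiv_dvd.
  by apply: pdiv_prime; move: d0 ne1; lia.
have pF : p \in [pchar 'F_p] := pchar_Fp p_pr.
pose Ep : 'M['F_p]_l := (map_mx intr E)^T.
have /eqP/det0P [v v0 vE] : \det Ep = 0.
  by rewrite det_tr det_map_mx; apply/eqP; rewrite -(dvdz_pcharf pF).
(* A root of 1 + x + ... + x^(p-1); it is not 1, as [p] is nonzero in [C]. *)
have [zeta zp z1] : exists2 zeta : C, zeta ^+ p = 1 & zeta != 1.
  have /closed_rootP [zeta /rootP rz] : size (\poly_(k < p) (1 : C)) != 1%N.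
    rewrite size_poly_eq ?oner_neq0 //; by have := prime_gt1 p_pr; lia.
  exists zeta.
    apply/eqP; rewrite -subr_eq0 subrX1; move: rz; rewrite horner_poly.
    by under eq_bigr do rewrite mul1r; move=> ->; rewrite mulr0.
  apply: contraPneq rz => ->; rewrite horner_poly.
  under eq_bigr do rewrite expr1n mulr1; rewrite sumr_const card_ord.
  by apply/eqP; rewrite natf_eq0 // -lt0n prime_gt0.
have zeta0 : zeta != 0.
  apply/eqP => z0; move: zp; rewrite z0 expr0n gtn_eqF ?prime_gt0 // => /esym/eqP.
  by rewrite oner_eq0.
have zeta_dvd (m : int) : (p%:Z %| m)%Z -> zeta ^ m = 1.
  by move=> /dvdzP [c ->]; rewrite mulrC -exprz_exp -exprnP zp exp1rz.
pose z : 'rV[C]_l := \row_j zeta ^ (val (v 0 j))%:Z.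
have gz : Gm z by move=> j; rewrite mxE expfz_neq0.
(* The kernel vector controls only the selected weights; [half_det] takes care of the other
   entries. *)
have w1 : weight_mx e z = 1%:M.
  pose id' : {rmorphism C -> C} := idfun.
  have d1 : is_diag_mx (1%:M : 'M[C]_n) := scalar_mx_is_diag _ _.
  apply: (half_det (i := id') (diag_mx_is_diag _) d1).
  - exact: weight_eqn.
  - have := weight_eqn id' (z := const_mx 1); rewrite (_ : weight_mx e _ = 1%:M); last first.
      apply/matrixP => r s; rewrite !mxE big1 // => j _; by rewrite mxE exp1rz.
    by apply=> j; rewrite mxE oner_neq0.
  move=> k; rewrite !mxE !eqxx mulr1n.
  under eq_bigr do rewrite mxE exprz_exp; rewrite prod_expz //; apply: zeta_dvd.
  rewrite (dvdz_pcharf pF) rmorph_sum /=.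
  have := congr1 (fun A : 'rV_l => A 0 k) vE; rewrite !mxE => h; apply/eqP; rewrite -[RHS]h.
  apply: eq_bigr => j _; rewrite !mxE intrM; congr (_ * _).
  by rewrite -pmulrn natr_Zp.
have [j vj] : exists j, v 0 j != 0.
  apply: NNPP => hn; case/eqP: v0; apply/rowP => j; rewrite mxE; apply/eqP.
  by apply: NNPP => hj; apply: hn; exists j; apply/negP.
have := tor_inj gz w1 j; rewrite mxE -exprnP.
move: (v 0 j) vj => x x0 zv.
have cop : coprime p (nat_of_ord x).
  rewrite prime_coprime //; apply: contra x0 => dv; apply/eqP/val_inj => /=.
  have lt : (nat_of_ord x < p)%N.
    by have := ltn_ord x; move: (nat_of_ord x) => y; rewrite Fp_cast.
  by apply/eqP; apply: contraTT dv => nz; rewrite gtnNdvd // lt0n.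
have [[a c] eac] : exists ac, (ac.1 * p = ac.2 * nat_of_ord x + 1)%N.
  have p0 := prime_gt0 p_pr; case: (egcdnP (nat_of_ord x) p0) => a c eac _.
  by exists (a, c); rewrite /= eac (eqP cop).
have : zeta ^+ (a * p) = zeta by rewrite eac exprD mulnC exprM zv expr1n mul1r.
by rewrite mulnC exprM zp expr1n => /esym/eqP; rewrite (negbTE z1).
Qed.

Lemma half_inverse : exists B : 'I_l -> 'I_l -> int,
  (forall k k', \sum_j e (f k) j * B j k' = (k == k')%:R)
  /\ forall j j', \sum_k B j k * e (f k) j' = (j == j')%:R.
Proof.
have u := half_unimodular; set E := \matrix_(_, _) _ in u.
exists (fun j k => invmx E j k); split=> x y.
  by have := congr1 (fun A : 'M_l => A x y) (mulmxV u); rewrite !mxE => <-; apply: eq_bigr => j _; rewrite mxE.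
by have := congr1 (fun A : 'M_l => A x y) (mulVmx u); rewrite !mxE => <-; apply: eq_bigr => j _; rewrite mxE.
Qed.

Lemma prod_delta (K : fieldType) (x : 'I_l -> K) k : \prod_j x j ^ ((k == j)%:R : int) = x k.
Proof.
rewrite (bigD1 k) //= eqxx big1 ?mulr1 // => j; rewrite eq_sym => /negbTE ->.
by rewrite expr0z.
Qed.

(** The inverse of the unimodular matrix of the selected weights expresses [z] by Laurent monomials
    in the selected entries of [D], so [K] need not be closed. The other entries agree by
    [half_det]. *)
Lemma weight_surj (K : fieldType) (i : {rmorphism C -> K}) (D : 'M[K]_n) :
  is_diag_mx D -> D \in unitmx -> classical_eqn (omap (map_mx i) oJ) b D ->
  exists2 z : 'rV[K]_l, Gm z & D = weight_mx e z.
Proof.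
move=> dD uD eD; have [B [hB _]] := half_inverse.
have D0 p : D p p != 0.
  move: uD; rewrite unitmxE unitfE (diag_det dD) => nz; apply: contraNneq nz => Dp.
  by rewrite (bigD1 p) //= Dp mul0r.
pose z : 'rV[K]_l := \row_j \prod_k D (f k) (f k) ^ B j k.
have gz : Gm z by move=> j; rewrite mxE; apply/prodf_neq0 => k _; rewrite expfz_neq0.
exists z => //; apply: (half_det (i := i)) => //; first exact: diag_mx_is_diag.
  exact: weight_eqn.
move=> k; rewrite !mxE eqxx mulr1n; under [RHS]eq_bigr do rewrite mxE.
rewrite prod_exchange //; under [RHS]eq_bigr do rewrite hB.
by rewrite prod_delta.
Qed.

Lemma weight_inj (K : fieldType) (z z' : 'rV[K]_l) : Gm z -> Gm z' ->
  weight_mx e z = weight_mx e z' -> z = z'.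
Proof.
move=> gz gz' h; have [B [_ hB]] := half_inverse; apply/rowP => j.
have key (y : 'rV[K]_l) : Gm y -> \prod_k (weight_mx e y (f k) (f k)) ^ B j k = y 0 j.
  move=> gy; under eq_bigr do rewrite !mxE eqxx mulr1n.
  by rewrite prod_exchange //; under eq_bigr do rewrite hB; rewrite prod_delta.
by rewrite -key // h key.
Qed.

End Half.

End Weights.

(** * Determinants of unipotent matrices and equations of the classical groups *)

Lemma sort_perm n (gr : 'I_n -> int) : injective gr ->
  exists s : 'S_n, forall p q : 'I_n, (p < q)%N -> gr (s p) < gr (s q).
Proof.
move=> gri; pose s0 := sort (fun p q => gr p <= gr q) (enum 'I_n).
have sz : size s0 == n by rewrite size_sort size_enum_ord.
have us : uniq s0 by rewrite sort_uniq enum_uniq.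
have inj : injective (tnth (Tuple sz)).
  move=> p q; rewrite !(tnth_nth p) /= => /eqP; rewrite nth_uniq ?(eqP sz) //.
  by move/eqP/val_inj.
exists (perm.perm inj) => p q pq; rewrite !perm.permE !(tnth_nth p) /=.
have srt : sorted (fun p q => gr p <= gr q) s0 by apply: sort_sorted => u v; apply: le_total.
have tr : transitive (fun p q => gr p <= gr q) by move=> u v x; apply: le_trans.
have := sorted_ltn_nth tr p srt; move=> /(_ p q); rewrite !inE (eqP sz) => /(_ (ltn_ord _) (ltn_ord _) pq).
rewrite le_eqVlt => /orP [/eqP /gri/eqP|//].
by rewrite nth_uniq ?(eqP sz) // => /eqP e; rewrite e ltnn in pq.
Qed.

Lemma det_unip (K : fieldType) n (gr : 'I_n -> int) (A : 'M[K]_n) : unip gr A -> \det A = 1.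
Proof.
(* Ties of [gr] are broken by the index. The factor [n] exceeds every difference of two indices, so
   [gr'] is injective and refines the order of [gr]; sorted by it, the matrix is triangular. *)
move=> uA; pose gr' (p : 'I_n) : int := gr p * n%:Z + p%:Z.
have gr'_lt (p q : 'I_n) : gr p < gr q -> gr' p < gr' q.
  move=> lt; have : (gr p + 1) * n%:Z <= gr q * n%:Z by apply: ler_wpM2r; lia.
  by rewrite /gr' mulrDl mul1r; have := ltn_ord p; lia.
have grI : injective gr'.
  move=> p q e; have [/gr'_lt|/gr'_lt|e'] := ltgtP (gr p) (gr q); [lia|lia|].
  by apply: val_inj; move: e; rewrite /gr' e' => /addrI [].
have [s hs] := sort_perm grI.
have dA p : A p p = 1.
  apply/eqP; rewrite -subr_eq0; apply: contraT => nz; have := uA p p.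
  by rewrite !mxE eqxx => /(_ nz); lia.
have oA p q : p != q -> A p q != 0 -> gr' p < gr' q.
  move=> pq nz; have := uA p q; rewrite !mxE (negbTE pq) subr0 => /(_ nz).
  by move=> h; apply: gr'_lt; lia.
have eD : \det A = \det (row_perm s (col_perm s A)).
  by rewrite row_permE col_permE !det_mulmx !det_perm perm.odd_permV mulrCA -signr_addb addbb mulr1.
rewrite eD -det_tr det_trig; first by rewrite big1 // => p _; rewrite !mxE dA.
apply/is_trig_mxP => p q pq; rewrite !mxE; apply/eqP; apply: contraT => /oA.
rewrite (inj_eq perm.perm_inj) -val_eqE /= gtn_eqF // => /(_ isT).
by have := hs p q pq; lia.
Qed.

Lemma expmxZ (K : fieldType) n c (A : 'M[K]_n) k : (c *: A) ^+ k = c ^+ k *: A ^+ k.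
Proof.
elim: k => [|k IH]; first by rewrite !expr0 scale1r.
by rewrite !exprS IH -!mulmxE -scalemxAl -scalemxAr scalerA.
Qed.

Section ClassicalEqn.

Variables (K : fieldType) (n : nat).
Implicit Types (A B J S : 'M[K]_n) (oJ : option 'M[K]_n).

Lemma classical_eqn1 oJ b : classical_eqn oJ b 1%:M.
Proof.
split=> [|_]; last by rewrite det1.
by case: oJ => // J; rewrite trmx1 mul1mx mulmx1.
Qed.

Lemma classical_eqn_mul oJ b A B : classical_eqn oJ b A -> classical_eqn oJ b B ->
  classical_eqn oJ b (A *m B).
Proof.
move=> [fA dA] [fB dB]; split=> [|hb]; last by rewrite det_mulmx dA // dB // mulr1.
case: oJ fA fB => // J fA fB.
by rewrite trmx_mul !mulmxA -(mulmxA B^T) -(mulmxA B^T) fA fB.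
Qed.

Lemma classical_eqn_inv oJ b A : A \in unitmx -> classical_eqn oJ b A ->
  classical_eqn oJ b (invmx A).
Proof.
move=> uA [fA dA]; split=> [|hb]; last by rewrite det_inv dA // invr1.
case: oJ fA => // J fA; rewrite -{1}fA !mulmxA -trmx_mul mulmxV // trmx1 mul1mx.
by rewrite mulmxK.
Qed.

Lemma classical_eqn_conj oJ b S A : S \in unitmx ->
  classical_eqn (omap (fun J => S^T *m J *m S) oJ) b (invmx S *m A *m S) <->
  classical_eqn oJ b A.
Proof.
move=> uS.
have eD : \det (invmx S *m A *m S) = \det A.
  by rewrite !det_mulmx mulrAC -det_mulmx mulVmx // det1 mul1r.
have key J : (invmx S *m A *m S)^T *m (S^T *m J *m S) *m (invmx S *m A *m S)
    = S^T *m (A^T *m J *m A) *m S.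
  rewrite !trmx_mul !mulmxA mulmxK // -[_ *m (invmx S)^T *m S^T]mulmxA -(trmx_mul S) mulmxV //.
  by rewrite trmx1 mulmx1.
rewrite /classical_eqn eD; split=> -[f d]; split=> //; case: oJ f => //= J; rewrite key.
  move=> /(congr1 (fun M => (invmx S)^T *m M *m invmx S)).
  by rewrite !mulmxA -!(trmx_mul S) mulmxV // trmx1 !mul1mx !mulmxK.
by move=> ->.
Qed.

(** The determinant has no counterpart here: where the root vectors are produced, the matrices have
    nonzero degree, so their trace is zero. *)
Definition form_lie oJ A : Prop := if oJ is Some J then A^T *m J + J *m A = 0 else True.

Lemma expmx_classical (charK : [pchar K] =i pred0) oJ b A : A ^+ n = 0 -> \det (expmx A) = 1 ->
  form_lie oJ A -> classical_eqn oJ b (expmx A).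
Proof.
move=> nA dA fA; split=> //; case: oJ fA => // J /= fA.
have fA' : A^T *m J = J *m (- A) by apply/eqP; rewrite mulmxN -addr_eq0 fA.
have fk k : (A ^+ k)^T *m J = J *m (- A) ^+ k.
  elim: k => [|k IH]; first by rewrite !expr0 trmx1 mul1mx mulmx1.
  by rewrite exprS -mulmxE trmx_mul -mulmxA fA' mulmxA IH exprSr -mulmxE !mulmxA.
have -> : (expmx A)^T *m J = J *m expmx (- A).
  rewrite /expmx raddf_sum /= mulmx_suml mulmx_sumr; apply: eq_bigr => j _.
  by rewrite linearZ /= -scalemxAl -scalemxAr fk.
by rewrite -mulmxA (mulmx1C (expmxN charK nA)) mulmx1.
Qed.

End ClassicalEqn.

Lemma map_mxid (C : fieldType) m n (A : 'M[C]_(m, n)) : map_mx idfun A = A.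
Proof. by apply/matrixP => p q; rewrite mxE. Qed.

Lemma points_classical (C K : fieldType) (i : {rmorphism C -> K}) n (G : 'M[C]_n -> Prop)
    oJ b : (forall x, G x -> classical_eqn oJ b x) ->
  forall A, points i G A -> classical_eqn (omap (map_mx i) oJ) b A.
Proof.
move=> hG A PA; pose pid := @polymx_id _ _ i n; split=> [|hb].
  case: oJ hG => //= J hG; apply/matrixP => r s.
  have pf := polyfunB (polymx_mul (polymx_mul (polymx_tr pid) (polymx_const J)) pid r s)
    (polymx_const J r s).
  apply/eqP; rewrite -subr_eq0; apply/eqP; apply: (points_polyfun pf) PA => x /hG [h _].
  by rewrite map_mxid h subrr.
have pf := polyfunB (polyfun_det pid) polyfun1.
apply/eqP; rewrite -subr_eq0; apply/eqP; apply: (points_polyfun pf) PA => x /hG [_ h].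
by rewrite h // subrr.
Qed.

(** * Velocities of matrix curves and Lie algebras of classical groups *)

Section LieClassical.

Variables (C : fieldType) (charC : [pchar C] =i pred0) (n : nat).

Lemma diff_at1_uniq f (c d : C) : diff_at1 f c -> diff_at1 f d -> c = d.
Proof.
move=> hc hd; apply/eqP; rewrite -subr_eq0 -[- d]add0r; apply/eqP.
have e : diff_at1 (fun z => f z + (-1) * f z) (c + (0 * f 1 + (-1) * d)).
  by apply: (diff_at1D hc); apply: diff_at1M hd; apply: diff_at1_const.
rewrite mul0r add0r mulN1r in e; rewrite add0r.
by apply: (diff_at1_zero charC e) => z _; rewrite mulN1r subrr.
Qed.

Lemma diff_at1_subr1 : diff_at1 (fun z : C => z - 1) 1.
Proof.
have e := diff_at1_poly ('X - 1%:P : {poly C}); rewrite derivXsubC hornerC in e.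
by apply: (diff_at1_ext e) => z _; rewrite hornerXsubC.
Qed.

Definition diff_mx a b (M : C -> 'M[C]_(a, b)) (D : 'M[C]_(a, b)) : Prop :=
  forall r s, diff_at1 (fun z => M z r s) (D r s).

Lemma diff_mx_const a b (A : 'M[C]_(a, b)) : diff_mx (fun=> A) 0.
Proof. by move=> r s; rewrite mxE; apply: diff_at1_const. Qed.

Lemma diff_mxD a b (M N : C -> 'M[C]_(a, b)) D D' : diff_mx M D -> diff_mx N D' ->
  diff_mx (fun z => M z + N z) (D + D').
Proof.
move=> h h' r s; rewrite mxE; apply: (diff_at1_ext (diff_at1D (h r s) (h' r s))) => z _.
by rewrite mxE.
Qed.

Lemma diff_mxM a b c (M : C -> 'M[C]_(a, b)) (N : C -> 'M[C]_(b, c)) D D' :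
  diff_mx M D -> diff_mx N D' -> diff_mx (fun z => M z *m N z) (D *m N 1 + M 1 *m D').
Proof.
move=> h h' r s.
have e := diff_at1_sum (index_enum 'I_b) (P := xpredT) (fun j _ => diff_at1M (h r j) (h' j s)).
have -> : (D *m N 1 + M 1 *m D') r s = \sum_j (D r j * N 1 j s + M 1 r j * D' j s).
  by rewrite mxE [X in X + _]mxE [X in _ + X]mxE -big_split.
by apply: (diff_at1_ext e) => z _; rewrite mxE.
Qed.

Lemma diff_mxZ a b f d (A : 'M[C]_(a, b)) : diff_at1 f d -> diff_mx (fun z => f z *: A) (d *: A).
Proof.
move=> h r s; have e := diff_at1M h (diff_at1_const (A r s)).
rewrite mulr0 addr0 in e; rewrite mxE; apply: (diff_at1_ext e) => z _; by rewrite mxE.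
Qed.

Lemma diff_mx_tr a b (M : C -> 'M[C]_(a, b)) D : diff_mx M D -> diff_mx (fun z => (M z)^T) D^T.
Proof.
move=> h r s; rewrite mxE; apply: (diff_at1_ext (h s r)) => z _; by rewrite mxE.
Qed.

Lemma diff_mx_sum a b (I : Type) (r : seq I) (M : I -> C -> 'M[C]_(a, b)) D :
  (forall j, diff_mx (M j) (D j)) ->
  diff_mx (fun z => \sum_(j <- r) M j z) (\sum_(j <- r) D j).
Proof.
move=> h; elim: r => [|j r IH].
  rewrite big_nil => p q; apply: (diff_at1_ext (diff_mx_const 0 p q)) => z _; by rewrite big_nil.
rewrite big_cons => p q; apply: (diff_at1_ext (diff_mxD (h j) IH p q)) => z _; by rewrite big_cons.
Qed.

Lemma diff_at1X (f : C -> C) d k : diff_at1 f d -> diff_at1 (fun z => f z ^+ k) (k%:R * f 1 ^+ k.-1 * d).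
Proof.
move=> h; elim: k => [|k IH].
  by rewrite !mul0r; apply: (diff_at1_ext (diff_at1_const 1)) => z _; rewrite expr0.
have e := diff_at1M h IH; rewrite (_ : _ + _ = k.+1%:R * f 1 ^+ k.+1.-1 * d) in e.
  by apply: (diff_at1_ext e) => z _; rewrite exprS.
case: k {IH} => [|k] /=; first by rewrite !(mul0r, mulr0, expr0, mulr1, mul1r, addr0).
by rewrite exprS -[k.+2%:R]natr1; set u := f 1 ^+ k; set v := k.+1%:R; ring.
Qed.

(** The parameter is [z - 1] because velocities are taken at [z = 1]. *)
Lemma diff_mx_exp (A : 'M[C]_n) : A ^+ n = 0 -> diff_mx (fun z => expmx ((z - 1) *: A)) A.
Proof.
move=> nA; have nz z : ((z - 1) *: A) ^+ n = 0 by rewrite expmxZ nA scaler0.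
have h j : diff_mx (fun z : C => (j`!%:R)^-1 *: ((z - 1) *: A) ^+ j)
    ((j == 1%N)%:R *: A).
  move=> r s.
  have e := diff_mxZ ((j`!%:R)^-1 *: A ^+ j) (diff_at1X j diff_at1_subr1) r s.
  rewrite subrr (_ : (_ *: (_ *: _) = (j == 1%N)%:R *: A)) in e.
    by apply: (diff_at1_ext e) => z _; rewrite expmxZ !mxE mulrCA.
  case: j => [|[|j]] /=.
  - by rewrite !mul0r !scale0r.
  - by rewrite expr0 !mul1r expr1 invr1 !scale1r.
  - by rewrite expr0n /= mulr0 mul0r !scale0r.
(* Two terms more than in [expmx], so that the linear term exists for every [n]. *)
have e := diff_mx_sum (index_enum 'I_n.+2) (fun j : 'I_n.+2 => h j).
have eA : \sum_(j < n.+2) ((j : nat) == 1%N)%:R *: A = A.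
  rewrite (bigD1 (Ordinal (isT : (1 < n.+2)%N))) //= scale1r big1 ?addr0 // => j.
  by rewrite -val_eqE /= => /negbTE ->; rewrite scale0r.
rewrite eA in e; move=> r s; apply: (diff_at1_ext (e r s)) => z _.
by rewrite -(@expmx_widen _ _ _ n.+2) //; lia.
Qed.

Lemma lie_expmx (G : 'M[C]_n -> Prop) (A : 'M[C]_n) : A ^+ n = 0 ->
  (forall c, G (expmx (c *: A))) -> lie idfun G A.
Proof.
move=> nA hG; apply: (lie_curve charC (diff_mx_exp nA)) => [|z _]; last exact: hG.
by rewrite subrr scale0r expmx0.
Qed.

(** The velocity of M^T J M along the line [1%:M + (z - 1) *: A] is computed twice: it is zero as a
    derivative of an equation of [G] in the direction [A], and the product rule gives A^T J + J
    A. *)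
Lemma lie_form (G : 'M[C]_n -> Prop) oJ b A : (forall x, G x -> classical_eqn oJ b x) ->
  lie idfun G A -> form_lie oJ A.
Proof.
case: oJ => //= J hG hA; apply/matrixP => r s.
pose pid := @polymx_id _ _ (idfun : {rmorphism C -> C}) n.
have [p [hp _]] := polyfunB (polymx_mul (polymx_mul (polymx_tr pid) (polymx_const J)) pid r s)
    (polymx_const J r s).
have vp : vanishing G p.
  by move=> x /hG [h _]; rewrite /mxeval hp map_mxid h subrr.
have lA := hA _ vp.
pose M (z : C) : 'M[C]_n := 1%:M + (z - 1) *: A.
have dM : diff_mx M A.
  have e := diff_mxD (diff_mx_const 1%:M) (diff_mxZ A diff_at1_subr1).
  by rewrite add0r scale1r in e.
have d1 := dirder_curve p dM; rewrite /M subrr scale0r addr0 in d1.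
have d2 := diff_mxM (diff_mxM (diff_mx_tr dM) (diff_mx_const J)) dM.
rewrite /M subrr scale0r addr0 mulmx0 addr0 mulmx1 trmx1 mul1mx in d2.
have d3 := diff_mxD d2 (diff_mx_const (- J)); rewrite addr0 in d3.
rewrite [RHS]mxE -[RHS]lA; apply: (diff_at1_uniq (d3 r s)).
apply: (diff_at1_ext d1) => z _; rewrite /mxeval hp map_mxid !mxE; congr (_ - _).
Qed.

(** The bracket is the velocity of the conjugates of [B] by exp((z - 1) A). This curve stays in the
    Lie algebra, which is cut out by linear equations, so its velocity satisfies them too. *)
Lemma lie_bracket_nilp (G : 'M[C]_n -> Prop) (A B : 'M[C]_n) : A ^+ n = 0 ->
  (forall c, G (expmx (c *: A))) -> (forall x D, G x -> lie idfun G D -> lie idfun G (x *m D *m invmx x)) ->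
  lie idfun G B -> lie idfun G (bracket A B).
Proof.
move=> nA hG ad hB p hp.
have nN : (- A) ^+ n = 0 by rewrite exprNn nA mulr0.
pose M (z : C) : 'M[C]_n := expmx ((z - 1) *: A) *m B *m expmx ((z - 1) *: (- A)).
have dM : diff_mx M (bracket A B).
  have e := diff_mxM (diff_mxM (diff_mx_exp nA) (diff_mx_const B)) (diff_mx_exp nN).
  by rewrite subrr !scale0r expmx0 mulmx0 addr0 mulmx1 mul1mx mulmxN in e.
have invE z : invmx (expmx ((z - 1) *: A)) = expmx ((z - 1) *: (- A)).
  have nz : ((z - 1) *: A) ^+ n = 0 by rewrite expmxZ nA scaler0.
  have h := expmxN charC nz; have [u _] := mulmx1_unit h.
  by rewrite -[LHS]mulmx1 -h mulKmx // scalerN.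
have d := diff_at1_sum (index_enum 'I_(n * n)) (P := xpredT)
  (F := fun k z => mxeval idfun (mderiv k p) 1%:M * mxvec (M z) 0 k)
  (D := fun k => mxeval idfun (mderiv k p) 1%:M * mxvec (bracket A B) 0 k).
apply: (diff_at1_zero charC (d _)) => [k _|z _].
  case/mxvec_indexP: k => r s; rewrite mxvecE.
  have e := diff_at1M (diff_at1_const (mxeval idfun (mderiv (mxvec_index r s) p) 1%:M)) (dM r s).
  rewrite mul0r add0r in e; apply: (diff_at1_ext e) => z _; by rewrite mxvecE.
rewrite /M -invE; apply: (ad _ _ _ hB _ hp); exact: hG.
Qed.

End LieClassical.

(** * The big cell *)

Section Star.

Variables (K : fieldType) (n : nat) (J : 'M[K]_n).
Implicit Types (A B : 'M[K]_n).
Hypothesis uJ : J \in unitmx.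

(* The adjoint for the form: [A] preserves the form iff [star A *m A = 1]. *)
Definition star A : 'M[K]_n := invmx J *m A^T *m J.

Lemma starM A B : star (A *m B) = star B *m star A.
Proof. by rewrite /star trmx_mul !mulmxA mulmxK. Qed.

Lemma star1 : star 1%:M = 1%:M.
Proof. by rewrite /star trmx1 mulmx1 mulVmx. Qed.

Lemma starB A B : star (A - B) = star A - star B.
Proof. by rewrite /star linearB mulmxBr mulmxBl. Qed.

Lemma star_form A : A^T *m J *m A = J <-> star A *m A = 1%:M.
Proof.
split=> [h|h]; first by rewrite /star -!mulmxA (mulmxA A^T) h mulVmx.
by rewrite -[RHS]mulmx1 -h /star !mulmxA mulmxV // mul1mx.
Qed.

Lemma star_lie A : star A = - A -> form_lie (Some J) A.
Proof.
move=> h; rewrite /= -[A^T *m J]mul1mx -(mulmxV uJ) -mulmxA [X in J *m X + _]mulmxA -/(star A) h.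
by rewrite mulmxN addNr.
Qed.

Variable gr : 'I_n -> int.
Hypothesis J_gr : forall p q, J p q != 0 -> gr p + gr q = 0.
Hypothesis iJ_gr : forall p q, invmx J p q != 0 -> gr p + gr q = 0.

Lemma star_entry A p q : star A p q =
  \sum_y \sum_x (if gr y - gr x == gr p - gr q then invmx J p x * A y x * J y q else 0).
Proof.
rewrite mxE; apply: eq_bigr => y _; rewrite mxE mulr_suml; apply: eq_bigr => x _.
rewrite mxE; have [->|n1] := eqVneq (invmx J p x) 0; first by rewrite !mul0r if_same.
have [->|n2] := eqVneq (J y q) 0; first by rewrite !mulr0 if_same.
by have := iJ_gr n1; have := J_gr n2; case: eqP => //; lia.
Qed.

(** Transposition changes the sign of the degree, and [J], which pairs opposite degrees, changes it
    back. *)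
Lemma star_comp d A : comp gr d (star A) = star (comp gr d A).
Proof.
apply/matrixP => p q; rewrite mxE !star_entry; case: eqP => [e|ne].
  apply: eq_bigr => y _; apply: eq_bigr => x _; rewrite mxE.
  by case: eqP => // ->; rewrite e eqxx.
rewrite big1 // => y _; rewrite big1 // => x _; rewrite mxE.
by case: eqP => // ->; case: eqP => // _; rewrite mulr0 mul0r.
Qed.

Lemma star_nz A p q : star A p q != 0 -> exists x y, gr y - gr x = gr p - gr q /\ A y x != 0.
Proof.
rewrite star_entry => nz; apply: NNPP => hn; case/eqP: nz.
rewrite big1 // => y _; rewrite big1 // => x _; case: eqP => // e.
have -> : A y x = 0; last by rewrite mulr0 mul0r.
by apply/eqP; apply: contraT => h; case: hn; exists x, y.
Qed.

Lemma star_degle d A : degle gr d A -> degle gr d (star A).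
Proof. by move=> hA p q /star_nz [x [y [<-]]] /hA. Qed.

(** With A = 1 + N, preservation of the form reads star N + N + (star N) N = 0. The quadratic term
    has degree at most -2d and is invisible in degree -d. *)
Lemma comp_form_lie d A : 0 < d -> A^T *m J *m A = J -> degle gr (- d) (A - 1%:M) ->
  form_lie (Some J) (comp gr (- d) A).
Proof.
move=> d0 /star_form hA; set N := A - 1%:M => hN; apply: star_lie.
have eA : A = N + 1%:M by rewrite subrK.
have cA : comp gr (- d) A = comp gr (- d) N by rewrite eA compD comp1 ?addr0 //; lia.
have e : star N + N + star N *m N = 0.
  have : star A *m A = (star N + 1%:M) *m (N + 1%:M).
    by rewrite /N starB star1 !subrK.
  clearbody N; rewrite hA mulmxDl mulmxDr mulmx1 mul1mx !addrA => /(congr1 (fun M => M - 1%:M)).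
  by rewrite subrr addrK => ->; rewrite [LHS]addrC addrA.
rewrite cA -star_comp; apply/eqP; rewrite -addr_eq0 -compD; apply/eqP.
move/(congr1 (comp gr (- d))): e; rewrite compD.
rewrite (comp_degle (degleM (star_degle hN) hN)); last lia.
by rewrite addr0 => ->; apply/matrixP => p q; rewrite !mxE if_same.
Qed.

Hypothesis gr_inj : injective gr.
Let rg := fun p => - gr p.

Lemma star_diag (D : 'M[K]_n) : is_diag_mx D -> is_diag_mx (star D).
Proof.
move=> /is_diag_mxP dD; apply/is_diag_mxP => p q pq; apply/eqP; apply: contraT.
move=> /star_nz [x [y [e]]]; rewrite dD ?eqxx //; apply: contra pq => /eqP yx.
apply/eqP; congr nat_of_ord; apply: gr_inj; move: e; rewrite (val_inj yx); lia.
Qed.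

Lemma star_unip A : unip gr A -> unip gr (star A).
Proof. by move=> hA; rewrite /unip -star1 -starB; apply: star_degle. Qed.

Lemma star_unipr A : unip rg A -> unip rg (star A).
Proof.
move=> hA; rewrite /unip -star1 -starB => p q /star_nz [x [y [e]]] /hA.
by rewrite /rg; lia.
Qed.

Lemma diag_inv (D : 'M[K]_n) : is_diag_mx D -> D \in unitmx -> is_diag_mx (invmx D).
Proof.
move=> /is_diag_mxP dD uD; apply/is_diag_mxP => p q pq.
have D0 r : D r r != 0.
  move: uD; rewrite unitmxE unitfE; apply: contraNneq => Dr.
  rewrite det_trig; last by apply/is_trig_mxP => u v uv; apply: dD; rewrite neq_ltn uv.
  by rewrite (bigD1 r) //= Dr mul0r.
apply: (mulfI (D0 p)); rewrite mulr0.
have := congr1 (fun M : 'M_n => M p q) (mulmxV uD); rewrite !mxE -val_eqE /= (negbTE pq) mulr0n => <-.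
rewrite (bigD1 p) //= big1 ?addr0 // => r rp; rewrite dD ?mul0r // eq_sym.
by rewrite -val_eqE in rp.
Qed.

Lemma unip_invmx (g : 'I_n -> int) (A : 'M[K]_n) : unip g A -> unip g (invmx A).
Proof.
move=> uA; have [B uB AB] := unip_inv uA.
have uA' := unip_unit uA.
by rewrite -[invmx A]mulmx1 -AB mulKmx.
Qed.

(** [star] reverses products but preserves each kind of factor, so inverses of stars give a second
    decomposition of the same matrix with the factors in the same order. Uniqueness makes each
    factor the inverse of its own star. *)
Lemma ldu_form (U D L : 'M[K]_n) : unip rg U -> is_diag_mx D -> D \in unitmx -> unip gr L ->
  (U *m D *m L)^T *m J *m (U *m D *m L) = J ->
  [/\ U^T *m J *m U = J, D^T *m J *m D = J & L^T *m J *m L = J].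
Proof.
move=> uU dD uD uL /star_form; rewrite !starM => h.
have iU := unip_unit uU; have iL := unip_unit uL.
have iU' := unip_unit (star_unipr uU); have iL' := unip_unit (star_unip uL).
have iD' : star D \in unitmx by rewrite /star !unitmx_mul unitmx_inv uJ unitmx_tr uD.
have e : invmx (star U) *m invmx (star D) *m invmx (star L) = U *m D *m L.
  have inv3 (x y z M : 'M[K]_n) : x \in unitmx -> y \in unitmx -> z \in unitmx ->
      z *m (y *m x) *m M = 1%:M -> invmx x *m invmx y *m invmx z = M.
    move=> ux uy uz e1; rewrite -[LHS]mulmx1 -e1 !mulmxA.
    by rewrite (mulmxKV uz) (mulmxKV uy) (mulVmx ux) mul1mx.
  exact: inv3.
have h1 : unip rg (invmx (star U)) by apply/unip_invmx/star_unipr.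
have h2 : is_diag_mx (invmx (star D)) by apply: diag_inv => //; apply: star_diag.
have h3 : invmx (star D) \in unitmx by rewrite unitmx_inv.
have h4 : unip gr (invmx (star L)) by apply/unip_invmx/star_unip.
have [eU eD eL] := ldu_unique h1 uU h2 dD h3 uD h4 uL e.
by split; apply/star_form; [rewrite -{2}eU|rewrite -{2}eD|rewrite -{2}eL]; rewrite mulmxV.
Qed.

End Star.

Section GradedLDU.

Variables (K : fieldType) (n : nat) (gr : 'I_n -> int) (s : 'S_n).
Hypothesis hs : forall p q : 'I_n, (p < q)%N -> gr (s p) < gr (s q).

Definition permuted (A : 'M[K]_n) : 'M[K]_n := \matrix_(p, q) A (s p) (s q).

(** Sorting the indices by [gr] turns the grading into the usual order. The lower triangular factor
    then has positive degrees, so it is the factor [U] that belongs to the positive roots. *)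
Lemma ldu_graded A : (forall k, \det (corner k (permuted A)) != 0) ->
  exists U D L : 'M[K]_n, [/\ A = U *m D *m L, is_diag_mx D, unip (fun p => - gr p) U & unip gr L].
Proof.
move=> /ldu_exists [L0 [D0 [U0 [e dD hL hU]]]].
pose f (M : 'M[K]_n) : 'M[K]_n := \matrix_(p, q) M ((s^-1)%g p) ((s^-1)%g q).
have fM M N : f (M *m N) = f M *m f N.
  apply/matrixP => p q; rewrite !mxE (reindex_inj (@perm_inj _ (s^-1)%g)) /=.
  by apply: eq_bigr => r _; rewrite !mxE.
have gs p q : gr p <= gr q -> ((s^-1)%g p <= (s^-1)%g q)%N.
  by move=> le; rewrite leqNgt; apply/negP => /hs; rewrite !permKV; lia.
have sI p q : ((s^-1)%g p == (s^-1)%g q) = (p == q) by rewrite (inj_eq perm_inj).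
exists (f L0), (f D0), (f U0); split.
- rewrite -!fM -e; apply/matrixP => p q; by rewrite !mxE !permKV.
- apply/is_diag_mxP => p q pq; rewrite mxE (is_diag_mxP dD) //.
  by rewrite val_eqE sI -val_eqE.
- move=> p q nz; have : ~~ (gr p <= gr q).
    by apply: contra nz => /gs/hL h; rewrite !mxE h sI subrr.
  lia.
- move=> p q nz; have : ~~ (gr q <= gr p).
    by apply: contra nz => /gs/hU h; rewrite !mxE h sI subrr.
  lia.
Qed.

End GradedLDU.

Lemma ldu_classical (K : fieldType) n (gr : 'I_n -> int) (oJ : option 'M[K]_n) b U D L :
  injective gr ->
  (forall J, oJ = Some J -> [/\ J \in unitmx, forall p q, J p q != 0 -> gr p + gr q = 0
     & forall p q, invmx J p q != 0 -> gr p + gr q = 0]) ->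
  unip (fun p => - gr p) U -> is_diag_mx D -> D \in unitmx -> unip gr L ->
  classical_eqn oJ b (U *m D *m L) ->
  [/\ classical_eqn oJ b U, classical_eqn oJ b D & classical_eqn oJ b L].
Proof.
move=> gri hJ uU dD uD uL [fA dA].
have dD1 : b -> \det D = 1.
  by move=> /dA; rewrite !det_mulmx (det_unip uU) (det_unip uL) mul1r mulr1.
suff [fU fD fL] : [/\ if oJ is Some J then U^T *m J *m U = J else True,
    if oJ is Some J then D^T *m J *m D = J else True
  & if oJ is Some J then L^T *m J *m L = J else True].
  by split; split=> // _; [apply: det_unip uU|apply: det_unip uL].
case: oJ hJ fA {dA} => // J /(_ J (erefl _)) [uJ Jg iJg].
exact: (ldu_form uJ Jg iJg gri).
Qed.

Section RootPeel.

Variables (K : fieldType) (charK : [pchar K] =i pred0) (n : nat) (gr : 'I_n -> int).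
Variables (oJ : option 'M[K]_n) (b : bool).
Hypothesis hJ : forall J, oJ = Some J -> [/\ J \in unitmx,
  forall p q, J p q != 0 -> gr p + gr q = 0 & forall p q, invmx J p q != 0 -> gr p + gr q = 0].
Variables (R : eqType) (Phi : seq R) (X : R -> 'M[K]_n) (deg : R -> int).
Hypothesis uPhi : uniq Phi.
Hypothesis homX : forall a, a \in Phi -> homdeg gr (deg a) (X a).
Hypothesis eqnX : forall a c, a \in Phi -> classical_eqn oJ b (expmx (c *: X a)).
Hypothesis expandX : forall d A, d != 0 -> form_lie oJ A -> homdeg gr d A ->
  exists v : R -> K, A = \sum_(a <- Phi | deg a == d) v a *: X a.

(** The leading component of a solution of the group equations solves the linearized ones by
    [comp_form_lie], so [expandX] writes it with root vectors of its own negative degree; all of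
    these are among the [beta j]. *)
Lemma peel m (beta : 'I_m -> R) (s : seq 'I_m) : injective beta ->
  (forall j, beta j \in Phi) -> (forall j, deg (beta j) < 0) ->
  (forall a, a \in Phi -> deg a < 0 -> exists j, a = beta j) ->
  perm_eq s (enum 'I_m) -> sorted (fun i j => deg (beta j) <= deg (beta i)) s ->
  forall L, classical_eqn oJ b L -> unip gr L -> exists y, L = expprod (X \o beta) s y.
Proof.
move=> bi bP b0 bS ps srt L eL uL.
pose dg j := - deg (beta j).
have us : uniq s by rewrite (perm_uniq ps) enum_uniq.
have lead M d : 0 < d -> classical_eqn oJ b M -> degle gr (- d) (M - 1%:M) ->
    exists c : 'I_m -> K, comp gr (- d) M = \sum_(j | dg j == d) c j *: X (beta j).
  move=> d0 eM hM; have [|||v hv] := @expandX (- d) (comp gr (- d) M).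
  - by lia.
  - case eJ: oJ => [J|] //; have [uJ Jg iJg] := hJ eJ.
    by apply: (comp_form_lie uJ Jg iJg d0) => //; case: eM; rewrite eJ.
  - exact: homog_comp.
  exists (v \o beta); rewrite hv -big_filter.
  have -> : \sum_(j | dg j == d) (v \o beta) j *: X (beta j) =
      \sum_(a <- [seq beta j | j <- enum 'I_m & dg j == d]) v a *: X a.
    by rewrite big_map big_filter big_enum_cond; apply: eq_bigl => j; rewrite inE.
  apply/perm_big/uniq_perm; rewrite ?filter_uniq //.
    by rewrite map_inj_uniq ?filter_uniq // -enumT enum_uniq.
  move=> a; rewrite mem_filter; apply/andP/mapP => [[/eqP ad aP]|[j]].
    have [|j ej] := bS a aP; first by rewrite ad; lia.
    exists j => //; rewrite mem_filter mem_enum andbT /dg -ej ad opprK //.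
  by rewrite mem_filter /dg => /andP [/eqP <- _] ->; rewrite opprK eqxx bP.
have [|||||||y ->] := @peel_aux _ gr K charK m (X \o beta) dg _ _ (classical_eqn oJ b) _ _ s us _ _ L eL uL.
- by move=> j; have := b0 j; rewrite /dg; lia.
- by move=> j; rewrite /dg opprK; apply: homX.
- by move=> j y M; apply: classical_eqn_mul; apply: eqnX.
- by move=> M d d0 eM hM; apply: lead.
- by apply: sub_sorted srt => i j; rewrite /dg lerN2.
- by move=> j j'; rewrite (perm_mem ps) mem_enum.
- move=> d d0 hM; have [c ->] := lead L d d0 eL hM; exists c.
  by rewrite (perm_big _ ps) /= big_enum_cond; apply: eq_bigl => j; rewrite inE.
by exists y.
Qed.

End RootPeel.

(** * Existence and uniqueness of coordinates on the big cell *)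

Section BigCell.

Variables (K : fieldType) (charK : [pchar K] =i pred0) (l n m : nat) (e : 'I_n -> 'I_l -> int).
Variables (oJ : option 'M[K]_n) (b : bool).
Variables (R : eqType) (Phi : seq R) (X : R -> 'M[K]_n).
Variables (gg gh : 'I_n -> int) (dg dh : R -> int).
Hypothesis gg_inj : injective gg.
Hypothesis hJ : forall J, oJ = Some J -> [/\ J \in unitmx,
  forall p q, J p q != 0 -> gg p + gg q = 0 /\ gh p + gh q = 0
  & forall p q, invmx J p q != 0 -> gg p + gg q = 0 /\ gh p + gh q = 0].
Hypothesis uPhi : uniq Phi.
Hypothesis homg : forall a, a \in Phi -> homdeg gg (dg a) (X a).
Hypothesis homh : forall a, a \in Phi -> homdeg gh (dh a) (X a).
Hypothesis sign_dg : forall a, a \in Phi -> (dg a < 0) = (dh a < 0) /\ (0 < dg a) = (0 < dh a).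
Hypothesis dh_neq0 : forall a, a \in Phi -> dh a != 0.
Hypothesis eqnX : forall a c, a \in Phi -> classical_eqn oJ b (expmx (c *: X a)).
Hypothesis expandg : forall d A, d != 0 -> form_lie oJ A -> homdeg gg d A ->
  exists v : R -> K, A = \sum_(a <- Phi | dg a == d) v a *: X a.
Hypothesis expandh : forall d A, d != 0 -> form_lie oJ A -> homdeg gh d A ->
  exists v : R -> K, A = \sum_(a <- Phi | dh a == d) v a *: X a.
Hypothesis X_neq0 : forall a, a \in Phi -> X a != 0.
Hypothesis X_supp : forall a a' p q, a \in Phi -> a' \in Phi ->
  X a p q != 0 -> X a' p q != 0 -> a = a'.
Variable beta : 'I_m -> R.
Hypothesis beta_inj : injective beta.
Hypothesis betaP : forall j, beta j \in Phi.
Hypothesis beta_neg : forall j, dh (beta j) < 0.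
Hypothesis beta_all : forall a, a \in Phi -> dh a < 0 -> exists j, a = beta j.
Hypothesis beta_sorted : sorted (fun i j => dh (beta j) <= dh (beta i)) (enum 'I_m).
Variables (w : R -> R) (nw : 'M[K]_n).
Hypothesis nw_unit : nw \in unitmx.
Hypothesis nw_eqn : classical_eqn oJ b nw.
Hypothesis wP : forall a, a \in Phi -> w a \in Phi.
Hypothesis w_surjective : forall a, a \in Phi -> exists2 a', a' \in Phi & w a' = a.
Hypothesis w_opp : forall a, a \in Phi -> (0 < dh (w a)) = (dh a < 0).
Hypothesis nwX : forall a, a \in Phi -> exists2 d, d != 0 & nw *m X a *m invmx nw = d *: X (w a).
Hypothesis torus_surj : forall D : 'M[K]_n, is_diag_mx D -> D \in unitmx ->
  classical_eqn oJ b D -> exists2 z : 'rV[K]_l, Gm z & D = weight_mx e z.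
Hypothesis torus_inj : forall z z' : 'rV[K]_l, Gm z -> Gm z' ->
  weight_mx e z = weight_mx e z' -> z = z'.

(** The map [umap] in the basis that diagonalizes the torus. *)
Definition uneg (y : 'rV[K]_m) : 'M[K]_n := expprod (X \o beta) (enum 'I_m) (y 0).

Lemma unip_expprod (gr : 'I_n -> int) N (Z : 'I_N -> 'M[K]_n) (d : 'I_N -> int) s y :
  (forall j, d j < 0) -> (forall j, homdeg gr (d j) (Z j)) -> unip gr (expprod Z s y).
Proof.
move=> d0 hZ; rewrite /unip.
apply: (@expprod_degle _ gr K N Z (fun j => - d j)) => // j; last by have := d0 j; lia.
- by have := d0 j; lia.
- by rewrite opprK.
Qed.

Lemma unip_uneg y : unip gg (uneg y) /\ unip gh (uneg y).
Proof.
split; [apply: (unip_expprod (d := dg \o beta))|apply: (unip_expprod (d := dh \o beta))] => j //=.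
- by rewrite (sign_dg (betaP j)).1.
- exact: homg.
- exact: homh.
Qed.

Lemma peel_neg L : classical_eqn oJ b L -> unip gh L -> exists y, L = uneg y.
Proof.
move=> eL uL.
have [|y ->] := @peel K charK n gh oJ b _ R Phi X dh uPhi homh eqnX expandh m beta (enum 'I_m)
  beta_inj betaP beta_neg beta_all (perm_refl _) beta_sorted L eL uL.
  by move=> J /hJ [uJ h1 h2]; split=> // p q; [case/h1|case/h2].
exists (\row_j y j); rewrite /uneg /expprod; apply: eq_bigr => j _; by rewrite mxE.
Qed.

Lemma sort_enum N (d : 'I_N -> int) : exists s : seq 'I_N,
  perm_eq s (enum 'I_N) /\ sorted (fun i j => d j <= d i) s.
Proof.
exists (sort (fun i j => d j <= d i) (enum 'I_N)); split; first by rewrite perm_sort.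
by apply: sort_sorted => i j; apply: le_total.
Qed.

(** The coefficients of the first peeling, in an order adapted to [gg], are thrown away. It only
    shows that [L] is a product of exponentials of negative root vectors, hence unipotent for [gh],
    where the order of [beta] can be used. *)
Lemma peel_generic L : classical_eqn oJ b L -> unip gg L -> exists y, L = uneg y.
Proof.
move=> eL uL; apply: peel_neg => //; have [s [ps srt]] := sort_enum (dg \o beta).
have [|||y ->] := @peel K charK n gg oJ b _ R Phi X dg uPhi homg eqnX expandg m beta s
  beta_inj betaP _ _ ps srt L eL uL.
- by move=> J /hJ [uJ h1 h2]; split=> // p q; [case/h1|case/h2].
- by move=> j; rewrite (sign_dg (betaP j)).1.
- by move=> a aP; rewrite (sign_dg aP).1; apply: beta_all.
by apply: (unip_expprod (d := dh \o beta)) => j //=; apply: homh.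
Qed.

Lemma conj_expprod N (a : 'I_N -> R) s y : (forall j, a j \in Phi) ->
  exists y', nw *m expprod (X \o a) s y *m invmx nw = expprod (X \o (w \o a)) s y'.
Proof.
move=> aP; have [d d0 hd] := fin_all_exists2 (fun j => nwX (aP j)).
exists (fun j => y j * d j); rewrite /expprod; elim: s => [|j s IH].
  by rewrite !big_nil mulmx1 mulmxV.
rewrite !big_cons -[_ * _]/(_ *m _) -[X in _ = X]/(_ *m _) -IH /=.
rewrite -scalerA -hd scalemxAl scalemxAr expmx_conj ?mulVmx //.
by rewrite !mulmxA mulmxKV.
Qed.

(** After peeling along the positive roots, conjugation by [nw] turns every factor into one for the
    negative root [w a]. The product is then unipotent for [gh] and can be peeled in the order of
    [beta]. *)
Lemma peel_pos U : classical_eqn oJ b U -> unip (fun p => - gg p) U ->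
  exists x, nw *m U *m invmx nw = uneg x.
Proof.
move=> eU uU; apply: peel_neg.
  by apply: classical_eqn_mul; [apply: classical_eqn_mul|apply: classical_eqn_inv].
pose pl := [seq a <- Phi | 0 < dg a]; pose al (j : 'I_(size pl)) := tnth (in_tuple pl) j.
have alP j : al j \in Phi /\ 0 < dg (al j).
  by have := mem_tnth j (in_tuple pl); rewrite mem_filter => /andP [].
have al_inj : injective al.
  move=> i j; rewrite /al !(tnth_nth (al i)) /= => /eqP.
  by rewrite nth_uniq ?filter_uniq // => /eqP/val_inj.
have [s [ps srt]] := sort_enum (fun j => - dg (al j)).
have [|||||y ->] := @peel K charK n (fun p => - gg p) oJ b _ R Phi X (fun a => - dg a) uPhi _ eqnX _
  _ al s al_inj (fun j => (alP j).1) _ _ ps srt U eU uU.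
- move=> J /hJ [uJ h1 h2]; split=> // p q; [case/h1|case/h2]; lia.
- by move=> a aP p q /(homg aP); lia.
- move=> d A d0 fA hA; have [||| v ->] := @expandg (- d) A; rewrite ?oppr_eq0 //.
    by move=> p q /hA; lia.
  by exists v; apply: eq_bigl => a; rewrite eqr_oppLR.
- by move=> j; have := (alP j).2; lia.
- move=> a aP a0; have : a \in pl by rewrite mem_filter aP andbT; lia.
  by move/seq_tnthP => [j ->]; exists j.
have [y' ->] := conj_expprod s y (fun j => (alP j).1).
apply: (unip_expprod (d := dh \o (w \o al))) => j /=.
  have [aP pa] := alP j; have := w_opp aP; have := dh_neq0 (wP aP).
  by have := (sign_dg aP).2; rewrite pa; lia.
by apply: homh; apply: wP; case: (alP j).
Qed.

Lemma big_cell_exists (s : 'S_n) A :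
  (forall p q : 'I_n, (p < q)%N -> gg (s p) < gg (s q)) ->
  classical_eqn oJ b A -> A \in unitmx ->
  (forall k, \det (corner k (permuted s (invmx nw *m A))) != 0) ->
  exists x (z : 'rV[K]_l) y, Gm z /\ A = uneg x *m nw *m weight_mx e z *m uneg y.
Proof.
move=> hs eA uA /(ldu_graded hs) [U [D [L [eB dD uU uL]]]].
have eB' : classical_eqn oJ b (U *m D *m L).
  by rewrite -eB; apply: classical_eqn_mul => //; apply: classical_eqn_inv.
have uD : D \in unitmx.
  have : U *m D *m L \in unitmx by rewrite -eB unitmx_mul unitmx_inv nw_unit.
  by rewrite !unitmx_mul => /andP [/andP []].
have [|eU eD eL] := ldu_classical gg_inj _ uU dD uD uL eB'.
  by move=> J /hJ [uJ h1 h2]; split=> // p q; [case/h1|case/h2].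
have [x ex] := peel_pos eU uU; have [y ey] := peel_generic eL uL.
have [z gz ez] := torus_surj dD uD eD.
exists x, z, y; split=> //; rewrite -ez -ey -ex mulmxKV // -!mulmxA (mulmxA U) -eB.
by rewrite mulmxA mulmxV // mul1mx.
Qed.

Lemma X_free (c : 'I_m -> K) : \sum_j c j *: (X \o beta) j = 0 -> forall j, c j = 0.
Proof.
move=> e0 j; have [p [q nz]] : exists p q, X (beta j) p q != 0.
  apply: NNPP => hn; have /eqP := X_neq0 (betaP j); apply; apply/matrixP => p q.
  by rewrite mxE; apply/eqP; apply: contraT => nz; case: hn; exists p, q.
have := congr1 (fun M : 'M_n => M p q) e0; rewrite summxE mxE (bigD1 j) //= big1 ?addr0.
  by rewrite mxE => /eqP; rewrite mulf_eq0 (negbTE nz) orbF => /eqP.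
move=> j' j'j; rewrite mxE; have [->|nz'] := eqVneq (X (beta j') p q) 0; first by rewrite mulr0.
by have := X_supp (betaP j') (betaP j) nz' nz; move/beta_inj/eqP; rewrite (negbTE j'j).
Qed.

Lemma uneg_inj : injective uneg.
Proof.
move=> y y' e0; apply/rowP => j.
apply: (@expprod_inj _ gh K charK m (X \o beta) (fun j => - dh (beta j)) _ _ (enum 'I_m)
  (y 0) (y' 0) X_free (enum_uniq _)) => //.
- by move=> j'; have := beta_neg j'; lia.
- by move=> j'; rewrite opprK; apply: homh.
- by apply: sub_sorted beta_sorted => i i'; rewrite lerN2.
- by rewrite mem_enum.
Qed.

Lemma conj_uneg x : unip (fun p => - gg p) (invmx nw *m uneg x *m nw).
Proof.
have [al alP ea] := fin_all_exists2 (fun j => w_surjective (betaP j)).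
have [d d0 hd] := fin_all_exists2 (fun j => nwX (alP j)).
have -> : invmx nw *m uneg x *m nw = expprod (X \o al) (enum 'I_m) (fun j => x 0 j / d j).
  rewrite /uneg /expprod; elim: (enum _) => [|j s IH]; first by rewrite !big_nil mulmx1 mulVmx.
  rewrite !big_cons -[_ * _]/(_ *m _) -[X in _ = X]/(_ *m _) -IH /= -ea.
  have -> : X (w (al j)) = (d j)^-1 *: (nw *m X (al j) *m invmx nw).
    by rewrite hd scalerA mulVf // scale1r.
  rewrite scalerA scalemxAl scalemxAr expmx_conj ?mulVmx //.
  by rewrite !mulmxA mulVmx // mul1mx.
apply: (unip_expprod (d := fun j => - dg (al j))) => j.
  have := w_opp (alP j); rewrite ea; have := beta_neg j; have := dh_neq0 (alP j).
  by have := (sign_dg (alP j)).2; lia.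
by move=> p q /(homg (alP j)); lia.
Qed.

Lemma weight_unit (z : 'rV[K]_l) : Gm z -> weight_mx e z \in unitmx.
Proof.
move=> gz; rewrite unitmxE unitfE det_diag; apply/prodf_neq0 => p _; rewrite mxE.
by apply/prodf_neq0 => j _; rewrite expfz_neq0.
Qed.

Lemma big_cell_inj x x' (z z' : 'rV[K]_l) y y' : Gm z -> Gm z' ->
  uneg x *m nw *m weight_mx e z *m uneg y = uneg x' *m nw *m weight_mx e z' *m uneg y' ->
  [/\ x = x', z = z' & y = y'].
Proof.
move=> gz gz' /(congr1 (mulmx (invmx nw))); rewrite !mulmxA => e0.
have [h1 h2 h3] := ldu_unique (@conj_uneg x) (@conj_uneg x') (diag_mx_is_diag _) (diag_mx_is_diag _)
  (weight_unit gz) (weight_unit gz') (proj1 (unip_uneg y)) (proj1 (unip_uneg y')) e0.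
split; [apply: uneg_inj|exact: torus_inj|exact: uneg_inj].
have := congr1 (fun M => nw *m M *m invmx nw) h1.
by rewrite !mulmxA mulmxV // !mul1mx !(mulmxK nw_unit).
Qed.

End BigCell.

(** * Polynomial dependence on parameters and polynomials that vanish everywhere *)

Lemma map_mx_exp (K L : fieldType) (f : {rmorphism K -> L}) n (A : 'M[K]_n) j :
  map_mx f (A ^+ j) = map_mx f A ^+ j.
Proof.
elim: j => [|j IH]; first by rewrite !expr0 map_mx1.
by rewrite !exprS -!mulmxE map_mxM IH.
Qed.

Lemma polymx_prod (C K1 K2 : fieldType) (i1 : {rmorphism C -> K1}) (i2 : {rmorphism C -> K2})
    (T1 T2 : Type) N (co1 : T1 -> 'I_N -> K1) (co2 : T2 -> 'I_N -> K2) n M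
    (F1 : 'I_M -> T1 -> 'M[K1]_n) F2 :
  (forall j, polymx i1 i2 co1 co2 (F1 j) (F2 j)) ->
  polymx i1 i2 co1 co2 (fun x => \prod_j F1 j x) (fun x => \prod_j F2 j x).
Proof.
move=> hF; elim: (index_enum _) => [|j s IH] r c.
  by apply: (polyfun_ext (polymx_const 1%:M r c)) => x; rewrite big_nil map_mx1.
by apply: (polyfun_ext (polymx_mul (hF j) IH r c)) => x; rewrite big_cons.
Qed.

Lemma polymx_expmx (C K1 K2 : fieldType) (i1 : {rmorphism C -> K1}) (i2 : {rmorphism C -> K2})
    (T1 T2 : Type) N (co1 : T1 -> 'I_N -> K1) (co2 : T2 -> 'I_N -> K2) n f1 f2 (A : 'M[C]_n) :
  polyfun i1 i2 co1 co2 f1 f2 ->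
  polymx i1 i2 co1 co2 (fun x => expmx (f1 x *: map_mx i1 A)) (fun x => expmx (f2 x *: map_mx i2 A)).
Proof.
move=> hf r s.
have h1 (j : 'I_n) : true -> polyfun i1 i2 co1 co2
    (fun x => (j`!%:R^-1 *: (f1 x *: map_mx i1 A) ^+ j) r s)
    (fun x => (j`!%:R^-1 *: (f2 x *: map_mx i2 A) ^+ j) r s).
  move=> _; have h2 := polyfunM (polyfunM (polyfun_const (j`!%:R^-1)) (polyfunX j hf))
    (polymx_const (A ^+ j) r s).
  by apply: (polyfun_ext h2) => x; rewrite expmxZ scalerA -map_mx_exp !mxE fmorphV rmorph_nat.
by apply: (polyfun_ext (polyfun_sum (index_enum 'I_n) h1)) => x; rewrite /expmx summxE.
Qed.

Lemma digits_inj B N (f g : 'I_N -> nat) : (forall k, (f k < B)%N) -> (forall k, (g k < B)%N) ->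
  (\sum_k f k * B ^ k = \sum_k g k * B ^ k)%N -> f =1 g.
Proof.
elim: N f g => [|N IH] f g fB gB; first by move=> _ [].
have split_sum (u : 'I_N.+1 -> nat) :
    (\sum_k u k * B ^ k = u ord0 + (\sum_(k < N) u (lift ord0 k) * B ^ k) * B)%N.
  rewrite big_ord_recl expn0 muln1 big_distrl /=; congr (_ + _)%N; apply: eq_bigr => k _.
  by rewrite /bump add1n expnSr mulnA.
rewrite !split_sum => e; have B0 : (0 < B)%N by apply: leq_ltn_trans (fB ord0).
have e0 : f ord0 = g ord0.
  by have := congr1 (modn^~ B) e; rewrite /= ![(_ + _ * B)%N]addnC !modnMDl !modn_small.
have e1 : (\sum_(k < N) f (lift ord0 k) * B ^ k = \sum_(k < N) g (lift ord0 k) * B ^ k)%N.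
  by move: e; rewrite e0 => /addnI/eqP; rewrite eqn_pmul2r // => /eqP.
move=> k; case: (unliftP ord0 k) => [k' ->|-> //].
by apply: (IH (f \o lift ord0) (g \o lift ord0)) => // j; rewrite /= ?fB ?gB.
Qed.

(* Kronecker's substitution sends distinct monomials to distinct powers. *)
Lemma mpoly_eq0_infinite (F E : fieldType) (i : {rmorphism F -> E}) N (p : {mpoly F[N]}) :
  [pchar E] =i pred0 -> (forall u : 'I_N -> E, mmap i u p = 0) -> p = 0.
Proof.
move=> charE hp; pose B := msize p; pose ka (m : 'X_{1..N}) := (\sum_k m k * B ^ k)%N.
pose q : {poly E} := \sum_(m <- msupp p) i p@_m *: 'X^(ka m).
have q0 : q = 0.
  apply: (poly_eq0_infinite charE) => z _; rewrite -[RHS](hp (fun k => z ^+ (B ^ k))).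
  rewrite /q horner_sum /mmap; apply: eq_bigr => m _; rewrite hornerZ hornerXn; congr (_ * _).
  rewrite /mmap1 /ka (big_morph (fun d => z ^+ d) (exprD z) (expr0 z)).
  by apply: eq_bigr => k _; rewrite mulnC exprM.
apply/eqP; apply: contraT => p0; have [m ms] : exists m, m \in msupp p.
  move: p0; rewrite -msupp_eq0; case: (msupp p) => // m s _; exists m; exact: mem_head.
have digB m' k : m' \in msupp p -> (m' k < B)%N.
  move=> /msize_mdeg_lt; apply: leq_ltn_trans.
  by rewrite mdegE (bigD1 k) //= leq_addr.
have := congr1 (fun r : {poly E} => r`_(ka m)) q0; rewrite coef0 coef_sum (bigD1_seq m) ?msupp_uniq //=.
rewrite coefZ coefXn eqxx mulr1 big_seq_cond big1 ?addr0 => [|m' /andP [m's m'm]]; last first.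
  rewrite coefZ coefXn; case: eqP => [ek|_]; last by rewrite mulr0.
  case/eqP: m'm; apply/mnmP => k; symmetry.
  exact: (digits_inj (fun k => digB m k ms) (fun k => digB m' k m's) ek).
by move/eqP; rewrite fmorph_eq0 mcoeff_eq0 ms.
Qed.

(** * Rational functions and the generic point *)

(* Functions whose product with a power of [den] is a polynomial, where [den] does not vanish. *)
Section RationalFunctions.

Variables (F E : fieldType) (i : {rmorphism F -> E}) (T : Type) (N : nat).
Variables (co : T -> 'I_N -> E) (den : {mpoly F[N]}).

Notation ev := (fun (p : {mpoly F[N]}) x => mmap i (co x) p).

Definition ratfun (f : T -> E) : Prop := exists d P,
  forall x, ev den x != 0 -> ev P x = ev den x ^+ d * f x.

Lemma ratfun_ext f g : ratfun f -> (forall x, ev den x != 0 -> f x = g x) -> ratfun g.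
Proof. by move=> [d [P hP]] e; exists d, P => x x0; rewrite hP // e. Qed.

Lemma ratfun_poly p : ratfun (ev p).
Proof. by exists 0%N, p => x _; rewrite expr0 mul1r. Qed.

Lemma ratfun_const c : ratfun (fun=> i c).
Proof. by apply: (ratfun_ext (ratfun_poly c%:MP)) => x _; rewrite mmapC. Qed.

Lemma ratfun_div p : ratfun (fun x => ev p x / ev den x).
Proof. by exists 1%N, p => x x0; rewrite expr1 mulrC divfK. Qed.

Lemma ratfunD f g : ratfun f -> ratfun g -> ratfun (fun x => f x + g x).
Proof.
move=> [d [P hP]] [d' [Q hQ]]; exists (d + d')%N, (P * den ^+ d' + Q * den ^+ d) => x x0.
rewrite mmapD !rmorphM !rmorphXn /= hP // hQ // exprD.
by move: (_ ^+ d) (_ ^+ d') (f x) (g x) => u v a c; ring.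
Qed.

Lemma ratfunM f g : ratfun f -> ratfun g -> ratfun (fun x => f x * g x).
Proof.
move=> [d [P hP]] [d' [Q hQ]]; exists (d + d')%N, (P * Q) => x x0.
rewrite rmorphM /= hP // hQ // exprD.
by move: (_ ^+ d) (_ ^+ d') (f x) (g x) => u v a c; ring.
Qed.

Lemma ratfun_mmap M (p : {mpoly F[M]}) (f : T -> 'I_M -> E) : (forall k, ratfun (f^~ k)) ->
  ratfun (fun x => mmap i (f x) p).
Proof.
move=> hf; elim/mpoly_ring_ind: p => [c|j|p q hp hq|p q hp hq].
- by apply: (ratfun_ext (ratfun_const c)) => x _; rewrite mmapC.
- by apply: (ratfun_ext (hf j)) => x _; rewrite mmapX mmap1U.
- by apply: (ratfun_ext (ratfunD hp hq)) => x _; rewrite mmapD.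
- by apply: (ratfun_ext (ratfunM hp hq)) => x _; rewrite rmorphM.
Qed.

End RationalFunctions.

Section Galois.

Variables (C F E : fieldType) (jC : {rmorphism C -> F}) (i : {rmorphism F -> E}) (dE : E -> E).
Variables (n : nat) (G : 'M[C]_n -> Prop) (Y : 'M[E]_n).
Hypothesis G_unit : forall x, G x -> x \in unitmx.
Hypothesis G_mul : forall x y, G x -> G y -> G (x *m y).
Hypothesis G_inv : forall x, G x -> G (invmx x).
Hypothesis G_det : forall x, G x -> \det x ^+ 2 = 1.
Hypothesis G_gal : forall g : 'M[C]_n, G g -> exists2 s : {rmorphism E -> E}, diff_galois dE i s
  & map_mx s Y = Y *m map_mx (i \o jC) g.
Hypothesis Y_pt : points (i \o jC) G Y.

(* Polynomials over [F] vanishing at [Y] vanish on the torsor [Y * G(C)], which is dense in [G]. *)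
Lemma generic_point (Q : {mpoly F[n * n]}) : mxeval i Q Y = 0 ->
  forall A, points (i \o jC) G A -> mxeval i Q A = 0.
Proof.
move=> QY A PA; have uY := Y_pt.1.
(* The substitution of [Y *m D] in [Q] is a polynomial in [D] with coefficients in [E], so
   [points_vanish] has to be used; it is applied at the point Y^-1 A. *)
have [Q1 [hQ1 _]] := polyfun_mxeval (i := (idfun : {rmorphism E -> E})) (map_mpoly i Q)
  (polymx_mul (polymx_const Y) (polymx_id (idfun : {rmorphism E -> E}))).
have evQ D : mxeval idfun Q1 D = mxeval i Q (Y *m D).
  by rewrite /mxeval hQ1 map_mxid; apply: mmap_map_mpoly.
rewrite -(mulKVmx uY A) -evQ; apply: (points_vanish (i := i \o jC) (S := G)); last first.
  exact: (points_mul G_unit G_mul (points_inv G_unit G_inv G_det Y_pt) PA).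
move=> x Gx; rewrite evQ; have [s [_ si _] <-] := G_gal Gx.
rewrite -[RHS](rmorph0 s) -QY /mxeval /mmap rmorph_sum; apply: eq_bigr => m _.
rewrite rmorphM /= si; congr (_ * _); rewrite rmorph_prod; apply: eq_bigr => k _.
by rewrite rmorphXn -map_mxvec mxE.
Qed.

Hypothesis Y_gen : generates i Y.

Notation ev := (mxeval i).

Lemma generated_fraction c : exists a b, ev b Y != 0 /\ c = ev a Y / ev b Y.
Proof.
pose P x := exists a b, ev b Y != 0 /\ x = ev a Y / ev b Y.
(* [generates] quantifies over boolean predicates, so being a fraction in the entries of [Y] is
   decided classically. *)
pose S : {pred E} := fun x => if excluded_middle_informative (P x) then true else false.
have SP x : reflect (P x) (x \in S).
  by rewrite unfold_in /S; case: excluded_middle_informative => h; constructor.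
have P_poly a : P (ev a Y).
  by exists a, 1; rewrite /mxeval rmorph1 oner_neq0 divr1.
apply/SP/Y_gen => [|a|j k]; last 2 first.
- by apply/SP; have := P_poly a%:MP; rewrite mxevalC.
- by apply/SP; have := P_poly 'X_(mxvec_index j k); rewrite mxevalX mxvecE.
split; first by apply/SP; have := P_poly 1; rewrite /mxeval rmorph1.
- move=> x y /SP [a [b [b0 ->]]] /SP [a' [b' [b'0 ->]]]; apply/SP.
  exists (a * b' - a' * b), (b * b'); rewrite /mxeval mmapB !rmorphM /= -!/(ev _ _).
  by split; [rewrite mulf_neq0|field; rewrite b0 b'0].
move=> x y /SP [a [b [b0 ->]]] /SP [a' [b' [b'0 ->]]]; apply/SP.
have [a'0|a'0] := eqVneq (ev a' Y) 0.
  by exists 0, 1; rewrite a'0 /mxeval rmorph1 rmorph0 oner_neq0 !mul0r invr0 mulr0.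
exists (a * b'), (b * a'); rewrite /mxeval !rmorphM /= -!/(ev _ _).
by split; [rewrite mulf_neq0|field; rewrite b0 b'0 a'0].
Qed.

Lemma common_denominator N (v : 'I_N -> E) : exists (a : 'I_N -> {mpoly F[n * n]}) b,
  ev b Y != 0 /\ forall k, v k = ev (a k) Y / ev b Y.
Proof.
have [a ha] := fin_all_exists (fun k => generated_fraction (v k)).
have [b hb] := fin_all_exists ha.
have b0 k : ev (b k) Y != 0 by case: (hb k).
exists (fun k => a k * \prod_(j | j != k) b j), (\prod_j b j); split.
  by rewrite /mxeval rmorph_prod; apply/prodf_neq0 => k _; apply: b0.
move=> k; have [_ ->] := hb k; rewrite [\prod_j b j](bigD1 k) //= /mxeval !rmorphM /= -!/(ev _ _).
rewrite -mulf_div divff ?mulr1 // /mxeval rmorph_prod; apply/prodf_neq0 => j _; exact: b0.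
Qed.

Lemma ratfun_generic b f : ratfun i (fun A : 'M[E]_n => mxvec A 0) b f ->
  ev b Y != 0 -> f Y = 0 -> forall A, points (i \o jC) G A -> ev b A != 0 -> f A = 0.
Proof.
move=> [d [P hP]] bY fY A PA bA.
have := generic_point (Q := P); rewrite /mxeval hP // fY mulr0 => /(_ erefl A PA).
by rewrite hP // => /eqP; rewrite mulf_eq0 expf_eq0 (negbTE bA) andbF => /eqP.
Qed.

End Galois.

(** * Gradings by functionals on the weights *)

Section WeightGradings.

Variables (K : fieldType) (l n : nat) (e : 'I_n -> 'I_l -> int).
Implicit Types (r : 'I_l -> int) (A : 'M[K]_n).

Definition wgr r (p : 'I_n) : int := \sum_j r j * e p j.

Definition has_weight (v : 'I_l -> int) A : Prop :=
  forall p q, A p q != 0 -> forall j, e p j - e q j = v j.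

Lemma has_weight_homdeg r v A : has_weight v A ->
  homdeg (wgr r) (\sum_j r j * v j) A.
Proof.
move=> hA p q /hA h; rewrite /wgr -sumrB; apply: eq_bigr => j _.
by rewrite -mulrBr h.
Qed.

Lemma has_weightZ (c : K) v A : has_weight v A -> has_weight v (c *: A).
Proof. by move=> hA p q; rewrite mxE mulf_eq0 negb_or => /andP [_ /hA]. Qed.

Lemma homdeg_nilp (charK : [pchar K] =i pred0) (gr : 'I_n -> int) d A :
  d != 0 -> homdeg gr d A -> A ^+ n = 0 /\ \det (expmx A) = 1.
Proof.
have key (gr' : 'I_n -> int) d' : 0 < d' -> homdeg gr' (- d') A -> A ^+ n = 0 /\ \det (expmx A) = 1.
  move=> d0 hA; split; first by apply: (@degle_nilp _ gr'); apply: (degleW _ (homog_degle hA)); lia.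
  apply: (@det_unip _ _ gr'); rewrite /unip; apply: (degleW _ (degle_expmx1 d0 (homog_degle hA))); lia.
move=> d0 hA; have [lt|le] := boolP (d < 0).
  by apply: (key gr (- d)); [lia|rewrite opprK].
apply: (key (fun p => - gr p) d); first lia.
by move=> p q /hA; lia.
Qed.

Lemma has_weight_nilp (charK : [pchar K] =i pred0) v j A : v j != 0 -> has_weight v A ->
  A ^+ n = 0 /\ \det (expmx A) = 1.
Proof.
move=> vj /(has_weight_homdeg (fun k => (k == j)%:R)); apply: homdeg_nilp => //.
by rewrite (bigD1 j) //= eqxx mul1r big1 ?addr0 // => k /negbTE ->; rewrite mul0r.
Qed.

End WeightGradings.

Lemma classical_eqn_unit (K : fieldType) l n (oJ : option 'M[K]_n) b A :
  classical_data l oJ b -> classical_eqn oJ b A -> A \in unitmx /\ \det A ^+ 2 = 1.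
Proof.
move=> [_ hd] [fA dA].
suff d2 : \det A ^+ 2 = 1.
  split=> //; rewrite unitmxE unitfE; apply: contraTneq (oner_neq0 K) => d0.
  by rewrite -d2 d0 expr0n eqxx.
case: oJ hd fA => [J [uJ _ _] | [_ hb] _]; last by rewrite dA // expr1n.
move=> /(congr1 determinant); rewrite !det_mulmx det_tr => h.
have J0 : \det J != 0 by rewrite -unitfE -unitmxE.
by apply: (mulIf J0); rewrite mul1r -[RHS]h expr2 mulrAC.
Qed.

Lemma diff_at1_expz (C : fieldType) (m : int) : diff_at1 (fun z : C => z ^ m) m%:~R.
Proof.
case: m => k.
  have e := diff_at1_poly ('X^k : {poly C}); rewrite derivXn hornerMn hornerXn expr1n in e.
  by apply: (diff_at1_ext e) => z _; rewrite hornerXn.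
exists 1, k.+1; split=> [z z0|]; first by rewrite NegzE -exprnN mulVf ?expf_neq0 // hornerC.
by rewrite -polyC1 derivC horner0 hornerC mulr1 sub0r NegzE rmorphN.
Qed.

(** * Classical groups in weight coordinates *)

Section Coordinates.

Variables (C : closedFieldType) (charC : [pchar C] =i pred0) (l n : nat).
Variables (G T : 'M[C]_n -> Prop) (g h : {vspace 'M[C]_n}).
Hypothesis hg : forall A, A \in g <-> lie idfun G A.
Hypothesis hh : forall A, A \in h <-> lie idfun T A.
Variables (oJ0 : option 'M[C]_n) (b : bool).
Hypothesis data0 : classical_data l oJ0 b.
Hypothesis G_eqn : forall x, G x <-> classical_eqn oJ0 b x.
Hypothesis TG : forall x, T x -> G x.
Variables (Phi : seq (dualv h)) (Delta : 'I_l -> dualv h) (k : dualv h -> 'I_l -> int).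
Hypothesis hPhi : root_system g Phi.
Hypothesis hDelta : root_basis Phi Delta k.
Variables (H : 'I_l -> subvs_of h) (X : dualv h -> 'M[C]_n).
Hypothesis hX : chevalley_basis g Phi Delta H X.
Variables (Ti : 'I_l -> 'M[C]_n -> Prop) (t : 'I_l -> 'M[{mpoly C[1 + 1]}]_n).
Hypothesis ht : torus_parametrization T H Ti t.
Variables (S : 'M[C]_n) (e : 'I_n -> 'I_l -> int).
Hypothesis uS : S \in unitmx.
Hypothesis tS : forall (K : fieldType) (i : {rmorphism C -> K}) j (z : K), z != 0 ->
  laurent_eval i (t j) (const_mx z) =
    map_mx i S *m diag_mx (\row_p z ^ e p j) *m map_mx i (invmx S).

Definition cj (A : 'M[C]_n) : 'M[C]_n := invmx S *m A *m S.

Definition oJ := omap (fun J => S^T *m J *m S) oJ0.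

Lemma cjK A : S *m cj A *m invmx S = A.
Proof. by rewrite /cj !mulmxA mulmxV // mul1mx mulmxK. Qed.

Lemma cj_conj A : cj (S *m A *m invmx S) = A.
Proof. exact: conj_unitK. Qed.

Lemma cjM A B : cj (A *m B) = cj A *m cj B.
Proof. by rewrite /cj !mulmxA mulmxK. Qed.

Lemma cj_inj : injective cj.
Proof. by move=> A B e'; rewrite -[A]cjK e' cjK. Qed.

Lemma cj_expmx A : cj (expmx A) = expmx (cj A).
Proof. by rewrite /cj expmx_conj // mulmxV. Qed.

Lemma cj_exp A m : cj (A ^+ m) = cj A ^+ m.
Proof.
elim: m => [|m IH]; first by rewrite !expr0 /cj mulmx1 mulVmx.
by rewrite !exprS -!mulmxE cjM IH.
Qed.

Lemma cjZ c A : cj (c *: A) = c *: cj A.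
Proof. by rewrite /cj -scalemxAr -scalemxAl. Qed.

Lemma det_cj A : \det (cj A) = \det A.
Proof. by rewrite /cj !det_mulmx mulrAC -det_mulmx mulVmx // det1 mul1r. Qed.

Lemma G_cj x : G x <-> classical_eqn oJ b (cj x).
Proof. by rewrite G_eqn; symmetry; apply: classical_eqn_conj. Qed.

Lemma data : classical_data l oJ b.
Proof.
case: data0 => l0 hd; split=> //; rewrite /oJ; case: oJ0 hd => //= J [uJ sJ dim].
split=> //; first by rewrite !unitmx_mul unitmx_tr uS uJ.
by rewrite !trmx_mul trmxK -!mulmxA; case: sJ => ->; [left|right; rewrite mulNmx mulmxN].
Qed.

Lemma G_unit x : G x -> x \in unitmx.
Proof. by move=> /G_eqn/(classical_eqn_unit data0) []. Qed.

Lemma G_det x : G x -> \det x ^+ 2 = 1.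
Proof. by move=> /G_eqn/(classical_eqn_unit data0) []. Qed.

Lemma G_mul x y : G x -> G y -> G (x *m y).
Proof. by rewrite !G_eqn; apply: classical_eqn_mul. Qed.

Lemma G_inv x : G x -> G (invmx x).
Proof. by move=> Gx; apply/G_eqn/classical_eqn_inv; [apply: G_unit|apply/G_eqn]. Qed.

Lemma tmap_diag (K : fieldType) (i : {rmorphism C -> K}) (z : 'rV[K]_l) : Gm z ->
  tmap i t z = map_mx i S *m weight_mx e z *m map_mx i (invmx S).
Proof.
move=> gz; rewrite /tmap /weight_mx.
have uSi : map_mx i S \in unitmx by rewrite map_unitmx.
rewrite map_invmx; set Q := map_mx i S in uSi *.
have key (r : seq 'I_l) : \prod_(j <- r) laurent_eval i (t j) (const_mx (z 0 j)) =
    Q *m diag_mx (\row_p \prod_(j <- r) z 0 j ^ e p j) *m invmx Q.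
  elim: r => [|j r IH].
    rewrite big_nil (_ : \row_p _ = const_mx 1) ?diag_const_mx ?mulmx1 ?mulmxV //.
    by apply/rowP => p; rewrite !mxE big_nil.
  rewrite big_cons IH tS // map_invmx -/Q -[_ * _]/(_ *m _).
  rewrite !mulmxA mulmxKV // -(mulmxA Q) mulmx_diag; congr (_ *m diag_mx _ *m _).
  by apply/rowP => p; rewrite !mxE big_cons.
exact: key.
Qed.

Lemma weight_mx1 (K : fieldType) : weight_mx e (const_mx 1 : 'rV[K]_l) = 1%:M.
Proof.
apply/matrixP => p q; rewrite !mxE big1 // => j _; by rewrite mxE exp1rz.
Qed.

Lemma tmapE (z : 'rV[C]_l) : Gm z -> tmap idfun t z = S *m weight_mx e z *m invmx S.
Proof. by move=> gz; rewrite tmap_diag // !map_mxid. Qed.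

Lemma tor_eqn (z : 'rV[C]_l) : Gm z -> classical_eqn oJ b (weight_mx e z).
Proof.
move=> gz; have [_ _ _ [_ _ _ hE _]] := ht.
have /TG/G_cj : T (tmap idfun t z) by apply/hE; exists z.
by rewrite tmapE // cj_conj.
Qed.

Lemma tor_inj (z : 'rV[C]_l) : Gm z -> weight_mx e z = 1%:M -> forall j, z 0 j = 1.
Proof.
move=> gz z1 j; have [_ _ _ [_ _ _ _ [q [m hq]]]] := ht.
have g1 : Gm (const_mx 1 : 'rV[C]_l) by move=> j'; rewrite mxE oner_neq0.
by rewrite (hq z gz) tmapE // z1 -weight_mx1 -tmapE // -(hq _ g1) mxE.
Qed.

(** An off-diagonal entry is a linear function that vanishes on the diagonalized torus, so it
    vanishes on its Lie algebra. *)
Lemma h_diag A : A \in h -> is_diag_mx (cj A).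
Proof.
move=> /hh lA; apply/is_diag_mxP => p q pq.
have := lie_conj (S' := fun M => is_diag_mx M) (mulVmx uS) _ lA.
move=> /(_ _ 'X_(mxvec_index p q)) h'.
have {h'} : dirder idfun 'X_(mxvec_index p q) 1%:M (cj A) = 0.
  apply: h' => [x Tx|x /is_diag_mxP dx]; last first.
    by rewrite (mxevalX (idfun : {rmorphism C -> C})) mxvecE dx.
  have [_ _ _ [_ _ _ hE _]] := ht; have [z gz ->] := (hE x).1 Tx.
  by rewrite tmapE // -/(cj _) cj_conj diag_mx_is_diag.
by rewrite (dirderX (idfun : {rmorphism C -> C})) mxvecE.
Qed.

Lemma h_abel (A B : subvs_of h) : bracket (vsval A) (vsval B) = 0.
Proof.
apply: cj_inj; rewrite /bracket.
have -> : cj 0 = 0 by rewrite /cj mulmx0 mul0mx.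
have := h_diag (subvsP A); have := h_diag (subvsP B).
move=> /diag_mxP [u eB] /diag_mxP [v eA].
have -> : cj (vsval A *m vsval B - vsval B *m vsval A) =
    cj (vsval A) *m cj (vsval B) - cj (vsval B) *m cj (vsval A).
  by rewrite -!cjM /cj mulmxBr mulmxBl.
by rewrite eA eB diag_mxC subrr.
Qed.

Lemma h_sub (A : subvs_of h) : vsval A \in g.
Proof. by apply/hg; apply: (lie_subset TG); apply/hh/subvsP. Qed.

Lemma adG x A : G x -> A \in g -> x *m A *m invmx x \in g.
Proof.
move=> Gx /hg lA; apply/hg; have ux := G_unit Gx.
apply: (lie_conj (mulmxV ux)) lA => y Gy.
by apply: G_mul; [apply: G_mul|apply: G_inv].
Qed.

(** The velocity of [t j] at 1 is diagonal with the exponents as entries, and it is a multiple of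
    [H j] by the hypothesis on the Lie algebra of [Ti j]. The factor is nonzero, for otherwise all
    exponents would vanish and [t j] would take the same value at 1 and at 2. *)
Lemma H_curve j : exists2 c : C, c != 0 & forall p, (e p j)%:~R = c * cj (vsval (H j)) p p.
Proof.
have [_ hTi lieTi _] := ht; have [_ _ _ hE [q [m hq]]] := hTi j.
pose M (z : C) : 'M[C]_n := S *m diag_mx (\row_p z ^ e p j) *m invmx S.
have fM z : z != 0 -> laurent_eval idfun (t j) (const_mx z) = M z.
  by move=> z0; rewrite tS // !map_mxid.
have dM : diff_mx M (S *m diag_mx (\row_p (e p j)%:~R) *m invmx S).
  have d : diff_mx (fun z : C => diag_mx (\row_p z ^ e p j)) (diag_mx (\row_p (e p j)%:~R)).
    move=> r s; rewrite !mxE; case: eqVneq => [->|rs].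
      rewrite mulr1n; apply: (diff_at1_ext (diff_at1_expz C (e s j))) => z _.
      by rewrite !mxE eqxx.
    rewrite mulr0n; apply: (diff_at1_ext (diff_at1_const 0)) => z _.
    by rewrite !mxE (negbTE rs).
  have dl := diff_mxM (diff_mxM (diff_mx_const S) d) (diff_mx_const (invmx S)).
  by rewrite mul0mx add0r mulmx0 addr0 in dl.
have G1 (z : C) : z != 0 -> Gm (const_mx z : 'rV[C]_1) by move=> z0 k'; rewrite mxE.
have /lieTi [c ec] : lie idfun (Ti j) (S *m diag_mx (\row_p (e p j)%:~R) *m invmx S).
  apply: (lie_curve charC dM) => [|z z0].
    rewrite /M (_ : \row_p _ = const_mx 1) ?diag_const_mx ?mulmx1 ?mulmxV //.
    by apply/rowP => p; rewrite !mxE exp1rz.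
  by apply/hE; exists (const_mx z); [apply: G1|rewrite fM].
have ce p : (e p j)%:~R = c * cj (vsval (H j)) p p.
  have := congr1 (fun A => cj A p p) ec; rewrite cj_conj cjZ !mxE eqxx mulr1n => ->.
  by rewrite /cj.
exists c => //; apply/eqP => c0.
have M1 z : M z = M 1.
  rewrite /M (_ : \row_p z ^ _ = \row_p 1 ^ e p j) //; apply/rowP => p; rewrite !mxE.
  have -> : e p j = 0 by apply: (intf_inj charC); rewrite ce c0 mul0r.
  by rewrite !expr0z.
have two : (2%:R : C) != 0 by apply: two_neq0.
have := hq (const_mx 2%:R) (G1 _ two) ord0; rewrite fM // M1 -fM ?oner_neq0 //.
rewrite -hq; last exact: G1 (oner_neq0 C).
rewrite !mxE => /(natf_inj charC (x1 := 2) (x2 := 1)) //.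
Qed.

Let basisX := let: And5 x _ _ _ _ := hX in x.
Let rootX : forall a, a \in Phi -> root_space g a (X a) := let: And5 _ _ r _ _ := hX in r.

Lemma e_indep (u : 'I_l -> C) : (forall p, \sum_j u j * (e p j)%:~R = 0) -> forall j, u j = 0.
Proof.
move=> hu j.
have [c c0] := fin_all_exists2 H_curve => hc.
have : \sum_j (u j * c j) *: vsval (H j) = 0.
  apply: cj_inj; have -> : cj 0 = 0 by rewrite /cj mulmx0 mul0mx.
  have -> : cj (\sum_j (u j * c j) *: vsval (H j)) = \sum_j (u j * c j) *: cj (vsval (H j)).
    by rewrite {1}/cj mulmx_sumr mulmx_suml; apply: eq_bigr => j' _; rewrite -cjZ.
  apply/matrixP => p q; rewrite summxE [RHS]mxE; have [->|pq] := eqVneq p q; last first.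
    rewrite big1 // => j' _; rewrite mxE (is_diag_mxP (h_diag (subvsP (H j'))) p q pq) mulr0 //.
  rewrite -[RHS](hu q); apply: eq_bigr => j' _.
  by rewrite mxE hc mulrA.
move/(H_indep hPhi basisX)/(_ j)/eqP; rewrite mulf_eq0 (negbTE (c0 j)) orbF => /eqP //.
Qed.

Lemma root_space_entries (a : dualv h) A p q j c :
  (forall r, (e r j)%:~R = c * cj (vsval (H j)) r r) ->
  root_space g a A -> cj A p q != 0 -> (e p j - e q j)%:~R = c * a (H j).
Proof.
move=> hc [_ /(_ (H j))] /(congr1 cj); rewrite cjZ /bracket.
have -> : cj (vsval (H j) *m A - A *m vsval (H j)) =
    cj (vsval (H j)) *m cj A - cj A *m cj (vsval (H j)) by rewrite -!cjM /cj mulmxBr mulmxBl.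
have /diag_mxP [d eH] := h_diag (subvsP (H j)).
move=> h1 nz; have := congr1 (fun M : 'M_n => M p q) h1.
rewrite eH; move: (cj A) nz => A' nz; rewrite mul_diag_mx mul_mx_diag !mxE [_ * d 0 q]mulrC -mulrBl.
have {h1} e1 (x : C) : (d 0 p - d 0 q) * A' p q = x * A' p q -> d 0 p - d 0 q = x := fun e => mulIf nz e.
move=> /e1 <-; rewrite rmorphB /= !hc eH !mxE !eqxx !mulr1n mulrBr //.
Qed.

(** The exponents of the character of the torus that belongs to [a], integers in contrast to the
    values of [a]. By [cjX_weight] every nonzero entry of the root vector gives the same
    exponents. *)
Definition wt (a : dualv h) (j : 'I_l) : int :=
  if [pick pq : 'I_n * 'I_n | cj (X a) pq.1 pq.2 != 0] is Some pq then e pq.1 j - e pq.2 j else 0.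

Lemma wt_cast (c : 'I_l -> C) : (forall j p, (e p j)%:~R = c j * cj (vsval (H j)) p p) ->
  forall a, a \in Phi -> forall j, (wt a j)%:~R = c j * a (H j).
Proof.
move=> hc a aP j; rewrite /wt; case: pickP => [[p q] /= nz|no].
  exact: (root_space_entries (hc j) (rootX aP) nz).
have := rootX_neq0 hPhi basisX aP; rewrite -(inj_eq cj_inj).
case/eqP; rewrite {2}/cj mulmx0 mul0mx; apply/matrixP => p q; rewrite [RHS]mxE.
by have := no (p, q) => /negbFE/eqP.
Qed.

Lemma cjX_weight a : a \in Phi -> has_weight e (wt a) (cj (X a)).
Proof.
move=> aP p q nz j; have [c c0 hc] := fin_all_exists2 H_curve.
by apply: (intf_inj charC); rewrite (root_space_entries (hc j) (rootX aP) nz) (wt_cast hc).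
Qed.

Lemma cjX_neq0 a : a \in Phi -> cj (X a) != 0.
Proof.
move=> aP; have := rootX_neq0 hPhi basisX aP; apply: contraNneq => e0.
by rewrite -[X a]cjK e0 mulmx0 mul0mx.
Qed.

Lemma wt_neq0 a : a \in Phi -> exists j, wt a j != 0.
Proof.
move=> aP; apply: NNPP => hn; have /eqP := root_neq0 hPhi aP; apply.
have [c c0 hc] := fin_all_exists2 H_curve.
apply: (dual_ext hPhi basisX rootX h_abel h_sub) => j; rewrite [RHS]lfunE /=.
apply: (mulfI (c0 j)); rewrite mulr0 -(wt_cast hc) //.
have -> // : wt a j = 0.
by apply/eqP; apply: NNPP => hj; apply: hn; exists j; apply/negP.
Qed.

Lemma nilX_det a : a \in Phi -> X a ^+ n = 0 /\ forall c, \det (expmx (c *: X a)) = 1.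
Proof.
move=> aP; have [j aj] := wt_neq0 aP; have wa := cjX_weight aP; split.
  apply: cj_inj; rewrite cj_exp (has_weight_nilp charC aj wa).1.
  by rewrite /cj mulmx0 mul0mx.
move=> c; rewrite -det_cj cj_expmx cjZ.
exact: (has_weight_nilp charC aj (has_weightZ (c := c) wa)).2.
Qed.

Lemma nilX a : a \in Phi -> X a ^+ n = 0. Proof. by case/nilX_det. Qed.

Lemma form_lieZ (K : fieldType) oJ' c (A : 'M[K]_n) : form_lie oJ' A -> form_lie oJ' (c *: A).
Proof.
by case: oJ' => //= J hA; rewrite linearZ /= -scalemxAl -scalemxAr -scalerDr hA scaler0.
Qed.

Lemma expX a c : a \in Phi -> G (expmx (c *: X a)).
Proof.
move=> aP; apply/G_eqn; apply: (expmx_classical charC).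
- by rewrite expmxZ nilX // scaler0.
- by case/nilX_det: aP.
apply: form_lieZ; apply: (lie_form charC (G := G) (b := b)); first by move=> x /G_eqn.
by apply/hg; case: (rootX aP).
Qed.

Lemma brX a B : a \in Phi -> B \in g -> bracket (X a) B \in g.
Proof.
move=> aP /hg lB; apply/hg; apply: (lie_bracket_nilp charC) lB; first exact: nilX.
  by move=> c; apply: expX.
by move=> x D Gx /hg Dg; apply/hg; apply: adG.
Qed.

Lemma diag_functional p q : exists a : dualv h, forall B : subvs_of h,
  (a B : C) = cj (vsval B) p p - cj (vsval B) q q.
Proof.
pose f (B : subvs_of h) : C^o := cj (vsval B) p p - cj (vsval B) q q.
have fl : linear f.
  move=> c A B; rewrite /f linearP /=.
  have -> : cj (c *: vsval A + vsval B) = c *: cj (vsval A) + cj (vsval B).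
    by rewrite -cjZ /cj mulmxDr mulmxDl.
  move: (cj (vsval A)) (cj (vsval B)) => M N; rewrite !mxE -[c *: (_ : C^o)]/(c * _).
  by move: (M p p) (M q q) (N p p) (N q q) => x y x' y'; ring.
pose fL : {linear subvs_of h -> C^o} := HB.pack f (GRing.isLinear.Build _ _ _ _ f fl).
by exists (linfun fL) => B; rewrite lfunE.
Qed.

(** The Lie algebra is not computed: a matrix of nonzero weight is nilpotent, so the linearized
    equations put its exponentials in [G] and the matrix in [g]. Being a weight vector, it then lies
    in a root space, which is a line. *)
Lemma root_of_weight v j (B : 'M[C]_n) : v j != 0 -> has_weight e v B -> form_lie oJ B ->
  B != 0 -> exists a c, [/\ a \in Phi, B = c *: cj (X a) & wt a =1 v].
Proof.
move=> vj wB fB B0; have nB := has_weight_nilp charC vj wB.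
pose A := S *m B *m invmx S.
have nA : A ^+ n = 0 by apply: cj_inj; rewrite cj_exp cj_conj nB.1 /cj mulmx0 mul0mx.
have Ag : A \in g.
  apply/hg; apply: (lie_expmx charC) => // c; apply/G_cj.
  rewrite cj_expmx cjZ cj_conj; apply: (expmx_classical charC).
  - by rewrite expmxZ nB.1 scaler0.
  - exact: (has_weight_nilp charC vj (has_weightZ (c := c) wB)).2.
  - exact: form_lieZ.
have [p [q nz]] : exists p q, B p q != 0.
  apply: NNPP => hn; case/eqP: B0; apply/matrixP => p q; rewrite mxE; apply/eqP.
  by apply: NNPP => h'; apply: hn; exists p, q; apply/negP.
have [a ha] := diag_functional p q; have [c c0 hc] := fin_all_exists2 H_curve.
have aH j' : (v j')%:~R = c j' * a (H j').
  by rewrite ha mulrBr -!hc -rmorphB /= (wB p q nz).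
have a0 : a != 0.
  apply: contraNneq vj => a0; rewrite -(intf_eq0 charC) aH a0 lfunE /= mulr0 //.
have rsA : root_space g a A.
  split=> // D; apply: cj_inj; rewrite cjZ /bracket.
  have -> : cj (vsval D *m A - A *m vsval D) = cj (vsval D) *m cj A - cj A *m cj (vsval D).
    by rewrite -!cjM /cj mulmxBr mulmxBl.
  rewrite cj_conj; have /diag_mxP [d eD] := h_diag (subvsP D).
  rewrite eD mul_diag_mx mul_mx_diag; apply/matrixP => r s; rewrite !mxE.
  have [->|nrs] := eqVneq (B r s) 0; first by rewrite !(mulr0, mul0r) subrr.
  rewrite [_ * d 0 s]mulrC -mulrBl; congr (_ * _).
  have [u eu] := h_span hPhi basisX rootX h_abel h_sub D.
  (* The diagonal entries of an element of [h] are one fixed linear combination of the exponents, so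
     their difference at [r], [s] depends on [v] only. *)
  have dE x : d 0 x = \sum_j' u j' / c j' * (e x j')%:~R.
    have -> : d 0 x = cj (vsval D) x x by rewrite eD !mxE eqxx.
    rewrite eu {1}/cj mulmx_sumr mulmx_suml summxE; apply: eq_bigr => j' _.
    by rewrite -/(cj _) cjZ mxE hc mulrA divfK.
  rewrite ha eD !mxE !eqxx !mulr1n !dE -!sumrB; apply: eq_bigr => j' _.
  by rewrite -!mulrBr -!rmorphB /= (wB _ _ nrs) (wB _ _ nz).
have A0 : A != 0.
  by apply: contraNneq B0 => A0; rewrite -[B]cj_conj -/A A0 /cj mulmx0 mul0mx.
have [aP [c' eA]] := root_space_line hPhi basisX rootX h_abel a0 rsA A0.
exists a, c'; split=> //; first by rewrite -cjZ -eA cj_conj.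
move=> j'; apply: (intf_inj charC); by rewrite (wt_cast hc) // aH.
Qed.

Lemma J_graded J p q : oJ = Some J -> J p q != 0 -> forall j, e p j + e q j = 0.
Proof. exact: (form_graded charC tor_eqn). Qed.

Lemma J_unit J : oJ = Some J -> J \in unitmx /\ (J^T = J \/ J^T = - J).
Proof. by move=> eJ; case: data; rewrite eJ => _ []. Qed.

Lemma invJ_graded J p q : oJ = Some J -> invmx J p q != 0 -> forall j, e p j + e q j = 0.
Proof.
move=> eJ nz; have [uJ _] := J_unit eJ.
have eqV (z : 'rV[C]_l) : Gm z -> classical_eqn (Some (invmx J)) false (weight_mx e z).
  move=> gz; split=> //; have [+ _] := tor_eqn gz; rewrite eJ tr_diag_mx => hD.
  set D := diag_mx _ in hD *.
  have h1 : (D *m J) *m (D *m invmx J) = 1%:M by rewrite mulmxA hD mulmxV.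
  by rewrite /weight_mx -/D -[LHS](mulmxK uJ) -(mulmxA (D *m invmx J)) (mulmx1C h1) mul1mx.
exact: (form_graded charC eqV (erefl _) nz).
Qed.

(** In the presence of a form, the matrix unit minus its [star]: the projection of the matrix unit,
    up to the factor 2, to the solutions of the linearized equations. It still has a single weight,
    as [J] pairs opposite weights. *)
Definition root_mx p q : 'M[C]_n := if oJ is Some J then
  delta_mx p q - invmx J *m delta_mx q p *m J else delta_mx p q.

Lemma root_mx_weight p q : has_weight e (fun j => e p j - e q j) (root_mx p q).
Proof.
rewrite /root_mx; case eJ: oJ => [J|] r s; last first.
  rewrite mxE; case: (boolP ((r == p) && (s == q))) => [/andP [/eqP -> /eqP ->] //|_].
  by rewrite eqxx.
rewrite !mxE; case: (boolP ((r == p) && (s == q))) => [/andP [/eqP -> /eqP ->] //|_].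
rewrite mulr0n sub0r oppr_eq0 (bigD1 p) //= big1 ?addr0 => [|x xp]; last first.
  rewrite mxE (bigD1 q) //= big1 ?addr0 => [|y yq]; rewrite mxE ?(negbTE xp) ?(negbTE yq) ?andbF ?mulr0 ?mul0r //.
rewrite mxE (bigD1 q) //= big1 ?addr0 => [|y yq]; last by rewrite mxE (negbTE yq) mulr0.
rewrite mxE !eqxx mulr1 mulf_eq0 negb_or => /andP [n1 n2] j.
by have := invJ_graded eJ n1 j; have := J_graded eJ n2 j; lia.
Qed.

Lemma root_mx_lie p q : form_lie oJ (root_mx p q).
Proof.
rewrite /root_mx; case eJ: oJ => [J|] //=; have [uJ sJ] := J_unit eJ.
rewrite linearB /= !trmx_mul trmx_inv !trmx_delta mulmxBl mulmxBr !mulmxA mulmxV // mul1mx.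
case: sJ => ->; first by rewrite mulmxKV // addrA subrK subrr.
have JN : (- J) *m (- invmx J) = 1%:M by rewrite mulNmx mulmxN opprK mulmxV.
have -> : invmx (- J) = - invmx J by rewrite -[LHS]mulmx1 -JN mulKmx //; case: (mulmx1_unit JN).
rewrite !(mulNmx, mulmxN) opprK mulmxKV //.
by rewrite addrA subrK subrr.
Qed.

Definition wdeg (r : 'I_l -> int) (a : dualv h) : int := \sum_j r j * wt a j.

Lemma cjX_homdeg r a : a \in Phi -> homdeg (wgr e r) (wdeg r a) (cj (X a)).
Proof. by move=> aP; apply: has_weight_homdeg; apply: cjX_weight. Qed.

(** [A] is rebuilt from the matrices [root_mx p q], which are defined over [C] and are multiples of
    root vectors whenever [A p q] is nonzero. With a form, [A] equals minus its [star], so the sum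
    counts it twice; this is the origin of the factor one half. *)
Lemma root_expansion (K : fieldType) (i : {rmorphism C -> K}) r d (A : 'M[K]_n) :
  d != 0 -> form_lie (omap (map_mx i) oJ) A -> homdeg (wgr e r) d A ->
  exists v : dualv h -> K, A = \sum_(a <- Phi | wdeg r a == d) v a *: map_mx i (cj (X a)).
Proof.
move=> d0 fA hA.
pose P (B : 'M[K]_n) := exists v : dualv h -> K,
  B = \sum_(a <- Phi | wdeg r a == d) v a *: map_mx i (cj (X a)).
have P0 : P 0 by exists (fun=> 0); rewrite big1 // => a _; rewrite scale0r.
have PD B B' : P B -> P B' -> P (B + B').
  move=> [v ->] [v' ->]; exists (fun a => v a + v' a); rewrite -big_split.
  by apply: eq_bigr => a _; rewrite scalerDl.
have PZ c B : P B -> P (c *: B).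
  move=> [v ->]; exists (fun a => c * v a); rewrite scaler_sumr.
  by apply: eq_bigr => a _; rewrite scalerA.
have Proot p q : A p q != 0 -> P (map_mx i (root_mx p q)).
  move=> nz; have [->|B0] := eqVneq (root_mx p q) 0; first by rewrite map_mx0.
  have [j ej] : exists j, e p j - e q j != 0.
    apply: NNPP => hn; case/eqP: d0; rewrite -(hA p q nz) /wgr -sumrB big1 // => j _.
    rewrite -mulrBr; apply/eqP; rewrite mulf_eq0; apply/orP; right.
    by apply: contraT => h'; case: hn; exists j.
  have [a [c [aP eB ea]]] := root_of_weight ej (@root_mx_weight p q) (root_mx_lie p q) B0.
  have da : wdeg r a = d.
    rewrite -(hA p q nz) /wdeg /wgr -sumrB; apply: eq_bigr => j' _.
    by rewrite ea mulrBr.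
  exists (fun a' => if a' == a then i c else 0).
  rewrite big_mkcond (bigD1_seq a) ?(root_uniq hPhi) //= da !eqxx big1 ?addr0 ?eB ?map_mxZ //.
  by move=> a' /negbTE ->; rewrite scale0r; case: ifP.
suff eA : exists c : K, A = c *: \sum_p \sum_q A p q *: map_mx i (root_mx p q).
  have [c ->] := eA; apply: (PZ); apply: big_ind => // p _; apply: big_ind => // q _.
  have [->|nz] := eqVneq (A p q) 0; first by rewrite scale0r.
  by apply: PZ; apply: Proot.
rewrite /root_mx; case eJ: oJ fA => [J|] /= fA; last first.
  exists 1; rewrite scale1r {1}[A]matrix_sum_delta.
  by apply: eq_bigr => p _; apply: eq_bigr => q _; rewrite map_delta_mx.
have [uJ _] := J_unit eJ; set J' := map_mx i J in fA *.
have uJ' : J' \in unitmx by rewrite map_unitmx.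
have two : (2%:R : K) != 0 by rewrite -(rmorph_nat i) fmorph_eq0; apply: two_neq0.
exists 2%:R^-1; apply: (scalerI two); rewrite scalerA divff // scale1r.
have -> : \sum_p \sum_q A p q *: map_mx i (delta_mx p q - invmx J *m delta_mx q p *m J)
    = A - invmx J' *m A^T *m J'.
  rewrite {3}[A]matrix_sum_delta {2}[A]matrix_sum_delta.
  rewrite raddf_sum mulmx_sumr mulmx_suml -sumrB; apply: eq_bigr => p _.
  rewrite raddf_sum mulmx_sumr mulmx_suml -sumrB; apply: eq_bigr => q _.
  rewrite /= linearZ /= trmx_delta -scalemxAr -scalemxAl -scalerBr; congr (_ *: _).
  by rewrite map_mxB !map_mxM map_invmx !map_delta_mx.
have -> : invmx J' *m A^T *m J' = - A.
  by rewrite -mulmxA (eqP (_ : A^T *m J' == - (J' *m A))) ?mulmxN ?mulKmx // -addr_eq0 fA.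
by rewrite opprK scaler_nat mulr2n.
Qed.

Lemma wt_simple a : a \in Phi -> forall j, wt a j = \sum_i k a i * wt (Delta i) j.
Proof.
move=> aP j; have [c c0 hc] := fin_all_exists2 H_curve; apply: (intf_inj charC).
have DP i : Delta i \in Phi by case: hDelta.
rewrite (wt_cast hc) // {1}(root_coef hDelta aP) rmorph_sum sum_lfunE mulr_sumr.
apply: eq_bigr => i _; rewrite rmorphM /= (wt_cast hc) // -scaler_int lfunE /=.
by rewrite -[_ *: _]/(_ * _) mulrCA.
Qed.

(** A functional with the same value on all simple roots is wanted. The matrix of their weights is
    integral and invertible over [C]; its adjugate gives an integral solution with the value
    [\det N], and the sign of the determinant makes that value positive. *)
Lemma height_functional : exists r d, 0 < d /\ forall a, a \in Phi -> wdeg r a = d * height k a.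
Proof.
have [c c0 hc] := fin_all_exists2 H_curve.
have DP i : Delta i \in Phi by case: hDelta.
pose N : 'M[int]_l := \matrix_(i, j) wt (Delta i) j.
have uN : map_mx (intr : int -> C) N \in unitmx.
  rewrite -row_free_unit; apply: inj_row_free => v hv.
  have : \sum_i v 0 i *: Delta i = 0.
    apply: (dual_ext hPhi basisX rootX h_abel h_sub) => j; rewrite [RHS]lfunE sum_lfunE /=.
    apply: (mulfI (c0 j)); rewrite mulr0 mulr_sumr.
    have := congr1 (fun M : 'rV_l => M 0 j) hv; rewrite !mxE => e0; rewrite -[RHS]e0.
    apply: eq_bigr => i _; rewrite !mxE (wt_cast hc) // lfunE /=.
    by rewrite -[_ *: _]/(_ * _) mulrCA.
  by move/(Delta_indep hDelta) => v0; apply/rowP => i; rewrite v0 mxE.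
have dN : \det N != 0.
  move: uN; rewrite unitmxE unitfE det_map_mx /=; apply: contraNneq => ->; by rewrite rmorph0.
exists (fun j => Num.sg (\det N) * \sum_i \adj N j i), `|\det N|; split; first by rewrite normr_gt0.
move=> a aP; rewrite /wdeg; under eq_bigr => j _ do rewrite wt_simple // mulr_sumr.
rewrite exchange_big mulr_sumr; apply: eq_bigr => i _ /=.
have key : \sum_j wt (Delta i) j * \sum_i' \adj N j i' = \det N.
  under eq_bigr => j _ do rewrite mulr_sumr.
  rewrite exchange_big /=.
  transitivity (\sum_i' ((\det N)%:M : 'M_l) i i').
    rewrite -mul_mx_adj; apply: eq_bigr => i' _; rewrite mxE.
    by apply: eq_bigr => j _; rewrite [N i j]mxE.
  rewrite (bigD1 i) //= mxE eqxx mulr1n big1 ?addr0 // => i'.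
  by rewrite eq_sym mxE => /negbTE ->.
rewrite normrEsg -{3}key mulr_sumr mulr_suml; apply: eq_bigr => j _.
by move: (\sum_(_ <- _) _) (Num.sg _) => x y; ring.
Qed.

Lemma weights_dist p q : (forall j, e p j = e q j) -> p = q.
Proof.
by have [f hf] := half_exists e_indep; apply: (weights_distinct charC data tor_eqn hf).
Qed.

(** The coefficients are powers of a natural number [s]. The difference of two weights is then the
    value at [s] of a nonzero polynomial, and in characteristic zero some [s] avoids the roots of
    the product of these finitely many polynomials. *)
Lemma separating_functional : exists r, injective (wgr e r).
Proof.
pose P p q : {poly C} := \sum_(j < l) (e p j - e q j)%:~R *: 'X^j.
have P0 p q : p != q -> P p q != 0.
  move=> pq; apply/eqP => e0; case/eqP: pq; apply: weights_dist => j.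
  have := congr1 (fun u : {poly C} => u`_j) e0; rewrite coef0 coef_sum (bigD1 j) //=.
  rewrite coefZ coefXn eqxx mulr1 big1 ?addr0 => [|j' j'j]; last first.
    by rewrite coefZ coefXn val_eqE eq_sym (negbTE j'j) mulr0.
  by move/eqP; rewrite intf_eq0 // subr_eq0 => /eqP.
pose Q := \prod_(pq : 'I_n * 'I_n | pq.1 != pq.2) P pq.1 pq.2.
have Q0 : Q != 0 by apply/prodf_neq0 => -[p q] /=; apply: P0.
have [s hs] : exists s : nat, Q.[s%:R] != 0.
  apply: NNPP => hn; have := max_poly_roots Q0 (rs := [seq s%:R | s <- iota 0 (size Q)]).
  rewrite size_map size_iota ltnn => h'; apply: notF; apply: h'.
    apply/allP => _ /mapP [s _ ->]; apply/rootP/eqP; apply: contraT => h'.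
    by case: hn; exists s.
  by rewrite map_inj_uniq ?iota_uniq //; apply: natf_inj.
exists (fun j => (s ^ j)%N%:Z) => p q e'; apply/eqP; apply: contraT => pq.
move: hs; rewrite horner_prod (bigD1 (p, q)) //= mulf_eq0 negb_or => /andP [/eqP []].
rewrite horner_sum -[RHS](rmorph0 (intr : {rmorphism int -> C})).
have -> : 0 = wgr e (fun j => (s ^ j)%N%:Z) p - wgr e (fun j => (s ^ j)%N%:Z) q by rewrite e' subrr.
rewrite /wgr -sumrB rmorph_sum; apply: eq_bigr => j _.
by rewrite hornerZ hornerXn -mulrBr rmorphM /= mulrC -natrX.
Qed.

(** The height functional is multiplied by [B + 1], where [B] bounds all differences of values of
    the separating functional. The sum of both has the sign of the height on the roots and separates
    the indices where the height functional does not. *)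
Lemma generic_functional : exists r, injective (wgr e r) /\
  forall a, a \in Phi -> (0 < height k a -> 0 < wdeg r a) /\ (height k a < 0 -> wdeg r a < 0).
Proof.
have [r0 [d [d0 hd]]] := height_functional; have [r1 inj1] := separating_functional.
pose B := \sum_p \sum_q `|wgr e r1 p - wgr e r1 q|.
have leB p q : `|wgr e r1 p - wgr e r1 q| <= B.
  rewrite /B (bigD1 p) //= (bigD1 q) //= -addrA lerDl addr_ge0 ?sumr_ge0 // => p' _.
  by rewrite sumr_ge0.
have B0 : 0 <= B by apply: sumr_ge0 => p _; apply: sumr_ge0.
pose r j := (B + 1) * r0 j + r1 j.
have wgrE p : wgr e r p = (B + 1) * wgr e r0 p + wgr e r1 p.
  by rewrite /wgr mulr_sumr -big_split; apply: eq_bigr => j _; rewrite mulrDl mulrA.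
have wdegE a : wdeg r a = (B + 1) * wdeg r0 a + wdeg r1 a.
  by rewrite /wdeg mulr_sumr -big_split; apply: eq_bigr => j _; rewrite mulrDl mulrA.
have wdegB a : a \in Phi -> `|wdeg r1 a| <= B.
  move=> aP; have [p [q nz]] : exists p q, cj (X a) p q != 0.
    apply: NNPP => hn; have /eqP := cjX_neq0 aP; apply; apply/matrixP => p q.
    rewrite [RHS]mxE; apply/eqP; apply: contraT => nz; case: hn; by exists p, q.
  by rewrite -(@cjX_homdeg r1 a aP p q nz).
exists r; split=> [p q|a aP].
  rewrite !wgrE => e'; apply: inj1; have := leB p q; have := leB q p.
  have [lt|lt|] := ltgtP (wgr e r0 p) (wgr e r0 q); last by move=> e0 _ _; move: e'; rewrite e0 => /addrI.
    have : (B + 1) * 1 <= (B + 1) * (wgr e r0 q - wgr e r0 p) by apply: ler_wpM2l; lia.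
    rewrite mulrBr; lia.
  have : (B + 1) * 1 <= (B + 1) * (wgr e r0 p - wgr e r0 q) by apply: ler_wpM2l; lia.
  rewrite mulrBr; lia.
have := wdegB a aP; rewrite wdegE hd //; split=> h0.
  have : (B + 1) * 1 <= (B + 1) * (d * height k a).
    by apply: ler_wpM2l; [lia|have := mulr_gt0 d0 h0; lia].
  lia.
have : (B + 1) * 1 <= (B + 1) * - (d * height k a).
  by apply: ler_wpM2l; [lia|have : d * height k a < 0 by rewrite pmulr_rlt0]; lia.
rewrite mulrN; lia.
Qed.

Lemma height_sign a : a \in Phi -> (pos k a = (0 < height k a)) * (negative_root k a = (height k a < 0)).
Proof.
move=> aP; have kn : exists i, k a i != 0.
  apply: NNPP => hn; have /eqP := root_neq0 hPhi aP; apply.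
  rewrite (root_coef hDelta aP) big1 // => i _; have -> : k a i = 0; last by rewrite mulr0z.
  by apply/eqP; apply: contraT => h'; case: hn; exists i.
have [i0 ki] := kn.
have sgn : pos k a -> 0 < height k a.
  move=> /forallP p; rewrite /height (bigD1 i0) //=.
  have : 0 <= \sum_(i | i != i0) k a i by apply: sumr_ge0 => i _.
  by move: (\sum_(i | _) _) (p i0) ki => s; move: (k a i0) => u; lia.
have sgn' : negative_root k a -> height k a < 0.
  move=> /forallP p; rewrite /height (bigD1 i0) //=.
  have : \sum_(i | i != i0) k a i <= 0 by apply: sumr_le0 => i _.
  by move: (\sum_(i | _) _) (p i0) ki => s; move: (k a i0) => u; lia.
have dich : pos k a \/ negative_root k a.
  by case: hDelta => _ _ /(_ a aP) [_ [p|p]]; [left|right]; apply/forallP.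
split; apply/idP/idP; first exact: sgn.
- by case: dich => // /sgn'; lia.
- exact: sgn'.
- by case: dich => // /sgn; lia.
Qed.

Lemma height_neq0 a : a \in Phi -> height k a != 0.
Proof.
move=> aP; have [hs hs'] := height_sign aP.
case: hDelta => _ _ /(_ a aP) [_ [/forallP p|/forallP p]].
  by have := hs; rewrite /pos p; lia.
by have := hs'; rewrite /negative_root p; lia.
Qed.

(** * The representative of the longest element and points of the big cell *)

Section WeylElement.

Variables (w : dualv h -> dualv h) (nw : 'M[C]_n).
Hypothesis hw : longest Delta H w.
Hypothesis hnw : weyl_representative G T w nw.

Lemma nw_G : G nw. Proof. by case: hnw. Qed.

Lemma w_in_root a : a \in Phi -> w a \in Phi.
Proof.
exact: (w_root charC hPhi hDelta hX h_abel G_mul G_unit adG brX nilX expX hw).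
Qed.

Lemma w_in_surj a : a \in Phi -> exists2 a', a' \in Phi & w a' = a.
Proof.
exact: (w_surj charC hPhi hDelta hX h_abel G_mul G_unit adG brX nilX expX hw).
Qed.

Lemma w_sign a : a \in Phi -> (0 < height k (w a)) = (height k a < 0).
Proof.
move=> aP; have waP := w_in_root aP; have hs := height_sign aP.
rewrite -(height_sign waP).1.
rewrite (w_pos charC hPhi hDelta hX h_abel G_mul G_unit adG brX nilX expX hw) //.
by rewrite hs.1; have := height_neq0 aP; lia.
Qed.

Lemma nw_h (A : subvs_of h) : invmx nw *m vsval A *m nw \in h.
Proof.
have [Gn Tn _] := hnw; have un := G_unit Gn; apply/hh.
apply: (lie_conj (mulVmx un)) ((hh _).1 (subvsP A)) => x Tx.
by apply/Tn; rewrite !mulmxA mulmxV // mul1mx mulmxK.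
Qed.

Lemma nw_root a : a \in Phi -> exists2 d, d != 0 & nw *m X a *m invmx nw = d *: X (w a).
Proof.
move=> aP; have [Gn _ wE] := hnw; have un := G_unit Gn; have waP := w_in_root aP.
have rs : root_space g (w a) (nw *m X a *m invmx nw).
  apply: (conj_root_space G_unit adG Gn (rootX aP)) => B.
  by exists (vsproj h (invmx nw *m vsval B *m nw)); rewrite ?wE // vsprojK ?nw_h.
have nz : nw *m X a *m invmx nw != 0.
  apply: contraNneq (rootX_neq0 hPhi basisX aP) => e0.
  by rewrite -[X a](conj_unitK (X a) un) e0 mulmx0 mul0mx.
have [_ [d ed]] := root_space_line hPhi basisX rootX h_abel (root_neq0 hPhi waP) rs nz.
by exists d => //; apply: contraNneq nz => d0; rewrite ed d0 scale0r.
Qed.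

Section Points.

Variables (K : fieldType) (jj : {rmorphism C -> K}) (m : nat) (beta : m.-tuple (dualv h)).
Hypothesis hbeta : negative_root_numbering Phi k beta.

Let XK a : 'M[K]_n := map_mx jj (cj (X a)).
Let oJK := omap (map_mx jj) oJ.

Lemma pchar_ext : [pchar K] =i pred0.
Proof. by move=> p; rewrite (fmorph_pchar jj) charC. Qed.

Lemma homdeg_map gr d (A : 'M[C]_n) : homdeg gr d A -> homdeg gr d (map_mx jj A).
Proof. by move=> hA p q; rewrite mxE fmorph_eq0 => /hA. Qed.

Lemma formK_graded r r' J : oJK = Some J -> [/\ J \in unitmx,
  forall p q, J p q != 0 -> wgr e r p + wgr e r q = 0 /\ wgr e r' p + wgr e r' q = 0
  & forall p q, invmx J p q != 0 -> wgr e r p + wgr e r q = 0 /\ wgr e r' p + wgr e r' q = 0].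
Proof.
have wg r0 p q : (forall j, e p j + e q j = 0) -> wgr e r0 p + wgr e r0 q = 0.
  by move=> h0; rewrite /wgr -big_split big1 // => j _; rewrite /= -mulrDr h0 mulr0.
rewrite /oJK; case eJ: oJ => [J0|] //= [<-]; have [uJ _] := J_unit eJ.
split=> [|p q|p q]; first by rewrite map_unitmx.
  by rewrite mxE fmorph_eq0 => /(J_graded eJ) h0; split; apply: wg.
by rewrite -map_invmx mxE fmorph_eq0 => /(invJ_graded eJ) h0; split; apply: wg.
Qed.

Lemma classical_eqn_map (A : 'M[C]_n) oJ' : classical_eqn oJ' b A ->
  classical_eqn (omap (map_mx jj) oJ') b (map_mx jj A).
Proof.
move=> [fA dA]; split=> [|/dA h0]; last by rewrite det_map_mx h0 rmorph1.
by case: oJ' fA => //= J fA; rewrite map_trmx -!map_mxM fA.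
Qed.

Lemma XK_eqn a c : a \in Phi -> classical_eqn oJK b (expmx (c *: XK a)).
Proof.
move=> aP; have [j aj] := wt_neq0 aP.
have wa : has_weight e (wt a) (c *: XK a).
  by apply: has_weightZ => p q; rewrite mxE fmorph_eq0; apply: cjX_weight.
have [nX dX] := has_weight_nilp pchar_ext aj wa.
apply: (expmx_classical pchar_ext) => //; apply: form_lieZ; rewrite /oJK.
have : form_lie oJ (cj (X a)).
  apply: (lie_form charC (G := fun x => classical_eqn oJ b x) (b := b)) => //.
  have /hg Xg : X a \in g by case: (rootX aP).
  by apply: (lie_conj (mulVmx uS)) Xg => x; move/G_cj.
by case: oJ => //= J hX0; rewrite /XK map_trmx -!map_mxM -map_mxD hX0 map_mx0.
Qed.

Lemma wt_inj a a' : a \in Phi -> a' \in Phi -> wt a =1 wt a' -> a = a'.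
Proof.
move=> aP a'P eww; have [c c0 hc] := fin_all_exists2 H_curve.
apply: (dual_ext hPhi basisX rootX h_abel h_sub) => j; apply: (mulfI (c0 j)).
by rewrite -!(wt_cast hc) // eww.
Qed.

Lemma XK_supp a a' p q : a \in Phi -> a' \in Phi -> XK a p q != 0 -> XK a' p q != 0 -> a = a'.
Proof.
move=> aP a'P; rewrite ![map_mx jj _ p q]mxE !fmorph_eq0 => n1 n2; apply: wt_inj => // j.
by rewrite -(cjX_weight aP n1) (cjX_weight a'P n2).
Qed.

Lemma nwK_root a : a \in Phi -> exists2 d, d != 0 &
  map_mx jj (cj nw) *m XK a *m invmx (map_mx jj (cj nw)) = d *: XK (w a).
Proof.
move=> aP; have [d d0 hd] := nw_root aP; exists (jj d); first by rewrite fmorph_eq0.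
have un := G_unit nw_G.
have icj : invmx (cj nw) = cj (invmx nw).
  have u : cj nw \in unitmx by rewrite /cj !unitmx_mul unitmx_inv uS un.
  by rewrite -[RHS]mul1mx -(mulVmx u) -mulmxA -cjM mulmxV // /cj mulmx1 mulVmx // mulmx1.
by rewrite -map_invmx icj /XK -!map_mxM -!cjM hd cjZ map_mxZ.
Qed.

Lemma beta_in j : tnth beta j \in Phi /\ height k (tnth beta j) < 0.
Proof.
have [pb _] := hbeta; have := mem_tnth j beta; rewrite (perm_mem pb) mem_filter.
by case/andP => + bP; rewrite (height_sign bP).2.
Qed.

Lemma beta_onto a : a \in Phi -> height k a < 0 -> exists j, a = tnth beta j.
Proof.
move=> aP ha; apply/tnthP; have [pb _] := hbeta.
by rewrite (perm_mem pb) mem_filter aP (height_sign aP).2 ha.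
Qed.

Lemma beta_tnth_inj : injective (tnth beta).
Proof.
have [pb _] := hbeta; apply/tuple_uniqP.
by rewrite (perm_uniq pb) filter_uniq // (root_uniq hPhi).
Qed.

Let SK := map_mx jj S.

Lemma umapE y : umap jj X beta y = SK *m uneg XK (tnth beta) y *m invmx SK.
Proof.
have uSK : SK \in unitmx by rewrite map_unitmx.
have key s : \prod_(j <- s) expmx (y 0 j *: map_mx jj (X (tnth beta j))) =
    SK *m expprod (XK \o tnth beta) s (y 0) *m invmx SK; last first.
  by rewrite /uneg -key /umap enumT [index_enum _]unlock.
rewrite /expprod; elim: s => [|j s IH]; first by rewrite !big_nil mulmx1 mulmxV.
rewrite !big_cons IH -[_ * _]/(_ *m _) -[X in _ = _ *m X *m _]/(_ *m _) /=.
have -> : map_mx jj (X (tnth beta j)) = SK *m XK (tnth beta j) *m invmx SK.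
  by rewrite /XK /SK -map_invmx -!map_mxM cjK.
rewrite scalemxAl scalemxAr expmx_conj ?mulVmx //.
by rewrite !mulmxA mulmxKV.
Qed.

Lemma big_cell_points : exists s : 'S_n,
  (forall A, classical_eqn (omap (map_mx jj) oJ0) b A -> A \in unitmx ->
    (forall q, \det (corner q (permuted s
       (invmx SK *m (invmx (map_mx jj nw) *m A) *m SK))) != 0) ->
    exists x (z : 'rV[K]_l) y, Gm z /\
      A = umap jj X beta x *m map_mx jj nw *m tmap jj t z *m umap jj X beta y)
  /\ forall x x' (z z' : 'rV[K]_l) y y', Gm z -> Gm z' ->
      umap jj X beta x *m map_mx jj nw *m tmap jj t z *m umap jj X beta y =
      umap jj X beta x' *m map_mx jj nw *m tmap jj t z' *m umap jj X beta y' ->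
      [/\ x = x', z = z' & y = y'].
Proof.
(* [rg] orders the indices for the LDU decomposition; [rh] is proportional to the height and orders
   the roots as [beta] does. *)
have uSK : SK \in unitmx by rewrite map_unitmx.
have [rg [rg_inj hrg]] := generic_functional; have [rh [d [d0 hrh]]] := height_functional.
have [s hs] := sort_perm rg_inj.
have hhE a : a \in Phi -> ((wdeg rh a < 0) = (height k a < 0)) * ((0 < wdeg rh a) = (0 < height k a)).
  by move=> aP; rewrite hrh // pmulr_rlt0 // pmulr_rgt0.
have hgE a : a \in Phi -> (wdeg rg a < 0) = (wdeg rh a < 0) /\ (0 < wdeg rg a) = (0 < wdeg rh a).
  move=> aP; rewrite !(hhE a aP); have [h1 h2] := hrg a aP; have := height_neq0 aP.
  by case: (ltgtP (height k a) 0) h1 h2 => // _ h1 h2 _; [have := h2 isT|have := h1 isT]; lia.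
have hom r a : a \in Phi -> homdeg (wgr e r) (wdeg r a) (XK a).
  by move=> aP; apply/homdeg_map/cjX_homdeg.
have ex r d' A : d' != 0 -> form_lie oJK A -> homdeg (wgr e r) d' A ->
    exists v : dualv h -> K, A = \sum_(a <- Phi | wdeg r a == d') v a *: XK a.
  exact: root_expansion.
have [f hf] := half_exists e_indep.
have tsurj (D : 'M[K]_n) : is_diag_mx D -> D \in unitmx -> classical_eqn oJK b D ->
    exists2 z : 'rV[K]_l, Gm z & D = weight_mx e z.
  exact: (weight_surj charC data tor_eqn tor_inj hf).
have tinj (z z' : 'rV[K]_l) : Gm z -> Gm z' -> weight_mx e z = weight_mx e z' -> z = z'.
  exact: (weight_inj charC data tor_eqn tor_inj hf).
have XK0 a : a \in Phi -> XK a != 0.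
  by move=> aP; rewrite /XK map_mx_eq0 cjX_neq0.
have bneg j : wdeg rh (tnth beta j) < 0 by have [bP hb] := beta_in j; rewrite (hhE _ bP).
have ball a : a \in Phi -> wdeg rh a < 0 -> exists j, a = tnth beta j.
  by move=> aP; rewrite (hhE _ aP); apply: beta_onto.
have bsort : sorted (fun i j => wdeg rh (tnth beta j) <= wdeg rh (tnth beta i)) (enum 'I_m).
  have [_ srt] := hbeta; move: srt; rewrite -{1}(map_tnth_enum beta) sorted_map.
  apply: sub_sorted => i j /=; have [bi _] := beta_in i; have [bj _] := beta_in j.
  by rewrite !hrh // ler_pM2l.
have bP j : tnth beta j \in Phi by case: (beta_in j).
have un := G_unit nw_G; have unK : map_mx jj (cj nw) \in unitmx.
  by rewrite map_unitmx /cj !unitmx_mul unitmx_inv uS un.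
have nwE : classical_eqn oJK b (map_mx jj (cj nw)) by apply/classical_eqn_map/G_cj/nw_G.
have wopp a : a \in Phi -> (0 < wdeg rh (w a)) = (wdeg rh a < 0).
  by move=> aP; rewrite (hhE _ aP) (hhE _ (w_in_root aP)) w_sign.
have wh0 a : a \in Phi -> wdeg rh a != 0.
  by move=> aP; rewrite hrh // mulf_neq0 ?height_neq0 //; lia.
have nwcj : map_mx jj nw = SK *m map_mx jj (cj nw) *m invmx SK.
  by rewrite /SK -map_invmx -!map_mxM cjK.
have cellE x (z : 'rV[K]_l) y : Gm z ->
    umap jj X beta x *m map_mx jj nw *m tmap jj t z *m umap jj X beta y =
    SK *m (uneg XK (tnth beta) x *m map_mx jj (cj nw) *m weight_mx e z *m uneg XK (tnth beta) y) *m invmx SK.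
  move=> gz; rewrite !umapE nwcj tmap_diag // -/SK map_invmx -/SK.
  by rewrite !mulmxA !(mulmxKV uSK).
exists s; split=> [A eA uA hA|x x' z z' y y' gz gz'].
  have eA' : classical_eqn oJK b (invmx SK *m A *m SK).
    have -> : oJK = omap (fun J => SK^T *m J *m SK) (omap (map_mx jj) oJ0).
      by rewrite /oJK /oJ; case: oJ0 => //= J; rewrite !map_mxM -map_trmx.
    exact/classical_eqn_conj.
  have [|q|x [z [y [gz eA1]]]] := @big_cell_exists K pchar_ext l n m e oJK b _ Phi XK (wgr e rg) (wgr e rh)
    (wdeg rg) (wdeg rh) rg_inj (formK_graded rg rh) (root_uniq hPhi) (hom rg) (hom rh) hgE wh0 XK_eqn
    (ex rg) (ex rh) (tnth beta) beta_tnth_inj bP bneg ball bsort w (map_mx jj (cj nw)) unK nwE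
    w_in_root wopp nwK_root tsurj s (invmx SK *m A *m SK) hs eA'.
  - by rewrite !unitmx_mul unitmx_inv uSK uA.
  - have := hA q; rewrite nwcj; congr (_ != 0); congr (\det (corner q (permuted s _))).
    have h1 : map_mx jj nw *m (SK *m invmx (map_mx jj (cj nw)) *m invmx SK) = 1%:M.
      by rewrite nwcj !mulmxA (mulmxKV uSK) (mulmxK unK) mulmxV.
    have [u1 _] := mulmx1_unit h1.
    rewrite -nwcj -[invmx (map_mx jj nw)]mulmx1 -h1 (mulKmx u1) !mulmxA mulVmx // mul1mx //.
  exists x, z, y; split=> //; rewrite cellE // -eA1.
  by rewrite !mulmxA mulmxV // mul1mx mulmxK.
rewrite !cellE // => e0; apply: (@big_cell_inj K pchar_ext l n m e _ Phi XK (wgr e rg) (wgr e rh)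
    (wdeg rg) (wdeg rh) (root_uniq hPhi) (hom rg) (hom rh) hgE wh0 XK0 XK_supp (tnth beta)
    beta_tnth_inj bP bneg bsort w _ unK w_in_surj wopp nwK_root tinj) => //.
by have := congr1 (fun M => invmx SK *m M *m SK) e0; rewrite !(conj_unitK _ uSK).
Qed.

Lemma points_G_mul (A B : 'M[K]_n) : points jj G A -> points jj G B -> points jj G (A *m B).
Proof. exact: (points_mul G_unit G_mul). Qed.

(** An equation of [G] evaluated on the one-parameter group is a polynomial over [C] in the
    parameter. It vanishes at every element of [C], so it is zero and vanishes at [c] in [K]. *)
Lemma exp_points a c : a \in Phi -> points jj G (expmx (c *: map_mx jj (X a))).
Proof.
move=> aP; split.
  have nX : (c *: map_mx jj (X a)) ^+ n = 0.
    by rewrite expmxZ -map_mx_exp nilX // map_mx0 scaler0.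
  by case: (mulmx1_unit (expmxN pchar_ext nX)).
move=> p hp; pose co (L : fieldType) (x : L) (_ : 'I_1) := x.
have hF : polymx idfun jj (co C) (co K) (fun x => expmx (x *: map_mx idfun (X a)))
    (fun x => expmx (x *: map_mx jj (X a))).
  exact: (polymx_expmx (X a) (polyfun_var ord0)).
have h1 : polyfun idfun jj (co C) (co K) (fun x => mxeval idfun p (expmx (x *: X a)))
    (fun x => mxeval jj p (expmx (x *: map_mx jj (X a)))).
  by apply: polyfun_mmap => j; case/mxvec_indexP: j => r s; apply: (polyfun_ext (hF r s)) => x;
    rewrite mxvecE ?map_mxid.
have [q [q1 q2]] := h1; have q0 : q = 0.
  apply: (mpoly_eq0_infinite (i := (idfun : {rmorphism C -> C})) charC) => u.
  have := q1 (u ord0); rewrite hp; last exact: expX.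
  move=> e0; rewrite -[RHS]e0; apply: eq_bigr => m' _; congr (_ * _); apply: eq_bigr => j _.
  by rewrite (ord1 j).
by rewrite -q2 q0 mmap0.
Qed.

(** As in [exp_points], with a Laurent polynomial in the parameter, from which the denominator is
    cleared. *)
Lemma one_param_points j (z : K) : z != 0 -> points jj G (laurent_eval jj (t j) (const_mx z)).
Proof.
move=> z0; have [hT hTi _ _] := ht; have [_ _ _ hE _] := hTi j; split.
  rewrite tS // !unitmx_mul !map_unitmx unitmx_inv uS andbT /=.
  rewrite unitmxE unitfE det_diag; apply/prodf_neq0 => q _; by rewrite mxE expfz_neq0.
move=> p hp; pose co (L : fieldType) (x : L) q := row_mx (const_mx x : 'rV_1) (map_mx GRing.inv (const_mx x : 'rV_1)) 0 q.
have h1 : polyfun idfun jj (co C) (co K) (fun x => mxeval idfun p (laurent_eval idfun (t j) (const_mx x)))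
    (fun x => mxeval jj p (laurent_eval jj (t j) (const_mx x))).
  apply: polyfun_mmap => q; case/mxvec_indexP: q => r s.
  have h2 : polyfun idfun jj (co C) (co K) (fun x => mmap idfun (co C x) (t j r s))
      (fun x => mmap jj (co K x) (t j r s)) by exists (t j r s).
  by apply: (polyfun_ext h2) => x; rewrite mxvecE mxE.
have [P [P1 P2]] := h1; have L0 : laurent_poly (msize P) P = 0.
  apply: (poly_eq0_infinite charC) => x x0.
  have := laurent_polyE (idfun : {rmorphism C -> C}) (leqnn (msize P)) x0.
  rewrite map_poly_id //= -/(co C x) => <-; rewrite P1 hp ?mul0r //.
  by apply/TG/(hT j)/hE; exists (const_mx x) => // q; rewrite mxE.
have := laurent_polyE jj (leqnn (msize P)) z0; rewrite L0 map_poly0 horner0 -/(co K z) P2.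
by move=> /eqP; rewrite mulf_eq0 expf_eq0 (negbTE z0) andbF orbF => /eqP.
Qed.

Lemma points1 : points jj G 1%:M.
Proof.
have G1 : G 1%:M by apply/G_eqn/classical_eqn1.
by have := points_map jj (G_unit G1) G1; rewrite map_mx1.
Qed.

Lemma prod_points N (M : 'I_N -> 'M[K]_n) : (forall j, points jj G (M j)) ->
  points jj G (\prod_j M j).
Proof.
by move=> hM; apply: big_ind => // [|A B]; [apply: points1|apply: points_G_mul].
Qed.

Lemma cell_points x (z : 'rV[K]_l) y : Gm z ->
  points jj G (umap jj X beta x *m map_mx jj nw *m tmap jj t z *m umap jj X beta y).
Proof.
have hu v : points jj G (umap jj X beta v).
  by apply: prod_points => j; apply: exp_points; case: (beta_in j).
move=> gz; apply: points_G_mul => //; apply: points_G_mul; last first.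
  by apply: prod_points => j; apply: one_param_points.
by apply: points_G_mul => //; exact: (points_map jj (G_unit nw_G) nw_G).
Qed.

End Points.

End WeylElement.

End Coordinates.

Lemma mmap_ext (F E : fieldType) (i : F -> E) N (u v : 'I_N -> E) (p : {mpoly F[N]}) :
  u =1 v -> mmap i u p = mmap i v p.
Proof.
move=> uv; apply: eq_bigr => m _; congr (_ * _).
by apply: eq_bigr => k _; rewrite uv.
Qed.

(** * Algebraic independence of the coordinates of a chart *)

Section Independence.

Variables (C F E : fieldType) (jC : {rmorphism C -> F}) (i : {rmorphism F -> E}) (dE : E -> E).
Variables (n : nat) (G : 'M[C]_n -> Prop) (Y : 'M[E]_n).
Hypothesis charE : [pchar E] =i pred0.
Hypothesis G_unit : forall x, G x -> x \in unitmx.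
Hypothesis G_mul : forall x y, G x -> G y -> G (x *m y).
Hypothesis G_inv : forall x, G x -> G (invmx x).
Hypothesis G_det : forall x, G x -> \det x ^+ 2 = 1.
Hypothesis G_gal : forall g : 'M[C]_n, G g -> exists2 s : {rmorphism E -> E}, diff_galois dE i s
  & map_mx s Y = Y *m map_mx (i \o jC) g.
Hypothesis Y_pt : points (i \o jC) G Y.
Hypothesis Y_gen : generates i Y.

(* A chart of [G] by [N] parameters, those with indices [iv j] being invertible. *)
Variables (N l : nat) (iv : 'I_l -> 'I_N) (P : 'I_n -> 'I_n -> {mpoly F[N + l]}).

(** Inverses as extra variables make the chart polynomial, although the torus coordinates enter it
    through Laurent polynomials. *)
Definition with_inverses (v : 'rV[E]_N) : 'rV[E]_(N + l) := row_mx v (\row_j (v 0 (iv j))^-1).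

Variable chart : 'rV[E]_N -> 'M[E]_n.

Definition regular (v : 'rV[E]_N) : Prop := forall j, v 0 (iv j) != 0.

Hypothesis chartE : forall v r s, regular v -> chart v r s = mmap i (with_inverses v 0) (P r s).
Hypothesis chart_points : forall v, regular v -> points (i \o jC) G (chart v).
Hypothesis chart_inj : forall v v', regular v -> regular v' -> chart v = chart v' -> v = v'.

Notation ev := (mxeval i).

Lemma chart_independent v : regular v -> Y = chart v -> algebraically_independent i v.
Proof.
move=> rv eY p pv.
have [a [b [bY hv]]] := common_denominator Y_gen (with_inverses v 0).
(* The coordinates of [Y] as fractions in its entries, turned into functions of a variable matrix.
   Their identities at [Y] spread by [Y0] to all points of [G] where the denominator [b] does not
   vanish. *)
pose xi (A : 'M[E]_n) q := ev (a q) A / ev b A.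
have xiY : with_inverses v 0 =1 xi Y by move=> q; rewrite hv.
have Y0 f := ratfun_generic G_unit G_mul G_inv G_det G_gal Y_pt (b := b) (f := f).
have rxi q : ratfun i (fun A : 'M[E]_n => mxvec A 0) b (xi^~ q) by apply: ratfun_div.
have xiP A r s : points (i \o jC) G A -> ev b A != 0 -> mmap i (xi A) (P r s) = A r s.
  move=> PA bA; apply/eqP; rewrite -subr_eq0; apply/eqP.
  apply: (Y0 (fun A => mmap i (xi A) (P r s) - A r s)) PA bA => //; last first.
    by rewrite -(mmap_ext i (P r s) xiY) -chartE // -eY subrr.
  have h1 := ratfunM (ratfun_const i (fun A : 'M[E]_n => mxvec A 0) b (-1))
    (ratfun_poly i (fun A : 'M[E]_n => mxvec A 0) b 'X_(mxvec_index r s)).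
  apply: (ratfun_ext (ratfunD (ratfun_mmap (P r s) rxi) h1)) => B _.
  by rewrite mmapX mmap1U mxvecE rmorphN rmorph1 mulN1r.
have xi_inv A j : points (i \o jC) G A -> ev b A != 0 ->
    xi A (lshift l (iv j)) * xi A (rshift N j) = 1.
  move=> PA bA; apply/eqP; rewrite -subr_eq0; apply/eqP.
  apply: (Y0 (fun A => xi A (lshift l (iv j)) * xi A (rshift N j) - 1)) PA bA => //; last first.
    by rewrite -!xiY /with_inverses row_mxEl row_mxEr mxE mulfV ?subrr.
  apply: (ratfun_ext (ratfunD (ratfunM (rxi _) (rxi _)) (ratfun_const i _ b (-1)))) => B _.
  by rewrite rmorphN rmorph1.
have xi_p A : points (i \o jC) G A -> ev b A != 0 -> mmap i (fun q => xi A (lshift l q)) p = 0.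
  move=> PA bA; apply: (Y0 (fun A => mmap i (fun q => xi A (lshift l q)) p)) PA bA => //.
    by apply: ratfun_mmap => q; apply: rxi.
  by rewrite -[RHS]pv; apply: mmap_ext => q; rewrite -xiY /with_inverses row_mxEl.
have claim u : regular u -> ev b (chart u) != 0 -> mmap i (u 0) p = 0.
  move=> ru bu; have Pu := chart_points ru.
  pose u' := \row_q xi (chart u) (lshift l q).
  have ru' : regular u'.
    move=> j; rewrite mxE; apply/eqP => h0; have := xi_inv _ j Pu bu.
    by rewrite h0 mul0r => /esym/eqP; rewrite oner_eq0.
  have eu : with_inverses u' 0 =1 xi (chart u).
    move=> q; rewrite /with_inverses; case: (split_ordP q) => q' ->.
      by rewrite row_mxEl mxE.
    rewrite row_mxEr !mxE; have h1 := xi_inv _ q' Pu bu.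
    have nz : xi (chart u) (lshift l (iv q')) != 0 by have := ru' q'; rewrite mxE.
    by apply: (mulfI nz); rewrite h1 mulfV.
  (* Both [u'] and [u] are coordinates of the matrix [chart u]. *)
  have <- : u' = u.
    apply: chart_inj => //; apply/matrixP => r s.
    by rewrite chartE // (mmap_ext i _ eu) xiP.
  by rewrite -[RHS](xi_p _ Pu bu); apply: mmap_ext => q; rewrite mxE.
pose den : {mpoly F[N]} := \prod_j 'X_(iv j).
have evX u q : mmap i (u : 'I_N -> E) 'X_q = u q by rewrite mmapX mmap1U.
have den_reg (u : 'rV[E]_N) : mmap i (u 0) den != 0 <-> regular u.
  rewrite rmorph_prod /=; split=> [/prodf_neq0 h j|h]; first by have := h j isT; rewrite evX.
  by apply/prodf_neq0 => j _; rewrite evX.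
pose co (u : 'rV[E]_N) := u 0.
have rinv q : ratfun i co den (fun u => with_inverses u 0 q).
  rewrite /with_inverses; case: (split_ordP q) => q' ->.
    by apply: (ratfun_ext (ratfun_poly i co den 'X_q')) => u _; rewrite row_mxEl evX.
  apply: (ratfun_ext (ratfun_div i co den (\prod_(j | j != q') 'X_(iv j)))) => u /den_reg ru.
  rewrite row_mxEr mxE /den [\prod_j 'X_(iv j)](bigD1 q') //= rmorphM /= evX.
  have nz : mmap i (u 0) (\prod_(j | j != q') 'X_(iv j)) != 0.
    by rewrite rmorph_prod /=; apply/prodf_neq0 => j _; rewrite evX.
  by rewrite invfM mulrCA mulfV ?mulr1.
have [d [Q hQ]] : ratfun i co den (fun u => ev b (chart u)).
  apply: ratfun_mmap => q; case/mxvec_indexP: q => r s.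
  apply: (ratfun_ext (ratfun_mmap (P r s) rinv)) => u /den_reg ru.
  by rewrite mxvecE chartE.
(* The factors [den] and [Q] absorb the parameters that are not regular or at which [b] vanishes.
   Neither is the zero polynomial, since both are nonzero at [v], so [p] is. *)
have : p * Q * den = 0.
  apply: (mpoly_eq0_infinite (i := i) charE) => u; rewrite !rmorphM /=.
  pose ur := \row_q u q; have eu : u =1 ur 0 by move=> q; rewrite mxE.
  rewrite !(mmap_ext i _ eu); have [->|dn] := eqVneq (mmap i (ur 0) den) 0; first by rewrite mulr0.
  rewrite (hQ ur dn); have [->|bn] := eqVneq (ev b (chart ur)) 0; first by rewrite mulr0 mulr0 mul0r.
  by rewrite (claim ur) ?mul0r //; apply/den_reg.
have dv : mmap i (v 0) den != 0 by apply/den_reg.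
move=> /eqP; rewrite !mulf_eq0 => /orP [/orP [/eqP //|/eqP Q0]|/eqP d0]; last first.
  by rewrite d0 mmap0 eqxx in dv.
have := hQ v dv; rewrite Q0 mmap0 => /esym/eqP.
by rewrite mulf_eq0 expf_eq0 (negbTE dv) andbF -eY (negbTE bY).
Qed.

End Independence.

(** * The big cell as a chart *)

Lemma cell_polynomial (C K : fieldType) (jj : {rmorphism C -> K}) m n l (h : {vspace 'M[C]_n})
    (X : dualv h -> 'M[C]_n) (beta : m.-tuple (dualv h)) (t : 'I_l -> 'M[{mpoly C[1 + 1]}]_n)
    (B : 'M[C]_n) (iv := fun j : 'I_l => rshift m (lshift m j)) :
  exists P : 'I_n -> 'I_n -> {mpoly C[m + (l + m) + l]}, forall (v : 'rV[K]_(m + (l + m))) r s,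
    (umap jj X beta (lsubmx v) *m map_mx jj B *m tmap jj t (lsubmx (rsubmx v))
      *m umap jj X beta (rsubmx (rsubmx v))) r s = mmap jj (with_inverses iv v 0) (P r s).
Proof.
pose co (v : 'rV[K]_(m + (l + m))) := with_inverses iv v 0.
pose pm := @polymx C K K jj jj _ _ _ co co n n.
have hvar q : polyfun jj jj co co (fun v => v 0 q) (fun v => v 0 q).
  by apply: (polyfun_ext (polyfun_var (lshift l q))) => v; rewrite /co /with_inverses row_mxEl.
have hu (f : 'I_m -> 'I_(m + (l + m))) (x : 'rV[K]_(m + (l + m)) -> 'rV[K]_m) :
    (forall v j, x v 0 j = v 0 (f j)) -> pm (fun v => umap jj X beta (x v)) (fun v => umap jj X beta (x v)).
  move=> xf; apply: polymx_prod => j; apply: polymx_expmx.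
  by apply: (polyfun_ext (hvar (f j))) => v; rewrite xf.
have ht : pm (fun v => tmap jj t (lsubmx (rsubmx v))) (fun v => tmap jj t (lsubmx (rsubmx v))).
  apply: polymx_prod => j r s.
  pose g (v : 'rV[K]_(m + (l + m))) (k : 'I_(1 + 1)) : K := row_mx (const_mx (lsubmx (rsubmx v) 0 j))
     (map_mx GRing.inv (const_mx (lsubmx (rsubmx v) 0 j) : 'rV[K]_1)) 0 k.
  have hg k : polyfun jj jj co co (g^~ k) (g^~ k).
    rewrite /g; case: (split_ordP k) => k' ->.
      by apply: (polyfun_ext (hvar (iv j))) => v; rewrite row_mxEl !mxE.
    apply: (polyfun_ext (polyfun_var (rshift _ j))) => v;
      by rewrite /co /with_inverses !row_mxEr !mxE.
  by apply: (polyfun_ext (polyfun_mmap (t j r s) hg)) => v; rewrite mxE.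
have hP := polymx_mul (polymx_mul (polymx_mul (hu (@lshift m (l + m)) lsubmx _) (polymx_const B)) ht)
  (hu (fun j => rshift m (rshift l j)) (fun v => rsubmx (rsubmx v)) _).
have [||P hP'] := fin_all_exists (fun r => fin_all_exists (hP _ _ r)).
- by move=> v j; rewrite mxE.
- by move=> v j; rewrite !mxE.
by exists P => v r s; have [-> _] := hP' r s.
Qed.

Theorem proposition4p5
    (C : closedFieldType) (charC : [pchar C] =i pred0)
    (* the classical group G, its torus and Lie algebras *)
    (l n : nat) (G : 'M[C]_n -> Prop) (hG : classical_group l G)
    (T : 'M[C]_n -> Prop) (hT : maximal_torus G T)
    (g h : {vspace 'M[C]_n})
    (hg : forall A, A \in g <-> lie idfun G A)
    (hh : forall A, A \in h <-> lie idfun T A)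
    (* roots and Chevalley basis *)
    (Phi : seq (dualv h)) (hPhi : root_system g Phi)
    (Delta : 'I_l -> dualv h) (k : dualv h -> 'I_l -> int)
    (hDelta : root_basis Phi Delta k)
    (H : 'I_l -> subvs_of h) (X : dualv h -> 'M[C]_n)
    (hX : chevalley_basis g Phi Delta H X)
    (m : nat) (beta : m.-tuple (dualv h))
    (hbeta : negative_root_numbering Phi k beta)
    (* the one-dimensional tori T_i and their parametrizations t_i *)
    (Ti : 'I_l -> 'M[C]_n -> Prop) (t : 'I_l -> 'M[{mpoly C[1 + 1]}]_n)
    (ht : torus_parametrization T H Ti t)
    (* the longest Weyl group element and its representative *)
    (w : dualv h -> dualv h) (hw : longest Delta H w)
    (nw : 'M[C]_n) (hnw : weyl_representative G T w nw)
    (* the differential field F and the extension E/F *)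
    (F : fieldType) (dF : F -> F) (hdF : derivation dF)
    (jC : {rmorphism C -> F}) (hC : has_constants dF jC)
    (E : fieldType) (dE : E -> E) (i : {rmorphism F -> E})
    (Y : 'M[E]_n) (hY : full_primitive jC dF dE i G Y) :
  exists (x : 'rV[E]_m) (z : 'rV[E]_l) (y : 'rV[E]_m),
    algebraically_independent i (row_mx x (row_mx z y))
    /\ Y = umap (i \o jC) X beta x *m map_mx (i \o jC) nw
           *m tmap (i \o jC) t z *m umap (i \o jC) X beta y.
Proof.
(* The four families are brought to one shape: no form for the special linear groups, and no
   condition on the determinant for the symplectic ones. *)
have [oJ [b [data G_eqn]]] : exists (oJ : option 'M[C]_n) b, classical_data l oJ b /\
    forall x, G x <-> classical_eqn oJ b x.
  case: hG => [[l0 en hG']|[l0 en [J [sJ uJ hG']]]|[l0 en [J [sJ uJ hG']]]|[l0 en [J [sJ uJ hG']]]].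
  - exists None, true; split=> // x; rewrite hG'; split=> [dx|[_ ->]] //.
  - exists (Some J), true; split; first by split=> //; split=> //; [left|right].
    by move=> x; rewrite hG'; split=> [[fx dx]|[fx dx]]; split=> //; apply: dx.
  - exists (Some J), false; split; first by split=> //; split=> //; [right|left].
    by move=> x; rewrite hG'; split=> [fx|[]].
  - exists (Some J), true; split; first by split; [apply: ltnW|split=> //; left].
    by move=> x; rewrite hG'; split=> [[fx dx]|[fx dx]]; split=> //; apply: dx.
have TG : forall x, T x -> G x by case: hT.
have [S [e [uS tS]]] := one_param_diag charC ht.
have [_ gal Ypt Ygen _] := hY.
pose jj : {rmorphism C -> E} := i \o jC.
have [s [cell_ex cell_inj]] := big_cell_points charC hg hh data G_eqn TG hPhi hDelta hX ht uS tS hw hnw jj hbeta.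
have cell_pt := cell_points charC hg hh data G_eqn TG hPhi hDelta hX ht uS tS hnw jj hbeta.
have G_unit x : G x -> x \in unitmx by move=> /G_eqn/(classical_eqn_unit data) [].
have G_det x : G x -> \det x ^+ 2 = 1 by move=> /G_eqn/(classical_eqn_unit data) [].
have G_mul x y : G x -> G y -> G (x *m y) by rewrite !G_eqn; apply: classical_eqn_mul.
have G_inv x : G x -> G (invmx x).
  by move=> Gx; apply/G_eqn/classical_eqn_inv; [apply: G_unit|apply/G_eqn].
have G_gal x : G x -> exists2 s : {rmorphism E -> E}, diff_galois dE i s & map_mx s Y = Y *m map_mx jj x.
  by move/gal.
have Gnw : G nw by case: hnw.
have unw := G_unit _ Gnw.
have eY : classical_eqn (omap (map_mx jj) oJ) b Y.
  by apply: (points_classical (G := G)) => // x /G_eqn.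
have [q|x [z [y [gz defY]]]] := cell_ex Y eY Ypt.1.
  apply/eqP => det0.
  (* The minors are polynomials, and do not vanish at [nw]. *)
  pose pid := @polymx_id C E jj n.
  have pd : polyfun idfun jj (fun A : 'M[C]_n => mxvec A 0) (fun A : 'M[E]_n => mxvec A 0)
      (fun A => \det (corner q (permuted s (map_mx idfun (invmx S) *m (map_mx idfun (invmx nw) *m A) *m map_mx idfun S))))
      (fun A => \det (corner q (permuted s (map_mx jj (invmx S) *m (map_mx jj (invmx nw) *m A) *m map_mx jj S)))).
    apply: polyfun_det => r c.
    have h1 := polymx_mul (polymx_mul (polymx_const (invmx S)) (polymx_mul (polymx_const (invmx nw)) pid)) (polymx_const S).
    case rc: ((r < q)%N && (c < q)%N).
      by apply: (polyfun_ext (h1 (s r) (s c))) => A; rewrite [in RHS]mxE rc [in RHS]mxE.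
    by apply: (polyfun_ext (polyfun_const (r == c)%:R)) => A; rewrite mxE rc ?rmorph_nat.
  have [Q [_ hQ]] := pd.
  have evQ A : mxeval i (map_mpoly jC Q) A = mmap jj (mxvec A 0) Q by apply: mmap_map_mpoly.
  have := generic_point G_unit G_mul G_inv G_det G_gal Ypt (Q := map_mpoly jC Q).
  rewrite evQ hQ !map_invmx => /(_ det0 _ (points_map jj unw Gnw)).
  rewrite evQ hQ !map_invmx mulVmx ?map_unitmx // mulmx1 mulVmx ?map_unitmx //.
  have -> : corner q (permuted s (1%:M : 'M[E]_n)) = 1%:M.
    by apply/matrixP => r c; rewrite !mxE (inj_eq perm_inj); case: ifP.
  by rewrite det1 => /eqP; rewrite oner_eq0.
exists x, z, y; split=> //.
have [P hP] := cell_polynomial jj X beta t nw.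
pose iv (j : 'I_l) := rshift m (lshift m j) : 'I_(m + (l + m)).
pose chart (v : 'rV[E]_(m + (l + m))) := umap jj X beta (lsubmx v) *m map_mx jj nw
  *m tmap jj t (lsubmx (rsubmx v)) *m umap jj X beta (rsubmx (rsubmx v)).
have regE v : regular iv v -> Gm (lsubmx (rsubmx v)) by move=> rv j; rewrite !mxE; apply: (rv j).
have chart_xzy : chart (row_mx x (row_mx z y)) = Y.
  by rewrite /chart row_mxKl !row_mxKr row_mxKl -defY.
apply: (chart_independent _ G_unit G_mul G_inv G_det G_gal Ypt Ygen (iv := iv)
  (P := fun r c => map_mpoly jC (P r c)) (chart := chart)) => //.
- by move=> p; rewrite (fmorph_pchar jj) charC.
- by move=> v r c _; rewrite /chart hP mmap_map_mpoly.
- by move=> v /regE rv; apply: cell_pt.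
- move=> v v' /regE rv /regE rv' /cell_inj [] // e1 e2 e3.
  by rewrite -[v]hsubmxK -[v']hsubmxK e1 -[rsubmx v]hsubmxK -[rsubmx v']hsubmxK e2 e3.
- by move=> j; rewrite row_mxEr row_mxEl.
Qed.
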